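(* Let $p\ge0$ be an integer. There is a constant $C_1(p,\mathcal M_2)$ depending only on $p$ such that the following holds. Let $Q\in W^{p+1,2}([0,b],\mathcal M_2)$, let $N>p+1$ be an integer and $0<x\le b$, and set $$\epsilon_{2,N}(x):=\frac{C_1(p,\mathcal M_2)\,x^{p+1}}{N^{p+1}}\,\bigl\|\partial_t^{p+1}K(x,\cdot)\bigr\|_{L_2(-x,x)}.$$ (a) For $\lambda\in\mathbb R$, $\left|U(\lambda,x)-U^N(\lambda,x)\right|\le\sqrt{2x}\,\epsilon_{2,N}(x)$. (b) If $\lambda\in\mathbb C$ with $\operatorname{Im}\lambda\neq0$, then $$\left|U(\lambda,x)-U^N(\lambda,x)\right|\le\epsilon_{2,N}(x)\sqrt{\frac{e^{2|\operatorname{Im}\lambda|x}-1}{|\operatorname{Im}\lambda|}}.$$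
   Context: Fix $b>0$. $\mathcal M_2$ is the algebra of complex $2\times2$ matrices with the operator norm $|\cdot|$ induced by the Euclidean norm of $\mathbb C^2$; $I$ is the identity; for matrix-valued $A$, $\|A\|_{L_2(c,d)}=(\int_c^d|A(t)|^2dt)^{1/2}$. $W^{r,2}([0,b],\mathcal M_2)$ is the space of matrix functions whose derivatives of order at most $r-1$ are absolutely continuous and whose $r$-th derivative is in $L^2$. Let $B=\begin{pmatrix}0&1\\-1&0\end{pmatrix}$ and $Q(x)=\begin{pmatrix}p_1(x)&q_1(x)\\ q_1(x)&-p_1(x)\end{pmatrix}$ with $p_1,q_1$ complex valued. For $\lambda\in\mathbb C$, $U(\lambda,x)$ is the matrix solution of $B\,dU/dx+Q(x)U=\lambda U$ on $(0,b)$ with $U(\lambda,0)=I$, and $U_0(\lambda,x)=\begin{pmatrix}\cos\lambda x&-\sin\lambda x\\ \sin\lambda x&\cos\lambda x\end{pmatrix}$. $K$ is the transmutation kernel of $Q$: the continuous $\mathcal M_2$-valued function on $\Omega^+=\{(x,t):0\le x\le b,\ |t|\le x\}$ such that $U(\lambda,x)=U_0(\lambda,x)+\int_{-x}^xK(x,t)U_0(\lambda,t)\,dt$ for all $\lambda\in\mathbb C$, $0<x\le b$. $\partial_t$ is the (weak) derivative in the second variable. With $P_n$ the Legendre polynomial of degree $n$, $K_n(x)=\frac{2n+1}{2}\int_{-x}^xK(x,t)P_n(t/x)\,dt$. Put $\tilde K_n(x)=2(-1)^{n/2}K_n(x)$ for $n$ even and $\tilde K_n(x)=2(-1)^{(n+1)/2}K_n(x)B$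 for $n$ odd. With $j_n$ the spherical Bessel function of the first kind of order $n$, $U^N(\lambda,x)=U_0(\lambda,x)+\sum_{n=0}^N\tilde K_n(x)j_n(\lambda x)$. *)

(* Defs.v *)
(* MathComp / MathComp-Analysis; complex numbers are R[i] from real-closed,
   over an arbitrary R : realType. *)
From HB Require Import structures.
From mathcomp Require Import all_boot all_order all_algebra.
From mathcomp Require Import complex.
From mathcomp Require Import all_classical all_reals all_analysis.

Set Implicit Arguments.
Unset Strict Implicit.
Unset Printing Implicit Defensive.

Import Order.TTheory GRing.Theory Num.Theory.
Import numFieldNormedType.Exports.

Local Open Scope classical_set_scope.
Local Open Scope complex_scope.
Local Open Scope ring_scope.

Section ComplexFunctions.
Variable R : realType.
Implicit Types z : R[i].

Definition cexp z : R[i] :=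
  (expR (complex.Re z))%:C * (cos (complex.Im z) +i* sin (complex.Im z)).

Definition ccos z : R[i] := (cexp ('i%C * z) + cexp (- ('i%C * z))) / 2%:R.

Definition csin z : R[i] :=
  (cexp ('i%C * z) - cexp (- ('i%C * z))) / (2%:R * 'i%C).

Definition cseries_sum (u : nat -> R[i]) : R[i] :=
  limn (series (fun k => complex.Re (u k))) +i*
  limn (series (fun k => complex.Im (u k))).

(* (2m+1)!! *)
Definition odd_dfact (m : nat) : nat := (\prod_(i < m.+1) (2 * i + 1))%N.

(* j_n z = z^n \sum_k (-1)^k z^(2k) / (2^k k! (2n+2k+1)!!), which is the power
   series of sqrt (pi / (2 z)) J_{n + 1/2} z; it also covers z = 0. *)
Definition sph_bessel (n : nat) z : R[i] :=
  z ^+ n * cseries_sum (fun k =>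
    (-1) ^+ k * z ^+ (2 * k) / (2 ^ k * k`! * odd_dfact (n + k))%:R).

(* Rodrigues' formula *)
Definition legendre (n : nat) : {poly R} :=
  ((2 ^ n * n`!)%:R)^-1 *: (('X^2 - 1) ^+ n)^`(n)%R.

End ComplexFunctions.

Section MatrixFunctions.
Variable R : realType.
Local Notation M2 := 'M[R[i]]_2.
Implicit Types (c d : R) (f : R -> M2).

Definition mx2 (T : Type) (a b c d : T) : 'M[T]_2 :=
  \matrix_(i, j) if i == 0 then (if j == 0 then a else b)
                 else (if j == 0 then c else d).

Definition enorm (v : 'cV[R[i]]_2) : R :=
  Num.sqrt (\sum_i (complex.Re (v i 0) ^+ 2 + complex.Im (v i 0) ^+ 2)).

Definition opnorm (A : M2) : R :=
  sup [set enorm (A *m v) | v in [set v | enorm v <= 1]].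

(* M2 is treated as an 8-dimensional real space: P holds for all the real and
   imaginary parts of the entries. *)
Definition componentwise (T : Type) (P : (T -> R) -> Prop) (f : T -> M2) :=
  forall i j, P (fun t => complex.Re (f t i j)) /\
              P (fun t => complex.Im (f t i j)).

Definition mx_int c d f : M2 := \matrix_(i, j)
  ((\int[@lebesgue_measure R]_(t in `]c, d[) complex.Re (f t i j)) +i*
   (\int[@lebesgue_measure R]_(t in `]c, d[) complex.Im (f t i j))).

Definition is_mx_derive (x : R) f (D : M2) := forall i j,
  is_derive x (1 : R) (fun t => complex.Re (f t i j)) (complex.Re (D i j)) /\
  is_derive x (1 : R) (fun t => complex.Im (f t i j)) (complex.Im (D i j)).

Definition in_L2 c d f :=
  componentwise (fun g => measurable_fun `]c, d[ g) f /\
  (@lebesgue_measure R).-integrable `]c, d[ (fun t => (opnorm (f t) ^+ 2)%:E).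

Definition L2norm c d f : R :=
  Num.sqrt (\int[@lebesgue_measure R]_(t in `]c, d[) (opnorm (f t) ^+ 2)).

Definition abs_continuous c d (g : R -> R) :=
  forall e : R, 0 < e -> exists2 delta : R, 0 < delta &
  forall (n : nat) (u v : 'I_n -> R),
    (forall i, c <= u i /\ u i <= v i /\ v i <= d) ->
    (forall i j, i != j -> v i <= u j \/ v j <= u i) ->
    \sum_i (v i - u i) < delta ->
    \sum_i `|g (v i) - g (u i)| < e.

(* W^{r,2}([c,d], M2).  F k is the k-th derivative of f; for k < r - 1 the
   continuity of F k.+1 turns the a.e. equality into an everywhere one. *)
Definition sobolev (r : nat) c d f := exists F : nat -> R -> M2,
  [/\ forall t, t \in `[c, d] -> F 0%N t = f t,
      forall k, (k < r)%N -> componentwise (abs_continuous c d) (F k),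
      forall k, (k < r)%N -> {ae @lebesgue_measure R, forall t : R,
        t \in `]c, d[ -> is_mx_derive t (F k) (F k.+1 t)} &
      in_L2 c d (F r)].

Definition test_function c d (phi : R -> R) :=
  (forall (k : nat) (t : R), derivable (derive1n k phi) t 1) /\
  exists c' d' : R, [/\ c < c', d' < d &
    forall t, t \notin `[c', d'] -> phi t = 0].

Definition is_L2_weak_derive (m : nat) c d f (D : R -> M2) :=
  in_L2 c d D /\
  forall phi, test_function c d phi ->
    mx_int c d (fun t => (derive1n m phi t)%:C *: f t) =
    (-1) ^+ m *: mx_int c d (fun t => (phi t)%:C *: D t).

End MatrixFunctions.

Section Dirac.
Variable R : realType.
Local Notation M2 := 'M[R[i]]_2.

Definition Bmx : M2 := mx2 0 1 (-1) 0.

Definition Qmx (p1 q1 : R -> R[i]) (x : R) : M2 :=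
  mx2 (p1 x) (q1 x) (q1 x) (- p1 x).

Definition U0 (lam : R[i]) (x : R) : M2 :=
  mx2 (ccos (lam * x%:C)) (- csin (lam * x%:C))
      (csin (lam * x%:C)) (ccos (lam * x%:C)).

(* Used for continuous Q only, so solutions are taken in the classical
   sense. *)
Definition is_dirac_solution (b : R) (Q : R -> M2) (U : R[i] -> R -> M2) :=
  forall lam,
  [/\ U lam 0 = 1%:M,
      componentwise (fun g => {within `[0, b], continuous g}) (U lam) &
      forall x, x \in `]0, b[ -> exists2 dU : M2, is_mx_derive x (U lam) dU &
        Bmx *m dU + Q x *m U lam x = lam *: U lam x].

Definition is_transmutation_kernel (b : R) (U : R[i] -> R -> M2)
    (K : R -> R -> M2) :=
  componentwise (fun g : R * R -> R =>
    {within [set z : R * R | 0 <= z.1 <= b /\ `|z.2| <= z.1], continuous g})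
    (fun z => K z.1 z.2) /\
  forall (lam : R[i]) (x : R), 0 < x <= b ->
    U lam x = U0 lam x + mx_int (- x) x (fun t => K x t *m U0 lam t).

Definition Kcoef (K : R -> R -> M2) (n : nat) (x : R) : M2 :=
  ((2 * n + 1)%:R / 2%:R) *:
  mx_int (- x) x (fun t => ((legendre R n).[t / x])%:C *: K x t).

Definition Ktilde (K : R -> R -> M2) (n : nat) (x : R) : M2 :=
  if odd n then (2%:R * (-1) ^+ (n.+1)./2) *: (Kcoef K n x *m Bmx)
  else (2%:R * (-1) ^+ n./2) *: Kcoef K n x.

Definition UN (K : R -> R -> M2) (N : nat) (lam : R[i]) (x : R) : M2 :=
  U0 lam x + \sum_(n < N.+1) sph_bessel n (lam * x%:C) *: Ktilde K n x.

End Dirac.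

(* Main.v *)
(* Diagonalising B turns the Dirac system into two Zakharov-Shabat systems. By
   uniqueness of Fourier transforms, the transmutation formula says that suitable
   combinations of the entries of K solve, in characteristic coordinates, a Goursat
   problem whose data are the entries of Q. The derivative of a solution along the
   lines u + v = x solves a Goursat problem of the same kind, hence K(x, .) has as
   many derivatives as Q.
   If f on [-x, x] has its derivative in L2, Bessel's inequality for the functions
   (x^2 - t^2) P_n'(t / x) gives |f - S_N f| <= x / (N + 1) |f'|, where S_N f is the
   Legendre partial sum. Subtracting from f a primitive of S_(N-1) f' replaces the
   last norm by |f' - S_(N-1) f'|, and p + 1 iterations bound K - S_N K by a multiple
   of (x / N)^(p + 1). As P_n(s) exp(i z s) has integral 2 i^n j_n(z) over [-1, 1],
   U - U^N is the integral of (K - S_N K) U_0, to which the Cauchy-Schwarz inequality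
   applies. *)
Require Import Defs.
From HB Require Import structures.
From mathcomp Require Import all_boot all_order all_algebra.
From mathcomp Require Import complex ring lra zify.
From mathcomp Require Import all_classical all_reals all_analysis measurable_realfun.

Set Implicit Arguments.
Unset Strict Implicit.
Unset Printing Implicit Defensive.

Import Order.TTheory GRing.Theory Num.Theory.
Import numFieldNormedType.Exports.

Local Open Scope classical_set_scope.
Local Open Scope complex_scope.
Local Open Scope ring_scope.

(** * Integration on a segment *)

(** [K] is given only through the transmutation identity, with no differential equation, so its
    smoothness has to be extracted from that identity; real spectral parameters suffice for this.
    Since p1 and q1 are complex valued, the system for e = -i is not the conjugate of the one for e
    = i, and both are needed to recover the four entries of K. The top derivative of Q is only
    square integrable, so every equation is kept in integrated form: a function is differentiated by
    exhibiting it as a primitive ([dens]), and the product rule as well as differentiation along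
    characteristics become exchanges of the order of integration. The constant is 64 (p + 1)^(p +
    1). The power comes from comparing N - p, the smallest projection index that the p + 1
    iterations guarantee, with N; the factor 64 from passing between the operator norm and the real
    and imaginary parts of the entries. *)

Section IntervalIntegral.
Variable R : realType.
Local Notation mu := (@lebesgue_measure R).
Implicit Types (a b c d x : R) (f g h : R -> R).

(* Int a b f = 0 when b < a. *)
Definition Int a b f : R := \int[mu]_(t in `[a, b]) f t.

Definition intg a b f := mu.-integrable `[a, b] (EFin \o f).

Lemma eq_Int a b f g : (forall t, a <= t <= b -> f t = g t) ->
  Int a b f = Int a b g.
Proof. by move=> fg; apply: eq_Rintegral => t; rewrite inE /= in_itv /= => /fg. Qed.

Lemma eq_intg a b f g : (forall t, a <= t <= b -> f t = g t) ->
  intg a b f -> intg a b g.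
Proof.
move=> fg; apply: eq_integrable => // t; rewrite inE /= in_itv /= => /fg.
by move=> ->.
Qed.

Lemma intg_meas a b f : intg a b f -> measurable_fun `[a, b] f.
Proof. by case/integrableP => /measurable_EFinP. Qed.

Lemma intg_cont a b f : continuous f -> intg a b f.
Proof.
move=> cf; apply: continuous_compact_integrable; first exact: segment_compact.
exact: continuous_subspaceT.
Qed.

Lemma intgD a b f g : intg a b f -> intg a b g -> intg a b (fun t => f t + g t).
Proof. by move=> hf hg; apply: eq_integrable (integrableD _ hf hg). Qed.

Lemma intgN a b f : intg a b f -> intg a b (fun t => - f t).
Proof. by move=> hf; apply: eq_integrable (integrableN hf). Qed.

Lemma intgB a b f g : intg a b f -> intg a b g -> intg a b (fun t => f t - g t).
Proof. by move=> hf hg; apply: intgD => //; exact: intgN. Qed.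

Lemma intgZ a b k f : intg a b f -> intg a b (fun t => k * f t).
Proof. by move=> hf; apply: eq_integrable (integrableZl _ k hf). Qed.

Lemma intgZr a b k f : intg a b f -> intg a b (fun t => f t * k).
Proof. by move=> hf; apply: eq_intg (intgZ k hf) => t _; rewrite mulrC. Qed.

Lemma intg_cst a b k : intg a b (fun=> k).
Proof. by apply: intg_cont; exact: cst_continuous. Qed.

Lemma intg_sum (I : Type) (s : seq I) (P : pred I) a b (F : I -> R -> R) :
  (forall i, intg a b (F i)) -> intg a b (fun t => \sum_(i <- s | P i) F i t).
Proof.
move=> hF; elim: s => [|i s ih].
  by apply: (eq_intg _ (intg_cst a b 0)) => t _; rewrite big_nil.
case Pi : (P i).
  by apply: (eq_intg _ (intgD (hF i) ih)) => t _; rewrite big_cons Pi.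
by apply: (eq_intg _ ih) => t _; rewrite big_cons Pi.
Qed.

Lemma intg_norm a b f : intg a b f -> intg a b (fun t => `|f t|).
Proof. by move=> hf; exact: integrable_norm. Qed.

Lemma intgS a b c d f : a <= c -> d <= b -> intg a b f -> intg c d f.
Proof.
move=> ac db; apply: integrableS => //; by apply: subset_itvScc; rewrite bnd_simp.
Qed.

Lemma IntD a b f g : intg a b f -> intg a b g ->
  Int a b (fun t => f t + g t) = Int a b f + Int a b g.
Proof. by move=> hf hg; exact: RintegralD. Qed.

Lemma IntB a b f g : intg a b f -> intg a b g ->
  Int a b (fun t => f t - g t) = Int a b f - Int a b g.
Proof. by move=> hf hg; exact: RintegralB. Qed.

Lemma IntZ a b k f : intg a b f -> Int a b (fun t => k * f t) = k * Int a b f.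
Proof. by move=> hf; exact: RintegralZl. Qed.

Lemma IntZr a b k f : intg a b f -> Int a b (fun t => f t * k) = Int a b f * k.
Proof. by move=> hf; exact: RintegralZr. Qed.

Lemma IntN a b f : intg a b f -> Int a b (fun t => - f t) = - Int a b f.
Proof.
by move=> hf; rewrite -mulN1r -IntZ//; apply: eq_Int => t _; rewrite mulN1r.
Qed.

Lemma Int_cst a b k : a <= b -> Int a b (fun=> k) = k * (b - a).
Proof.
move=> ab; rewrite /Int Rintegral_cst//; congr (_ * _).
transitivity (fine (if (a%:E < b%:E)%E then (b%:E - a%:E)%E else 0%E)).
  by congr fine; exact: (@lebesgue_measure_itv R `[a, b]).
rewrite lte_fin; case: ltP => // ba; have -> : b = a by apply/eqP; rewrite eq_le ab ba.
by rewrite subrr.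
Qed.

Lemma Int_sum (I : Type) (s : seq I) (P : pred I) a b (F : I -> R -> R) :
  (forall i, intg a b (F i)) ->
  Int a b (fun t => \sum_(i <- s | P i) F i t) = \sum_(i <- s | P i) Int a b (F i).
Proof.
move=> hF; elim: s => [|i s ih].
  rewrite big_nil (@eq_Int a b _ (fun=> 0)); last by move=> t _; rewrite big_nil.
  by rewrite /Int /Rintegral integral0.
rewrite big_cons; case Pi : (P i).
  rewrite -ih -IntD//; last exact: intg_sum.
  by apply: eq_Int => t _; rewrite big_cons Pi.
by rewrite -ih; apply: eq_Int => t _; rewrite big_cons Pi.
Qed.

Lemma Int_ge0 a b f : (forall t, a <= t <= b -> 0 <= f t) -> 0 <= Int a b f.
Proof. by move=> f0; apply: Rintegral_ge0 => t; rewrite /= in_itv /=; exact: f0. Qed.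

Lemma le_Int a b f g : intg a b f -> intg a b g ->
  (forall t, a <= t <= b -> f t <= g t) -> Int a b f <= Int a b g.
Proof.
move=> hf hg fg; apply: le_Rintegral => // t; rewrite /= in_itv /=; exact: fg.
Qed.

Lemma le_normr_Int a b f : intg a b f -> `|Int a b f| <= Int a b (fun t => `|f t|).
Proof. by move=> hf; exact: le_normr_Rintegral. Qed.

Lemma Int_bound a b f M : a <= b -> intg a b f ->
  (forall t, a <= t <= b -> `|f t| <= M) -> `|Int a b f| <= M * (b - a).
Proof.
move=> ab hf hM; rewrite -(Int_cst M ab); apply: le_trans (le_normr_Int hf) _.
by apply: le_Int => //; [exact: intg_norm|exact: intg_cst].
Qed.

Lemma Int_chasles a b c f : a <= c -> c <= b -> intg a b f ->
  Int a b f = Int a c f + Int c b f.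
Proof.
move=> ac cb hf; have := @Rintegral_itvB R f (BLeft a) (BRight b) c hf.
rewrite !bnd_simp => /(_ ac cb) h.
have e : \int[mu]_(t in `]c, b]) f t = Int c b f.
  apply: Rintegral_itv_obnd_cbnd; apply: integrableS hf => //.
  by apply: subset_itv; rewrite bnd_simp.
by rewrite -e -h addrC subrK.
Qed.

Lemma Int_pt a f : Int a a f = 0.
Proof. by rewrite /Int set_itv1 Rintegral_set1. Qed.

(** The statement integrates over open intervals, the proof over closed ones. *)
Lemma Int_oo a b f : intg a b f -> \int[mu]_(t in `]a, b[) f t = Int a b f.
Proof.
move=> hf; rewrite Rintegral_itv_bndo_bndc; last first.
  by apply: integrableS hf => //; apply: subset_itv; rewrite bnd_simp.
rewrite Rintegral_itv_obnd_cbnd//.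
by apply: integrableS hf => //; apply: subset_itv; rewrite bnd_simp.
Qed.

Lemma intg_oo a b f : mu.-integrable `]a, b[ (EFin \o f) -> intg a b f.
Proof.
move=> /integrableP[/measurable_EFinP mf hf]; rewrite /intg.
have mf' : measurable_fun `[a, b] f by exact: measurable_fun_itv_cc mf.
have m1 : measurable_fun `]a, b[ (fun x => `|(EFin \o f) x|%E).
  by apply: measurableT_comp => //; apply/measurable_EFinP.
have m2 : measurable_fun `]a, b] (fun x => `|(EFin \o f) x|%E).
  exact/emeasurable_fun_itv_bndo_bndcP.
apply/integrableP; split; first exact/measurable_EFinP.
by rewrite (integral_itv_bndo_bndc m1) (integral_itv_obnd_cbnd m2) in hf.
Qed.

Lemma intg_le a b f g : measurable_fun `[a, b] f -> intg a b g ->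
  (forall t, a <= t <= b -> `|f t| <= g t) -> intg a b f.
Proof.
move=> mf hg fg; apply: (le_integrable _ _ _ hg) => //.
  exact/measurable_EFinP.
move=> t; rewrite /= in_itv /= lee_fin => /fg h.
exact: le_trans h (ler_norm _).
Qed.

Lemma cont_bounded a b f : continuous f ->
  exists2 M, 0 <= M & forall t, a <= t <= b -> `|f t| <= M.
Proof.
move=> cf; have := @compact_bounded _ _ (f @` `[a, b]).
have cpt : compact (f @` `[a, b]).
  apply: continuous_compact; last exact: segment_compact.
  exact: continuous_subspaceT.
move=> /(_ cpt)[M [_ hM]]; exists (Num.max M 0 + 1).
  by rewrite addr_ge0// le_max lexx orbT.
move=> t tab; apply: (hM (Num.max M 0 + 1)); last by exists t.
by rewrite ltr_pwDr// le_max lexx.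
Qed.

Lemma intgM_bounded a b f g M : intg a b f -> measurable_fun `[a, b] g ->
  (forall t, a <= t <= b -> `|g t| <= M) -> intg a b (fun t => f t * g t).
Proof.
move=> hf mg gM; apply: (intg_le (g := fun t => M * `|f t|)).
- by apply: measurable_funM => //; exact: intg_meas.
- by apply: intgZ; exact: intg_norm.
- by move=> t /gM h; rewrite normrM mulrC ler_wpM2r.
Qed.

Lemma intgM_cont a b f g : intg a b f -> continuous g ->
  intg a b (fun t => f t * g t).
Proof.
move=> hf cg; have [M _ hM] := cont_bounded a b cg.
apply: (intgM_bounded hf _ hM); apply: measurable_funTS.
exact: continuous_measurable_fun.
Qed.

Definition inL2 a b f :=
  measurable_fun `[a, b] f /\ intg a b (fun t => f t ^+ 2).

Definition n2 a b f := Num.sqrt (Int a b (fun t => f t ^+ 2)).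

Lemma inL2_cont a b f : continuous f -> inL2 a b f.
Proof.
move=> cf; split.
  by apply: measurable_funTS; exact: continuous_measurable_fun.
by apply: intg_cont => t; apply: (@continuousM _ _ f f); exact: cf.
Qed.

Lemma inL2M a b f g : inL2 a b f -> inL2 a b g -> intg a b (fun t => f t * g t).
Proof.
move=> [mf hf] [mg hg]; apply: (intg_le (g := fun t => f t ^+ 2 + g t ^+ 2)).
- exact: measurable_funM.
- exact: intgD.
- move=> t _; rewrite normrM -(real_normK (num_real (f t))).
  by rewrite -(real_normK (num_real (g t))); nra.
Qed.

Lemma inL2_intg a b f : inL2 a b f -> intg a b f.
Proof.
move=> hf; have h1 : inL2 a b (fun=> 1) by apply: inL2_cont; exact: cst_continuous.
by apply: eq_intg (inL2M hf h1) => t _; rewrite mulr1.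
Qed.

Lemma inL2D a b f g : inL2 a b f -> inL2 a b g -> inL2 a b (fun t => f t + g t).
Proof.
move=> hf hg; split; first by apply: measurable_funD; [case: hf|case: hg].
have h : intg a b (fun t => f t ^+ 2 + 2 * (f t * g t) + g t ^+ 2).
  by apply: intgD; [apply: intgD; [case: hf|apply: intgZ; exact: inL2M]|case: hg].
by apply: eq_intg h => t _; ring.
Qed.

Lemma inL2Z a b k f : inL2 a b f -> inL2 a b (fun t => k * f t).
Proof.
move=> [mf hf]; split; first by apply: measurable_funM => //; exact: measurable_cst.
by apply: eq_intg (intgZ (k ^+ 2) hf) => t _; ring.
Qed.

Lemma inL2B a b f g : inL2 a b f -> inL2 a b g -> inL2 a b (fun t => f t - g t).
Proof.
move=> hf hg; have [m h] := inL2D hf (inL2Z (-1) hg); split.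
  by apply: eq_measurable_fun m => t _; rewrite mulN1r.
by apply: eq_intg h => t _; rewrite mulN1r.
Qed.

Lemma eq_inL2 a b f g : (forall t, a <= t <= b -> f t = g t) ->
  inL2 a b f -> inL2 a b g.
Proof.
move=> fg [mf hf]; split.
  by apply: eq_measurable_fun mf => t; rewrite inE /= in_itv /= => /fg.
by apply: eq_intg hf => t /fg ->.
Qed.

Lemma inL2_sum (I : Type) (s : seq I) (P : pred I) a b (F : I -> R -> R) :
  (forall i, inL2 a b (F i)) -> inL2 a b (fun t => \sum_(i <- s | P i) F i t).
Proof.
move=> hF; elim: s => [|i s ih].
  apply: (@eq_inL2 _ _ (fun=> 0)) => [t _|]; first by rewrite big_nil.
  by apply: inL2_cont; exact: cst_continuous.
case Pi : (P i).
  by apply: (eq_inL2 _ (inL2D (hF i) ih)) => t _; rewrite big_cons Pi.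
by apply: (eq_inL2 _ ih) => t _; rewrite big_cons Pi.
Qed.

Lemma inL2M_bounded a b f g M : inL2 a b f -> measurable_fun `[a, b] g ->
  (forall t, a <= t <= b -> `|g t| <= M) -> inL2 a b (fun t => f t * g t).
Proof.
move=> [mf hf] mg gM; split; first exact: measurable_funM.
have h : intg a b (fun t => f t ^+ 2 * g t ^+ 2).
  apply: (intgM_bounded (M := M ^+ 2) hf); first exact: measurable_funX.
  move=> t /gM h; rewrite normrX lerXn2r ?nnegrE//; exact: le_trans h.
by apply: eq_intg h => t _; rewrite exprMn.
Qed.

Lemma inL2S a b c d f : a <= c -> d <= b -> inL2 a b f -> inL2 c d f.
Proof.
move=> ac db [mf hf]; split; last exact: intgS hf.
by apply: measurable_funS mf => //; apply: subset_itvScc; rewrite bnd_simp.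
Qed.

Lemma CauchySchwarz a b f g : inL2 a b f -> inL2 a b g ->
  `|Int a b (fun t => f t * g t)| <= n2 a b f * n2 a b g.
Proof.
move=> hf hg; rewrite /n2.
set A := Int a b (fun t => f t ^+ 2); set C := Int a b (fun t => g t ^+ 2).
set B := Int a b _.
have A0 : 0 <= A by apply: Int_ge0 => t _; exact: sqr_ge0.
have C0 : 0 <= C by apply: Int_ge0 => t _; exact: sqr_ge0.
have q s : 0 <= A - 2 * s * B + s ^+ 2 * C.
  have -> : A - 2 * s * B + s ^+ 2 * C = Int a b (fun t => (f t - s * g t) ^+ 2).
    rewrite (@eq_Int a b _ (fun t => f t ^+ 2 - (2 * s) * (f t * g t) + s ^+ 2 * g t ^+ 2)).
      rewrite IntD ?IntB ?IntZ//; try (by case: hf); try (by case: hg).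
      - exact: inL2M.
      - by apply: intgZ; exact: inL2M.
      - by apply: intgB; [case: hf|apply: intgZ; exact: inL2M].
      - by apply: intgZ; case: hg.
    by move=> t _; ring.
  by apply: Int_ge0 => t _; exact: sqr_ge0.
have BAC : B ^+ 2 <= A * C.
  have [C00|Cn0] := eqVneq C 0.
    rewrite C00 mulr0; have [->|Bn0] := eqVneq B 0; first by rewrite expr0n.
    (* For C = 0 the quadratic is affine in s, and this s gives it the value -1. *)
    have := q ((A + 1) / (2 * B)); rewrite C00 mulr0 addr0.
    have -> : 2 * ((A + 1) / (2 * B)) * B = A + 1 by field.
    by rewrite opprD addrA subrr sub0r oppr_ge0 ler10.
  have := q (B / C).
  have -> : A - 2 * (B / C) * B + (B / C) ^+ 2 * C = (A * C - B ^+ 2) / C by field.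
  by rewrite pmulr_lge0 ?subr_ge0// invr_gt0 lt_neqAle eq_sym Cn0.
rewrite -sqrtrM// -(sqrtr_sqr B); exact: ler_wsqrtr.
Qed.

Lemma n2_ge0 a b f : 0 <= n2 a b f. Proof. exact: sqrtr_ge0. Qed.

Lemma n2_sqr a b f : n2 a b f ^+ 2 = Int a b (fun t => f t ^+ 2).
Proof. by rewrite sqr_sqrtr//; apply: Int_ge0 => t _; exact: sqr_ge0. Qed.

End IntervalIntegral.

(** * Affine changes of variable *)

Section AffineSubstitution.
Variable R : realType.
Local Notation mu := (@lebesgue_measure R).
Implicit Types (a b c d x : R) (f g h : R -> R).

Definition affmap c d : measurableTypeR R -> measurableTypeR R :=
  fun t => c * t + d.

Lemma measurable_affmap c d : measurable_fun setT (affmap c d).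
Proof.
apply: (@continuous_measurable_fun R) => t; apply: cvgD; last exact: cvg_cst.
by apply: cvgM; [exact: cvg_cst|exact: cvg_id].
Qed.

HB.instance Definition _ c d :=
  isMeasurableFun.Build _ _ _ _ (affmap c d) (measurable_affmap c d).

(** By uniqueness of Lebesgue measure it is enough to compare the two sides on the intervals []p,
    q]]. For c < 0 the preimage is closed on the left instead of on the right, with the same
    length. *)
Lemma lebesgue_measure_affine c d (c0 : c != 0) (A : set (measurableTypeR R)) :
  measurable A -> mu A = (`|c|%:E * mu (affmap c d @^-1` A))%E.
Proof.
move=> mA; have c0' : 0 <= `|c| by [].
pose nu := pushforward (mscale (NngNum c0') mu) (affmap c d).
rewrite -[RHS]/(nu A); apply: lebesgue_measure_unique => //= _ [[p q]] _ <-.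
rewrite /nu /pushforward /mscale /=.
have [cp|cn|/eqP] := ltgtP c 0; last by rewrite (negbTE c0).
- have -> : affmap c d @^-1` `]p, q] = `[(q - d) / c, (p - d) / c[%classic.
    apply/seteqP; split => t; rewrite /= !in_itv /= /affmap.
      by move=> /andP[h1 h2]; rewrite ler_ndivrMr// ltr_ndivlMr//; lra.
    by rewrite ler_ndivrMr// ltr_ndivlMr// => /andP[h1 h2]; lra.
  rewrite !lebesgue_measure_itv /= !lte_fin.
  rewrite (ltr_nM2r (x := c^-1)) ?invr_lt0// ltrD2r.
  case: ifPn => pq; last by rewrite mule0.
  rewrite -!EFinD -EFinM ltr0_norm//; congr EFin; field; exact: c0.
- have -> : affmap c d @^-1` `]p, q] = `](p - d) / c, (q - d) / c]%classic.
    apply/seteqP; split => t; rewrite /= !in_itv /= /affmap.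
      by move=> /andP[h1 h2]; rewrite ler_pdivlMr// ltr_pdivrMr//; lra.
    by rewrite ler_pdivlMr// ltr_pdivrMr// => /andP[h1 h2]; lra.
  rewrite !lebesgue_measure_itv /= !lte_fin.
  rewrite (ltr_pM2r (x := c^-1)) ?invr_gt0// ltrD2r.
  case: ifPn => pq; last by rewrite mule0.
  rewrite -!EFinD -EFinM gtr0_norm//; congr EFin; field; exact: c0.
Qed.

Lemma ge0_integral_affine c d (D : set (measurableTypeR R)) f : c != 0 ->
  measurable D -> measurable_fun D f -> (forall t, D t -> 0 <= f t) ->
  (\int[mu]_(t in D) (f t)%:E =
   `|c|%:E * \int[mu]_(t in affmap c d @^-1` D) (f (c * t + d))%:E)%E.
Proof.
move=> c0 mD mf f0; have c0' : 0 <= `|c| by [].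
pose nu := pushforward (mscale (NngNum c0') mu) (affmap c d).
transitivity (\int[nu]_(t in D) (f t)%:E)%E.
  apply: eq_measure_integral => A mA _; exact: lebesgue_measure_affine.
rewrite ge0_integral_pushforward//; last 2 first.
- exact/measurable_EFinP.
- by move=> y; rewrite inE lee_fin => /f0.
have mD' : measurable (affmap c d @^-1` D).
  by rewrite -[X in measurable X]setTI; exact: measurable_affmap.
rewrite ge0_integral_mscale//=.
- apply/measurable_EFinP; apply: (measurable_comp mD) => //.
    by move=> _ [t tD <-].
  by apply: measurable_funTS; exact: measurable_affmap.
- by move=> t tD; rewrite lee_fin f0.
Qed.

Definition affitv c d a b : interval R :=
  if 0 < c then `[(a - d) / c, (b - d) / c] else `[(b - d) / c, (a - d) / c].

Lemma affmap_preimage c d a b : c != 0 ->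
  affmap c d @^-1` `[a, b] = [set` affitv c d a b].
Proof.
move=> c0; rewrite /affitv; have [cp|cn|/eqP] := ltgtP c 0; last first.
- by rewrite (negbTE c0).
- apply/seteqP; split => t; rewrite /= !in_itv /= /affmap.
    by move=> /andP[h1 h2]; rewrite ler_pdivlMr// ler_pdivrMr//; lra.
  by rewrite ler_pdivlMr// ler_pdivrMr// => /andP[h1 h2]; lra.
- apply/seteqP; split => t; rewrite /= !in_itv /= /affmap.
    by move=> /andP[h1 h2]; rewrite ler_ndivlMr// ler_ndivrMr//; lra.
  by rewrite ler_ndivlMr// ler_ndivrMr// => /andP[h1 h2]; lra.
Qed.

Lemma intg_affine_set c d a b f : c != 0 -> intg a b f ->
  mu.-integrable [set` affitv c d a b] (EFin \o (fun t => f (c * t + d))).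
Proof.
move=> c0 hf; rewrite -affmap_preimage//.
have mD' : measurable (affmap c d @^-1` `[a, b]).
  by rewrite -[X in measurable X]setTI; exact: measurable_affmap.
apply/integrableP; split.
  apply/measurable_EFinP.
  apply: (measurable_comp (F := `[a, b]) (f := f) (g := affmap c d)) => //.
  - by move=> _ [t tD <-].
  - exact: intg_meas.
  - by apply: measurable_funTS; exact: measurable_affmap.
have := integrableP _ _ _ (intg_norm hf) => -[_].
under eq_integral do rewrite /= normr_id.
rewrite (ge0_integral_affine d c0)//; last first.
  by move/intg_meas : hf => hf; exact: measurableT_comp.
set I := (\int[mu]_(t in _) _)%E => h.
have I0 : (0 <= I)%E by apply: integral_ge0 => t _; rewrite lee_fin.
have : I \is a fin_num.
  rewrite ge0_fin_numE//; rewrite ltNge leye_eq; apply/negP => /eqP Iy.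
  by move: h; rewrite Iy mulry gtr0_sg ?normr_gt0// mul1e ltxx.
by rewrite ge0_fin_numE.
Qed.

Lemma Rintegral_affine_set c d a b f : c != 0 -> intg a b f ->
  Int a b f =
  `|c| * \int[mu]_(t in [set` affitv c d a b]) f (c * t + d).
Proof.
move=> c0 hf.
have ge0 g : intg a b g -> (forall t, 0 <= g t) -> Int a b g =
    `|c| * \int[mu]_(t in [set` affitv c d a b]) g (c * t + d).
  move=> hg g0; rewrite /Int /Rintegral (ge0_integral_affine d c0)//; last first.
    exact: intg_meas.
  rewrite affmap_preimage// fineM//.
  exact: (integrable_fin_num _ (intg_affine_set d c0 hg)).
have hn := intg_norm hf.
(* The formula is known for nonnegative functions, and f is the difference of |f| and |f| - f. *)
have hnf : intg a b (fun t => `|f t| - f t) by exact: intgB.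
rewrite (@eq_Int _ a b f (fun t => `|f t| - (`|f t| - f t))); last first.
  by move=> t _; rewrite subKr.
rewrite IntB// (ge0 _ hn)// (ge0 _ hnf); last by move=> t; rewrite subr_ge0 ler_norm.
rewrite -mulrBr -RintegralB//; first by congr (_ * _); apply: eq_Rintegral => t _; rewrite subKr.
- exact: (intg_affine_set d c0 hn).
- exact: (intg_affine_set d c0 hnf).
Qed.

Lemma intg_affine c d a b f : 0 < c -> intg (c * a + d) (c * b + d) f ->
  intg a b (fun t => f (c * t + d)).
Proof.
move=> c0 hf; have := intg_affine_set d (lt0r_neq0 c0) hf.
by rewrite /affitv c0 !addrK ![c * _]mulrC !mulfK ?lt0r_neq0.
Qed.

Lemma Int_affine c d a b f : 0 < c -> intg (c * a + d) (c * b + d) f ->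
  Int (c * a + d) (c * b + d) f = c * Int a b (fun t => f (c * t + d)).
Proof.
move=> c0 hf; rewrite (Rintegral_affine_set d (lt0r_neq0 c0) hf) gtr0_norm//.
by rewrite /affitv c0 !addrK ![c * _]mulrC !mulfK ?lt0r_neq0.
Qed.

Lemma intg_refl c a b f : intg a b f -> intg (c - b) (c - a) (fun t => f (c - t)).
Proof.
move=> hf; have N1 : (-1 : R) != 0 by rewrite oppr_eq0 oner_neq0.
have := intg_affine_set c N1 hf.
rewrite /affitv ltr0N1 /= invrN1 !mulrN1 !opprB.
by apply: eq_integrable => // t _ /=; rewrite mulN1r addrC.
Qed.

Lemma Int_refl c a b f : intg a b f ->
  Int (c - b) (c - a) (fun t => f (c - t)) = Int a b f.
Proof.
move=> hf; have N1 : (-1 : R) != 0 by rewrite oppr_eq0 oner_neq0.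
rewrite (Rintegral_affine_set c N1 hf) normrN1 mul1r /affitv.
rewrite ltr0N1 /= invrN1 !mulrN1 !opprB.
by apply: eq_Rintegral => t _; rewrite mulN1r addrC.
Qed.

Lemma intg_shift d a b f : intg (a + d) (b + d) f -> intg a b (fun t => f (t + d)).
Proof.
have := @intg_affine 1 d a b f ltr01; rewrite !mul1r => h /h.
by apply: eq_intg => t _; rewrite mul1r.
Qed.

Lemma Int_shift d a b f : intg (a + d) (b + d) f ->
  Int a b (fun t => f (t + d)) = Int (a + d) (b + d) f.
Proof.
have := @Int_affine 1 d a b f ltr01; rewrite !mul1r => h /h ->.
by apply: eq_Int => t _; rewrite mul1r.
Qed.

End AffineSubstitution.

Section Continuity.
Variable R : realType.
Implicit Types (a b c d x : R).

Lemma within_continuous_comp (S T V : topologicalType) (A : set T) (f : T -> V)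
    (g : S -> T) : {within A, continuous f} -> continuous g ->
  (forall z, A (g z)) -> continuous (f \o g).
Proof.
move=> /subspace_continuousP cf cg gA z.
apply: (@cvg_comp _ _ _ g f _ (within A (nbhs (g z)))); last exact: cf.
move=> B; rewrite /within /= => hB; change (nbhs z (g @^-1` B)).
have h : nbhs z [set w | A (g w) -> B (g w)] := cg z _ hB.
by apply: filterS h => w /=; apply; exact: gA.
Qed.

(** Composition with this retraction extends a function continuous on [[a, b]] to a function
    continuous on the line, so that continuity within a set never has to be carried along. *)
Definition clamp a b x : R := Num.max a (Num.min x b).

Lemma clamp_itv a b x : a <= b -> a <= clamp a b x <= b.
Proof. by move=> ab; rewrite /clamp le_max lexx /= ge_max ab ge_min lexx orbT. Qed.

Lemma clamp_id a b x : a <= x <= b -> clamp a b x = x.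
Proof. by move=> /andP[ax xb]; rewrite /clamp min_l// max_r. Qed.

Lemma clamp_continuous a b : continuous (clamp a b).
Proof.
move=> x; apply: (@continuous_max _ _ (cst a) (fun x => Num.min x b)).
  exact: cvg_cst.
by apply: continuous_min; [exact: cvg_id|exact: cvg_cst].
Qed.

Lemma continuous_clamp a b (f : R -> R) : a <= b ->
  {within `[a, b], continuous f} -> continuous (f \o clamp a b).
Proof.
move=> ab cf; apply: (within_continuous_comp cf); first exact: clamp_continuous.
by move=> z; rewrite /= in_itv /= clamp_itv.
Qed.

Lemma continuous2_comp (f : R * R -> R) (g h : R -> R) : continuous f ->
  continuous g -> continuous h -> continuous (fun t => f (g t, h t)).
Proof.
move=> cf cg ch t; apply: (@continuous_comp _ _ _ (fun t => (g t, h t)) f); last exact: cf.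
exact: (cvg_pair (cg t) (ch t)).
Qed.

Lemma continuous2_comp2 (f : R * R -> R) (g h : R * R -> R) : continuous f ->
  continuous g -> continuous h -> continuous (fun t => f (g t, h t)).
Proof.
move=> cf cg ch t; apply: (@continuous_comp _ _ _ (fun t => (g t, h t)) f); last exact: cf.
exact: (cvg_pair (cg t) (ch t)).
Qed.

Lemma fst_cont : continuous (fun z : R * R => z.1).
Proof. by move=> z; exact: cvg_fst. Qed.

Lemma snd_cont : continuous (fun z : R * R => z.2).
Proof. by move=> z; exact: cvg_snd. Qed.

(** Measurability refers to the product sigma-algebra, so each open set is written as a countable
    union of open squares with rational centres and radii 1 / (n + 1). *)
Lemma continuous2_measurable (f : R * R -> R) : continuous f ->
  measurable_fun [set: measurableTypeR R * measurableTypeR R] f.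
Proof.
move=> cf; apply: (measurability _ (RGenOInfty.measurableE R)).
move=> _ [_ [c ->] <-]; rewrite setTI.
set U := f @^-1` _.
have oU : open U by apply: open_comp; [move=> z _; exact: cf|exact: interval_open].
pose V (q r : rat) n := ball (ratr q : R) n.+1%:R^-1 `*` ball (ratr r : R) n.+1%:R^-1.
have -> : U = \bigcup_(q : rat) \bigcup_(r : rat) \bigcup_n
    (if `[< V q r n `<=` U >] then V q r n else set0).
  apply/seteqP; split=> [z Uz|z [q _ [r _ [n _]]]]; last first.
    by case: asboolP => // h /h.
  have /nbhs_ballP[e /= e0 zeU] : nbhs z U by exact: open_nbhs_nbhs.
  have [n /andP[_ hn]] : exists n, (0 : R) < n.+1%:R^-1 < e / 2.
    have /cvgrPdist_lt/(_ (e / 2)) := @cvg_harmonic R.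
    move=> /(_ ltac:(by rewrite divr_gt0))[n _ /(_ n (leqnn n))].
    rewrite sub0r normrN gtr0_norm => [h|]; last by rewrite /harmonic /= invr_gt0.
    by exists n; rewrite h andbT invr_gt0.
  have n0 : (0 : R) < n.+1%:R^-1 by rewrite invr_gt0.
  have itv (y : R) : y - n.+1%:R^-1 < y + n.+1%:R^-1 by rewrite ltrD2l gtrN.
  have [q] := rat_in_itvoo (itv z.1); have [r] := rat_in_itvoo (itv z.2).
  rewrite !in_itv /= => /andP[r1 r2] /andP[q1 q2].
  exists q => //; exists r => //; exists n => //.
  rewrite asboolT.
    by split => /=; rewrite /ball /= ltr_distl ?q1 ?q2 ?r1 ?r2.
  have tri (k x y p : R) : k < e / 2 -> x - k < p -> p < x + k -> `|p - y| < k ->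
      `|x - y| < e.
    by rewrite !ltr_norml => h1 h2 h3 /andP[h4 h5]; apply/andP; split; lra.
  move=> w [w1 w2]; apply: zeU; split.
    exact: tri hn q1 q2 w1.
  exact: tri hn r1 r2 w2.
apply: bigcupT_measurable_rat => q; apply: bigcupT_measurable_rat => r.
apply: bigcupT_measurable => n; case: ifP => // _.
by apply: measurableX; exact: measurable_ball.
Qed.

End Continuity.

(** * Exchanging the order of integration on a rectangle *)

Section Fubini.
Variable R : realType.
Local Notation mu := (@lebesgue_measure R).
Implicit Types (a b c d x : R).

Lemma Int_EFin a b (f : R -> R) : intg a b f ->
  (\int[mu]_(t in `[a, b]) (f t)%:E = (Int a b f)%:E)%E.
Proof. by move=> hf; rewrite fineK//; exact: integrable_fin_num. Qed.

(** The function [h] dominates the inner integrals of |f|, so Tonelli's theorem makes f, extended by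
    0 outside the rectangle, integrable on the plane. *)
Lemma Int_Fubini a b c d (f : R -> R -> R) (h : R -> R) :
  measurable_fun [set: measurableTypeR R * measurableTypeR R]
    (fun z => f z.1 z.2) ->
  (forall s, a <= s <= b -> intg c d (f s)) ->
  (forall t, c <= t <= d -> intg a b (f^~ t)) ->
  intg a b h ->
  (forall s, a <= s <= b -> Int c d (fun t => `|f s t|) <= h s) ->
  [/\ intg a b (fun s => Int c d (f s)), intg c d (fun t => Int a b (f^~ t)) &
  Int a b (fun s => Int c d (f s)) = Int c d (fun t => Int a b (f^~ t))].
Proof.
move=> mf i1 i2 hh hb.
pose D : set (measurableTypeR R * measurableTypeR R) := `[a, b] `*` `[c, d].
pose g (z : measurableTypeR R * measurableTypeR R) : \bar R :=
  (f z.1 z.2 * \1_D z)%:E.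
have mg : measurable_fun setT g.
  apply/measurable_EFinP/measurable_funM => //; apply: measurable_indic.
  exact: measurableX.
have gE s t : g (s, t) = if (a <= s <= b) && (c <= t <= d) then (f s t)%:E else 0%E.
  rewrite /g /= indicE; case: ifPn => [/andP[h1 h2]|h1].
    by rewrite mem_set ?mulr1// /D; split; rewrite /= in_itv.
  by rewrite memNset ?mulr0// => -[]; rewrite /= !in_itv /= => h2 h3; rewrite h2 h3 in h1.
have int1 s : (\int[mu]_t g (s, t) =
    ((fun s => (Int c d (f s))%:E) \_ `[a, b]) s)%E.
  rewrite patchE; case: ifPn => [|].
    rewrite inE /= in_itv /= => hs; rewrite -Int_EFin ?i1// [RHS]integral_mkcond.
    apply: eq_integral => t _; rewrite gE hs /= patchE.
    by rewrite mem_setE in_itv.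
  rewrite mem_setE in_itv /= => /negbTE hs; apply: integral0_eq => t _.
  by rewrite gE hs.
have int2 t : (\int[mu]_s g (s, t) =
    ((fun t => (Int a b (f^~ t))%:E) \_ `[c, d]) t)%E.
  rewrite patchE; case: ifPn => [|].
    rewrite inE /= in_itv /= => ht; rewrite -(Int_EFin (i2 _ ht)) [RHS]integral_mkcond.
    apply: eq_integral => s _; rewrite gE ht andbT patchE.
    by rewrite mem_setE in_itv.
  rewrite mem_setE in_itv /= => /negbTE ht; apply: integral0_eq => s _.
  by rewrite gE ht andbF.
have mag : measurable_fun setT (abse \o g) by exact: measurableT_comp.
have ig : (mu \x mu)%E.-integrable setT g.
  apply/integrable12ltyP => //.
  have : (\int[mu]_(s in `[a, b]) `|(h s)%:E| < +oo)%E by case/integrableP : hh.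
  apply: le_lt_trans; rewrite [leRHS]integral_mkcond.
  apply: ge0_le_integral => //.
  - by move=> s _; apply: integral_ge0.
  - exact: (@measurable_fun_fubini_tonelli_F _ _ _ _ R mu (abse \o g) mag
      (fun z => abse_ge0 (g z))).
  - apply/(measurable_restrictT _ _).1 => //.
    by apply: measurableT_comp => //; apply/measurable_EFinP; exact: intg_meas.
  - move=> s _; rewrite patchE; case: ifPn => [|].
      rewrite inE /= in_itv /= => hs.
      apply: (@le_trans _ _ (h s)%:E); last by rewrite lee_fin ler_norm.
      apply: le_trans (_ : (Int c d (fun t => `|f s t|))%:E <= _)%E; last by rewrite lee_fin hb.
      rewrite -Int_EFin; last by apply: intg_norm; exact: i1.
      rewrite [leRHS]integral_mkcond; rewrite le_eqVlt; apply/orP; left; apply/eqP.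
      apply: eq_integral => t _; change (`|g (s, t)|%E = ((fun t => `|f s t|%:E) \_ `[c, d]) t).
      rewrite gE hs /= patchE mem_setE in_itv /=.
      by case: ifP => // _; rewrite abse0.
    rewrite mem_setE in_itv /= => /negbTE hs; rewrite integral0_eq// => t _.
    change (`|g (s, t)|%E = 0%E).
    by rewrite gE hs abse0.
split.
- have := integrable_fubini_F ig; rewrite /fubini_F.
  rewrite (_ : (fun x => _) = (fun s => (Int c d (f s))%:E) \_ `[a, b]); last exact/funext.
  by move=> hi; apply/integrable_mkcond.
- pose g' (z : measurableTypeR R * measurableTypeR R) := g (z.2, z.1).
  have mg' : measurable_fun setT g'.
    apply: (measurableT_comp mg); first exact: measurable_swap.
  have ig' : (mu \x mu)%E.-integrable setT g'.
    apply/integrable12ltyP; first exact: mg'.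
    by have /integrable21ltyP := ig; apply.
  have := integrable_fubini_F ig'; rewrite /fubini_F.
  rewrite (_ : (fun x => _) = (fun t => (Int a b (f^~ t))%:E) \_ `[c, d]); last exact/funext.
  by move=> hi; apply/integrable_mkcond.
- have := Fubini ig.
  under eq_integral do rewrite int1.
  under [in RHS]eq_integral do rewrite int2.
  by rewrite -!integral_mkcond /Int /Rintegral => ->.
Qed.

End Fubini.

(** * Absolutely continuous functions *)

Section Triangle.
Variable R : realType.
Local Notation mu := (@lebesgue_measure R).
Local Notation mR := (measurableTypeR R).
Implicit Types (a b c d x : R) (f g : R -> R).

Lemma eq_Int_oo a b f g : intg a b f -> (forall t, a < t < b -> f t = g t) ->
  intg a b g /\ Int a b g = Int a b f.
Proof.
move=> hf fg; have hg : intg a b g.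
  have ho : mu.-integrable `]a, b[ (EFin \o f).
    by apply: integrableS hf => //; apply: subset_itv; rewrite bnd_simp.
  apply: intg_oo; apply: eq_integrable ho => //.
  by move=> t; rewrite inE /= in_itv /= => /fg ->.
split => //; rewrite -!Int_oo//; apply: eq_Rintegral => t.
by rewrite inE /= in_itv /= => /fg ->.
Qed.

Lemma measurable_le2 : measurable_fun [set: mR * mR]
  (fun z : mR * mR => (z.1 <= z.2)%R%:R : R).
Proof.
rewrite (_ : (fun _ => _) = fun z : mR * mR => if z.1 <= z.2 then 1 else 0 : R).
  by apply: measurable_fun_ifT => //; apply: measurable_fun_ler.
by apply/funext => z; case: leP.
Qed.

Lemma measurable_ler_r r : measurable_fun [set: mR] (fun t : mR => (t <= r)%R%:R : R).
Proof.
rewrite (_ : (fun _ => _) = fun t : mR => if t <= r then 1 else 0 : R).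
  by apply: measurable_fun_ifT => //; apply: measurable_fun_ler.
by apply/funext => t; case: leP.
Qed.

Lemma measurable_ler_l r : measurable_fun [set: mR] (fun t : mR => (r <= t)%R%:R : R).
Proof.
rewrite (_ : (fun _ => _) = fun t : mR => if r <= t then 1 else 0 : R).
  by apply: measurable_fun_ifT => //; apply: measurable_fun_ler.
by apply/funext => t; case: leP.
Qed.

Let le1 (p : bool) : `|p%:R : R| <= 1.
Proof. by case: p; rewrite ?normr1 ?normr0. Qed.

Lemma Int_cut_r a b r f : a <= r <= b -> intg a b f ->
  intg a b (fun t => f t * (t <= r)%R%:R) /\
  Int a b (fun t => f t * (t <= r)%R%:R) = Int a r f.
Proof.
move=> /andP[ar rb] hf.
have h : intg a b (fun t => f t * (t <= r)%R%:R).
  by apply: intgM_bounded hf _ (fun t _ => le1 _);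
    apply: measurable_funTS; exact: measurable_ler_r.
split=> //; rewrite (Int_chasles ar rb h).
rewrite (@eq_Int _ a r _ f) => [|t /andP[_ ->]]; last by rewrite mulr1.
have [|_ ->] := @eq_Int_oo r b (fun=> 0) (fun t => f t * (t <= r)%R%:R) (intg_cst _ _ _).
  by move=> t /andP[rt _]; rewrite leNgt rt mulr0.
by rewrite Int_cst// mul0r addr0.
Qed.

Lemma Int_cut_l a b r f : a <= r <= b -> intg a b f ->
  intg a b (fun t => f t * (r <= t)%R%:R) /\
  Int a b (fun t => f t * (r <= t)%R%:R) = Int r b f.
Proof.
move=> /andP[ar rb] hf.
have h : intg a b (fun t => f t * (r <= t)%R%:R).
  by apply: intgM_bounded hf _ (fun t _ => le1 _);
    apply: measurable_funTS; exact: measurable_ler_l.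
split=> //; rewrite (Int_chasles ar rb h).
rewrite (@eq_Int _ r b _ f) => [|t /andP[-> _]]; last by rewrite mulr1.
have [|_ ->] := @eq_Int_oo a r (fun=> 0) (fun t => f t * (r <= t)%R%:R) (intg_cst _ _ _).
  by move=> t /andP[_ rt]; rewrite leNgt rt mulr0.
by rewrite Int_cst// mul0r add0r.
Qed.

(** Fubini on the square, applied to f times the indicator of [s <= t]. *)
Lemma Int_triangle a b (f : R -> R -> R) (h : R -> R) :
  measurable_fun [set: mR * mR] (fun z => f z.1 z.2) ->
  (forall s, a <= s <= b -> intg a b (f s)) ->
  (forall t, a <= t <= b -> intg a b (f^~ t)) ->
  intg a b h ->
  (forall s, a <= s <= b -> Int a b (fun t => `|f s t|) <= h s) ->
  [/\ intg a b (fun s => Int s b (f s)), intg a b (fun t => Int a t (f^~ t)) &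
  Int a b (fun s => Int s b (f s)) = Int a b (fun t => Int a t (f^~ t))].
Proof.
move=> mf i1 i2 hh hb.
have c1 s : a <= s <= b -> _ := fun hs => Int_cut_l hs (i1 _ hs).
have c2 t : a <= t <= b -> _ := fun ht => Int_cut_r ht (i2 _ ht).
have [|||||e1 e2 e3] := @Int_Fubini R a b a b (fun s t => f s t * (s <= t)%R%:R) h.
- by apply: measurable_funM => //; exact: measurable_le2.
- by move=> s /c1[].
- by move=> t /c2[].
- exact: hh.
- move=> s hs; apply: le_trans (hb _ hs); apply: le_Int.
  + by apply: intg_norm; have [] := c1 _ hs.
  + by apply: intg_norm; exact: i1.
  + by move=> t _; rewrite normrM ler_piMr.
split.
- by apply: eq_intg e1 => s /c1[].
- by apply: eq_intg e2 => t /c2[].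
- rewrite (@eq_Int _ a b _ (fun s => Int a b (fun t => f s t * (s <= t)%R%:R))).
    by rewrite e3; apply: eq_Int => t /c2[].
  by move=> s /c1[].
Qed.

(** Fubini asks for measurability on the whole plane, whereas a function on [[a, b]] is arbitrary
    elsewhere. *)
Definition trim a b f t : R := if (a <= t) && (t <= b) then f t else 0.

Lemma trim_id a b f t : a <= t <= b -> trim a b f t = f t.
Proof. by rewrite /trim => ->. Qed.

Lemma measurable_trim a b f : measurable_fun `[a, b] f ->
  measurable_fun [set: mR] (trim a b f).
Proof.
move=> mf; rewrite (_ : trim a b f = f \_ `[a, b]); first exact: (measurable_restrictT _ _).1.
by apply/funext => t; rewrite patchE mem_setE in_itv.
Qed.

End Triangle.

Section Density.
Variable R : realType.
Local Notation mu := (@lebesgue_measure R).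
Local Notation mR := (measurableTypeR R).
Implicit Types (a b c d x : R) (f g : R -> R).

(* f is absolutely continuous, with derivative f' almost everywhere. *)
Definition dens a b f f' :=
  intg a b f' /\ forall t, a <= t <= b -> f t = f a + Int a t f'.

Lemma dens_sub a b f f' s t : dens a b f f' -> a <= s -> s <= t -> t <= b ->
  f t - f s = Int s t f'.
Proof.
move=> [hf hd] as_ st tb.
rewrite (hd t) ?(hd s) ?as_ ?tb ?(le_trans as_ st) ?(le_trans st tb)//.
rewrite (@Int_chasles R a t s)//; last exact: intgS hf.
by rewrite opprD addrACA subrr add0r addrC addKr.
Qed.

(** The product of the two primitives is the integral of f'(s) g'(r) over a square. The diagonal
    cuts the square into two triangles, which give the two terms of the product rule; no pointwise
    derivative is involved. *)
Lemma densM a b f f' g g' : dens a b f f' -> dens a b g g' ->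
  dens a b (fun t => f t * g t) (fun t => f' t * g t + f t * g' t).
Proof.
move=> [hf df] [hg dg].
have tri t : a <= t <= b ->
    [/\ intg a t (fun s => f' s * Int a s g'), intg a t (fun s => Int a s f' * g' s) &
    Int a t f' * Int a t g' =
    Int a t (fun s => f' s * Int a s g') + Int a t (fun s => Int a s f' * g' s)].
  move=> /andP[at_ tb].
  have hft : intg a t f' by exact: intgS hf.
  have hgt : intg a t g' by exact: intgS hg.
  pose F := trim a t f'; pose G := trim a t g'.
  have FE s : a <= s <= t -> F s = f' s by exact: trim_id.
  have GE s : a <= s <= t -> G s = g' s by exact: trim_id.
  have hF : intg a t F by apply: eq_intg hft => s /FE.
  have hG : intg a t G by apply: eq_intg hgt => s /GE.
  have [|||||e1 e2 e3] := @Int_triangle R a t (fun s r => F s * G r)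
    (fun s => `|F s| * Int a t (fun r => `|G r|)).
  - apply: measurable_funM; apply: measurableT_comp => //;
      exact: measurable_trim (intg_meas _).
  - by move=> s hs; exact: intgZ.
  - by move=> s hs; exact: intgZr.
  - by apply: intgZr; exact: intg_norm.
  - move=> s _; rewrite -IntZ; last exact: intg_norm.
    by rewrite le_eqVlt; apply/orP; left; apply/eqP/eq_Int => r _; rewrite normrM.
  have r1 s : a <= s <= t -> Int s t (fun r => F s * G r) = f' s * Int s t g'.
    move=> /andP[h1 h2]; rewrite IntZ ?FE ?h1//; last exact: intgS hG.
    by congr (_ * _); apply: eq_Int => r /andP[h3 h4]; rewrite GE// h4 (le_trans h1).
  have r2 s : a <= s <= t -> Int a s (fun r => F r * G s) = Int a s f' * g' s.
    move=> /andP[h1 h2]; rewrite IntZr ?GE ?h1//; last exact: intgS hF.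
    by congr (_ * _); apply: eq_Int => r /andP[h3 h4]; rewrite FE// h3 (le_trans h4).
  have i1 : intg a t (fun s => f' s * Int s t g') by apply: eq_intg e1.
  have i2 : intg a t (fun s => Int a s f' * g' s) by apply: eq_intg e2.
  have E s : a <= s <= t -> f' s * Int a t g' = f' s * Int a s g' + f' s * Int s t g'.
    by move=> /andP[h1 h2]; rewrite -mulrDr -Int_chasles.
  have i3 : intg a t (fun s => f' s * Int a s g').
    apply: (eq_intg _ (intgB (intgZr (Int a t g') hft) i1)) => s /E ->.
    by rewrite addrK.
  split => //; rewrite -IntZr// (@eq_Int _ a t _ _ E) IntD//; congr (_ + _).
  rewrite (@eq_Int _ a t _ _ (fun s hs => esym (r1 s hs))) e3.
  exact: eq_Int.
have dec t : a <= t <= b -> f' t * g t + f t * g' t =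
    (f' t * Int a t g' + Int a t f' * g' t) + (g a * f' t + f a * g' t).
  by move=> ht; rewrite (df _ ht) (dg _ ht); ring.
have hI t : a <= t <= b ->
    intg a t (fun t => (f' t * Int a t g' + Int a t f' * g' t) + (g a * f' t + f a * g' t)).
  move=> ht; have [i1 i2 _] := tri t ht; case/andP: ht => h1 h2.
  by apply: intgD; apply: intgD => //; apply: intgZ; [exact: intgS hf|exact: intgS hg].
split.
  have [ab|ba] := leP a b.
    by apply: (eq_intg _ (hI b _)) => [t /dec|]; rewrite ?ab ?lexx.
  by rewrite /intg set_itv_ge ?bnd_simp -?ltNge//; exact: integrable_set0.
move=> t ht; have [i1 i2 e] := tri t ht; case/andP: (ht) => h1 h2.
have hft : intg a t f' by exact: intgS hf.
have hgt : intg a t g' by exact: intgS hg.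
rewrite (@eq_Int _ a t _ (fun t => (f' t * Int a t g' + Int a t f' * g' t) + (g a * f' t + f a * g' t))).
  rewrite IntD; [|exact: intgD|by apply: intgD; exact: intgZ].
  rewrite IntD// -e IntD; [|exact: intgZ|exact: intgZ]; rewrite !IntZ//.
  by rewrite (df _ ht) (dg _ ht); ring.
by move=> s /andP[h3 h4]; rewrite dec// h3 (le_trans h4).
Qed.

End Density.

Section FTC.
Variable R : realType.
Local Notation mu := (@lebesgue_measure R).
Implicit Types (a b c d x : R) (f g : R -> R).

Lemma Int_FTC a b (F g : R -> R) : a <= b ->
  {within `[a, b], continuous F} -> {within `[a, b], continuous g} ->
  (forall t, a < t < b -> is_derive t 1 F (g t)) ->
  Int a b g = F b - F a.
Proof.
rewrite le_eqVlt => /predU1P[<- _ _ _|ab cF cg dF]; first by rewrite Int_pt subrr.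
have [_ Fa Fb] := (continuous_within_itvP F ab).1 cF.
rewrite /Int /Rintegral (continuous_FTC2 (F := F) ab cg)//.
  split => // t; rewrite in_itv /= => tab.
  by have [] := dF t tab.
move=> t; rewrite in_itv /= => tab; have [_ <-] := dF t tab.
by rewrite derive1E.
Qed.

Lemma Int_itv_ge a b f : b < a -> Int a b f = 0.
Proof. by move=> ba; rewrite /Int set_itv_ge ?bnd_simp -?ltNge// Rintegral_set0. Qed.

Lemma Int_clamp_continuous a b f : a <= b -> intg a b f ->
  continuous (fun x => Int a (clamp a b x) f).
Proof.
move=> ab hf; apply: (continuous_clamp (f := fun x => Int a x f)) => //.
exact: parameterized_integral_continuous.
Qed.

Lemma dens_within a b f f' : dens a b f f' -> {within `[a, b], continuous f}.
Proof.
move=> [hf hd]; have [ab|ba] := leP a b; last first.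
  by rewrite set_itv_ge ?bnd_simp -?ltNge//; exact: continuous_subspace0.
have cc : continuous (fun x => f a + Int a (clamp a b x) f').
  by move=> x; apply: cvgD; [exact: cvg_cst|exact: Int_clamp_continuous].
apply: (@subspace_eq_continuous _ _ _ (fun x => f a + Int a (clamp a b x) f') f).
  by move=> t; rewrite inE /= in_itv /= => tab; rewrite clamp_id// -hd.
exact: continuous_subspaceT.
Qed.

Lemma Int_lipschitz f M a b s t : (forall x, a <= x <= b -> `|f x| <= M) ->
  intg a b f -> a <= s -> s <= t -> t <= b ->
  `|Int a t f - Int a s f| <= M * (t - s).
Proof.
move=> hM hf as_ st tb; rewrite (@Int_chasles R a t s)//; last exact: intgS hf.
rewrite addrAC subrr add0r; apply: Int_bound => //; first exact: intgS hf.
by move=> x /andP[sx xt]; rewrite hM// (le_trans as_)// (le_trans xt).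
Qed.

(** By compactness of [[0, c]], continuity in the second variable at [u0] is uniform in the
    first. *)
Lemma cont2_tube (F : R * R -> R) c u0 e : continuous F -> 0 < e ->
  \forall u \near u0, forall s, 0 <= s <= c -> `|F (s, u) - F (s, u0)| < e.
Proof.
move=> cF e0; have := @segment_compact R 0 c.
move/compact_near_coveringP => /(_ R (nbhs u0)
  (fun u s => `|F (s, u) - F (s, u0)| < e) _) h.
have : \forall u \near u0, `[0, c] `<=` (fun s => `|F (s, u) - F (s, u0)| < e).
  apply: h => s _ /=.
  have c1 : continuous (fun z : R * R => F (z.1, z.2) - F (z.1, u0)).
    move=> z; apply: cvgB.
      exact: (continuous2_comp2 cF (@fst_cont R) (@snd_cont R)).
    apply: (continuous2_comp2 cF (@fst_cont R)).
    by move=> ?; exact: cvg_cst.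
  have := c1 (s, u0); rewrite /= => /cvgrPdist_lt /(_ e e0).
  apply: filterS => -[s' u'] /=; by rewrite subrr sub0r normrN.
by apply: filterS => u hu s hs; apply: hu; rewrite /= in_itv.
Qed.

Lemma cont2_section (F : R * R -> R) u : continuous F -> continuous (fun s => F (s, u)).
Proof.
move=> cF; apply: continuous2_comp => //; first by move=> ?; exact: cvg_id.
by move=> ?; exact: cvg_cst.
Qed.

Lemma Int_max a b f : Int a b f = Int a (Num.max a b) f.
Proof. by case: leP => // ba; rewrite Int_itv_ge// Int_pt. Qed.

Lemma Int_param_continuous (F : R * R -> R) : continuous F ->
  continuous (fun z : R * R => Int 0 z.2 (fun s => F (s, z.1))).
Proof.
move=> cF -[u0 v0]; apply/cvgrPdist_lt => e e0 /=.
pose B := `|v0| + 1; have B0 : 0 < B by rewrite ltr_pwDr.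
have [M M0 hM] := cont_bounded 0 B (@cont2_section F u0 cF).
pose d := Num.min (e / 2 / (M + 1)) 1.
have d0 : 0 < d by rewrite lt_min ltr01 !divr_gt0// ltr_wpDl.
have e2 : 0 < e / 2 / B by rewrite !divr_gt0.
have iF u a b : intg a b (fun s => F (s, u)).
  by apply: intg_cont; exact: cont2_section.
exists ([set u | forall s, 0 <= s <= B -> `|F (s, u) - F (s, u0)| < e / 2 / B], ball v0 d).
  by split; [exact: (cont2_tube B u0 cF e2)|exact: nbhsx_ballx].
move=> [u v] [/= hu hv].
(* The integral vanishes for a negative upper limit v, which may thus be replaced by max(0, v); this
   replacement does not increase distances. *)
rewrite (Int_max 0 v) (Int_max 0 v0).
set w := Num.max 0 v; set w0 := Num.max 0 v0.
have w00 : 0 <= w0 by rewrite le_max lexx.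
have w0' : 0 <= w by rewrite le_max lexx.
have ww : `|w0 - w| <= `|v0 - v|.
  have h1 : v0 - v <= `|v0 - v| by exact: ler_norm.
  have h2 : v - v0 <= `|v0 - v| by rewrite distrC ler_norm.
  have h3 : 0 <= `|v0 - v| by [].
  by rewrite /w0 /w ler_norml; case: (leP 0 v0); case: (leP 0 v) => h4 h5;
    apply/andP; split; lra.
have vd : `|v0 - v| < d by [].
have w0B : w0 <= B by rewrite ge_max ltW//= (le_trans (ler_norm _))// lerDl.
have wB : w <= B.
  rewrite ge_max ltW//=; have : `|v0 - v| < 1 by rewrite (lt_le_trans vd)// ge_min lexx orbT.
  by rewrite ltr_norml => /andP[h _]; have := ler_norm v0; rewrite /B; lra.
have L : `|Int 0 w0 (fun s => F (s, u0)) - Int 0 w (fun s => F (s, u0))| <=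
    M * `|w0 - w|.
  have [le|/ltW le] := leP w w0.
    by rewrite (ger0_norm (x := w0 - w)) ?subr_ge0//; apply: (Int_lipschitz hM).
  rewrite distrC (distrC w0) (ger0_norm (x := w - w0)) ?subr_ge0//.
  exact: (Int_lipschitz hM).
have L2 : `|Int 0 w (fun s => F (s, u0)) - Int 0 w (fun s => F (s, u))| <= e / 2.
  rewrite -IntB//; apply: le_trans (Int_bound (M := e / 2 / B) _ _ _) _ => //.
  - exact: intgB.
  - by move=> t /andP[t0 tw]; rewrite distrC ltW// hu// t0 (le_trans tw).
  - by rewrite subr0 mulrAC ler_pdivrMr// ler_wpM2l// divr_ge0// ltW.
apply: le_lt_trans (ler_distD (Int 0 w (fun s => F (s, u0))) _ _) _.
rewrite [ltRHS](splitr e); apply: ltr_leD => //; apply: le_lt_trans L _.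
apply: le_lt_trans (_ : M * (e / 2 / (M + 1)) < _).
  apply: ler_wpM2l => //; apply: le_trans ww _; apply: ltW; apply: lt_le_trans vd _.
  by rewrite ge_min lexx.
have M1 : 0 < M + 1 by rewrite ltr_wpDl.
by rewrite mulrCA -[ltRHS]mulr1 ltr_pM2l ?divr_gt0// ltr_pdivrMr// mul1r ltrDl.
Qed.

End FTC.

(** * Absolutely continuous functions are primitives of their derivatives *)

Section AbsolutelyContinuous.
Variable R : realType.
Local Notation mu := (@lebesgue_measure R).
Local Notation mR := (measurableTypeR R).
Implicit Types (a b c d x : R) (f g : R -> R).

(** Let m be the supremum of the t with P c t. The intervals granted around m glue some t just below
    m to a point beyond m, which contradicts the choice of m unless m = d. *)
Lemma Cousin c d (P : R -> R -> Prop) : c <= d ->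
  (forall s t r, c <= s -> s <= t -> t <= r -> r <= d -> P s t -> P t r -> P s r) ->
  (forall x, c <= x <= d -> exists2 e, 0 < e & forall s t, c <= s -> s <= x ->
    x <= t -> t <= d -> t - s < e -> P s t) ->
  P c d.
Proof.
move=> cd Padd Ploc.
pose S := [set t | c <= t <= d /\ P c t].
have Sc : S c.
  split; first by rewrite lexx.
  have [e e0] := Ploc c ltac:(by rewrite lexx).
  by apply; rewrite ?subrr.
have Sub : has_ubound S by exists d => t [/andP[]].
have S0 : S !=set0 by exists c.
have hS : has_sup S by [].
set m := sup S.
have cm : c <= m by exact: sup_upper_bound.
have md : m <= d by apply: ge_sup => // t [/andP[]].
have [e e0 Pm] := Ploc m ltac:(by rewrite cm).
have [t [/andP[ct td] Pct] mt] := sup_adherent (divr_gt0 e0 (ltr0n R 2)) hS.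
have tm : t <= m by apply: sup_upper_bound => //; split => //; rewrite ct.
pose r := Num.min d (m + e / 4).
have e4 : 0 < e / 4 by rewrite divr_gt0.
have mr : m <= r by rewrite le_min md /= lerDl ltW.
have rd : r <= d by rewrite ge_min lexx.
have Ptr : P t r.
  apply: Pm => //; have : r <= m + e / 4 by rewrite ge_min lexx orbT.
  by rewrite -/m in mt; lra.
have Pcr : P c r by apply: Padd Pct Ptr => //; exact: le_trans mr.
have rm : r <= m.
  by apply: sup_upper_bound => //; split => //; rewrite rd (le_trans cm mr).
have [dm|dm] := leP d (m + e / 4); first by rewrite /r min_l in Pcr.
by move: rm; rewrite /r min_r ?(ltW dm)// gerDl leNgt e4.
Qed.

(** Unlike the families indexed by ['I_n] in [abs_continuous], such lists concatenate when two
    adjacent intervals are glued in [Cousin]. *)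
Definition ordpairs (s t : R) (l : seq (R * R)) : bool :=
  all (fun p => [&& s <= p.1, p.1 <= p.2 & p.2 <= t]) l &&
  pairwise (fun p q => p.2 <= q.1) l.

Lemma ordpairs_cat s t r l1 l2 : s <= t -> t <= r ->
  ordpairs s t l1 -> ordpairs t r l2 -> ordpairs s r (l1 ++ l2).
Proof.
move=> st tr /andP[/allP a1 p1] /andP[/allP a2 p2].
rewrite /ordpairs pairwise_cat p1 p2 !andbT all_cat; apply/andP; split.
  apply/andP; split; apply/allP => p.
    by move=> /a1 /and3P[-> -> h]; rewrite (le_trans h).
  by move=> /a2 /and3P[h -> ->]; rewrite (le_trans _ h).
apply/allrelP => p q /a1 /and3P[_ _ h] /a2 /and3P[h' _ _].
exact: le_trans h'.
Qed.

Lemma abs_continuous_seq c d g e : abs_continuous c d g -> 0 < e ->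
  exists2 delta : R, 0 < delta & forall l : seq (R * R), ordpairs c d l ->
  \sum_(p <- l) (p.2 - p.1) < delta -> \sum_(p <- l) `|g p.2 - g p.1| < e.
Proof.
move=> ac e0; have [delta d0 h] := ac _ e0; exists delta => // l /andP[/allP al pl].
rewrite !(big_nth (0, 0)) !big_mkord => hl.
apply: h => // [i|i j ij].
  by have /al/and3P[-> -> ->] := mem_nth (0, 0) (ltn_ord i).
have /pairwiseP := pl => /(_ (0, 0)) pw.
case: (ltngtP i j) => [lt|lt|/val_inj eij]; last by rewrite eij eqxx in ij.
- by left; apply: pw => //; rewrite inE ltn_ord.
- by right; apply: pw => //; rewrite inE ltn_ord.
Qed.

Lemma is_derive0_small f x e : is_derive x 1 f 0 -> 0 < e ->
  exists2 r, 0 < r & forall y, `|y - x| < r -> `|f y - f x| <= e * `|y - x|.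
Proof.
move=> [/cvg_ex[/= l hl] dl] e0.
have l0 : l = 0 by rewrite -dl; apply/esym/cvg_lim.
move: hl; rewrite l0 => /cvgrPdist_lt /(_ e e0).
rewrite /dnbhs /within /= => /nbhs_ballP[r /= r0 h]; exists r => // y yx.
have [->|yx0] := eqVneq y x; first by rewrite !subrr normr0 mulr0.
have yx1 : y - x != 0 by rewrite subr_eq0.
have := h (y - x); rewrite /ball /= sub0r normrN => /(_ yx yx1).
rewrite sub0r normrN /GRing.scale /= mulr1 subrK normrM normfV => /ltW.
by rewrite mulrC ler_pdivrMr ?normr_gt0.
Qed.

Lemma integrable_trim a b f : intg a b f -> mu.-integrable setT (EFin \o trim a b f).
Proof.
move=> hf; rewrite (_ : EFin \o trim a b f = (EFin \o f) \_ `[a, b]).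
  by rewrite -integrable_mkcond.
apply/funext => t; rewrite patchE mem_setE in_itv /= /trim.
by case: ifP.
Qed.

Lemma intg_trim a b c d f : intg a b f -> intg c d (trim a b f).
Proof. by move=> hf; apply: integrableS (integrable_trim hf). Qed.

(* Let G be the primitive of g'. The null set where g - G does not have
   derivative 0 is covered by an open set V of small measure. On short intervals
   around a point of V the increment of g - G is controlled by absolute
   continuity, on those around another point by the derivative; Cousin's lemma
   splits [c, d] into intervals of both kinds. *)
Lemma abs_continuous_end c d g g' : c <= d -> abs_continuous c d g ->
  {ae mu, forall t : R, t \in `]c, d[ -> is_derive t 1 g (g' t)} ->
  intg c d g' -> g d - g c = Int c d g'.
Proof.
move=> cd ac dg hg'; pose T := trim c d g'.
have hT := integrable_trim hg'; rewrite -/T in hT.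
have iT a b : intg a b T by exact: intg_trim.
rewrite (@eq_Int _ c d _ T); last by move=> t ht; rewrite /T trim_id.
apply/eqP; rewrite -subr_eq0 -normr_le0; apply/ler_addgt0Pl => e' e'0; rewrite addr0.
(* The share e (d - c) is spent on the points where g - G has derivative 0; the two further e bound
   the variation of g and the integral of |T| over the exceptional part. *)
pose e := e' / (d - c + 2).
have dc2 : 0 < d - c + 2 by rewrite ltr_wpDl ?subr_ge0.
have e0 : 0 < e by rewrite divr_gt0.
have [d1 d10 H1] := abs_continuous_seq ac e0.
have [d2 [d20 H2]] := integral_normr_continuous hT e0.
pose G x := Int c x T.
have dG : {ae mu, forall x, c < x -> is_derive x 1 G (T x)}.
  have := @FTC1 R T (BLeft c) (fun y => iT c y) (open_integrable_locally openT hT).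
  apply: filterS; first exact: (ae_filter_ringOfSetsType mu).
  move=> x h cx; have lt : (BLeft c < BRight x)%E by rewrite lte_fin.
  have [h1 h2] := h lt.
  by apply: DeriveDef; [exact: h1|rewrite -derive1E; exact: h2].
have FF : Filter (nbhs (almost_everywhere mu)).
  exact: (ae_filter_ringOfSetsType mu).
have [Z [mZ Z0 hZ]] : {ae mu, forall x, x != c -> x != d -> c <= x <= d ->
    is_derive x 1 (fun x => g x - G x) 0}.
  near=> x => xc xd /andP[cx xd'].
  have h1 : is_derive x 1 g (g' x).
    have : x \in `]c, d[ by rewrite in_itv /= !lt_neqAle cx xd' xd eq_sym xc.
    by near: x.
  have h2 : is_derive x 1 G (T x).
    have : c < x by rewrite lt_neqAle eq_sym xc.
    by near: x.
  have -> : 0 = g' x - T x by rewrite /T trim_id ?cx ?subrr.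
  exact: is_deriveB.
(* At the end points nothing is known about the derivative, so they join the exceptional set. *)
pose Z' := Z `|` [set c; d].
have mZ' : measurable Z' by apply: measurableU => //; exact: measurableU.
have Z'0 : mu Z' = 0%E.
  apply/negligibleP => //; apply: negligibleU; first exact/negligibleP.
  by apply: negligibleU; apply/negligibleP => //; exact: lebesgue_measure_set1.
have d12 : 0 < Num.min d1 d2 by rewrite lt_min d10.
have Z'oo : (mu Z' < +oo)%E by rewrite Z'0 ltry.
have [V [oV ZV VZ]] := lebesgue_regularity_outer mZ' Z'oo d12.
have mV : measurable V by exact: open_measurable.
have muV : (mu V < (Num.min d1 d2)%:E)%E.
  apply: le_lt_trans VZ; rewrite -[leRHS]add0e -Z'0.
  apply: le_trans (measureU2 _ mZ' (measurableD mV mZ')).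
  apply: le_measure; rewrite ?inE//.
    by apply: measurableU => //; exact: measurableD.
  by move=> t Vt; have [|nt] := pselect (Z' t); [left|right].
have muVcd : (mu (V `&` `[c, d]) < (Num.min d1 d2)%:E)%E.
  apply: le_lt_trans muV; apply: le_measure; rewrite ?inE//.
  exact: measurableI.
pose chi t : R := \1_V t.
have mchi : measurable_fun setT (chi : mR -> R) by exact: measurable_indic.
have chi1 t : `|chi t| <= 1.
  by rewrite /chi indicE; case: (t \in V); rewrite ?normr1 ?normr0.
have chi0 t : 0 <= chi t by rewrite /chi indicE.
have ichi a b : intg a b chi.
  apply: intg_le (intg_cst a b 1) _ => //; exact: measurable_funTS.
have iTc a b : intg a b (fun t => `|T t| * chi t).
  apply: (intgM_bounded (M := 1)) => //; first by apply: intg_norm.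
  exact: measurable_funTS.
have Ichi : Int c d chi < d1.
  rewrite /Int /Rintegral integral_indic//.
  have fin : mu (V `&` `[c, d]) \is a fin_num.
    by rewrite ge0_fin_numE// (lt_trans muVcd) ?ltry.
  by rewrite -lte_fin fineK// (lt_le_trans muVcd)// lee_fin ge_min lexx.
have ITchi : Int c d (fun t => `|T t| * chi t) < e.
  have := H2 (V `&` `[c, d]) (measurableI _ _ mV (measurable_itv _)).
  rewrite setIC Rintegral_mkcondr /Int => h.
  rewrite (_ : (fun t => `|T t| * chi t) = (fun t => `|T t|) \_ V).
    by apply: h; rewrite setIC (lt_le_trans muVcd)// lee_fin ge_min lexx orbT.
  apply/funext => t; rewrite patchE /chi indicE.
  by case: ifP => tV; rewrite ?mulr1 ?mulr0.
(* The list collects the short intervals around points of V. Their total length is at most the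
   measure of V, expressed as the integral of chi so that it is additive under gluing. *)
pose P s t := exists2 l, ordpairs s t l &
  `|g t - g s - Int s t T| <= e * (t - s) + \sum_(p <- l) `|g p.2 - g p.1|
      + Int s t (fun t => `|T t| * chi t) /\
  \sum_(p <- l) (p.2 - p.1) <= Int s t chi.
have [l ol [l1 l2]] : P c d.
  apply: Cousin => //.
    move=> s t r cs st tr rd [l1 o1 [a1 b1]] [l2 o2 [a2 b2]].
    exists (l1 ++ l2); first exact: ordpairs_cat o1 o2.
    rewrite !big_cat /= !(@Int_chasles _ s r t)//; split; last exact: lerD.
    have -> : g r - g s - (Int s t T + Int t r T) =
      (g t - g s - Int s t T) + (g r - g t - Int t r T) by ring.
    by apply: le_trans (ler_normD _ _) _; lra.
  move=> x /andP[cx xd]; have [xV|xV] := pselect (V x).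
    have /nbhs_ballP[r /= r0 hr] : nbhs x V by exact: open_nbhs_nbhs.
    exists r => // s t cs sx xt td tsr; exists [:: (s, t)].
      by rewrite /ordpairs /= !lexx (le_trans sx xt).
    have st : s <= t by exact: le_trans xt.
    have c1 y : s <= y <= t -> chi y = 1.
      move=> /andP[sy yt]; rewrite /chi indicE mem_set//; apply: hr.
      by rewrite /ball /= ltr_norml; apply/andP; split; lra.
    rewrite !big_seq1 /=; split.
      rewrite (@eq_Int _ s t (fun t => `|T t| * chi t) (fun t => `|T t|)); last by move=> y /c1 ->; rewrite mulr1.
      apply: le_trans (ler_normB _ _) _; apply: lerD; last exact: le_normr_Int.
      by rewrite lerDr mulr_ge0 ?subr_ge0// ltW.
    by rewrite (@eq_Int _ s t chi (fun=> 1))// Int_cst// mul1r.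
  have xc : x != c by apply/eqP => xc; apply: xV; apply: ZV; right; left.
  have xd' : x != d by apply/eqP => xd'; apply: xV; apply: ZV; right; right.
  have dx : is_derive x 1 (fun x => g x - G x) 0.
    apply: contrapT => ndx; apply: xV; apply: ZV; left; apply: hZ => /= h.
    by apply: ndx; apply: h => //; rewrite cx.
  have [r r0 hr] := is_derive0_small dx e0.
  exists r => // s t cs sx xt td tsr; exists [::]; first by [].
  have st : s <= t by exact: le_trans xt.
  rewrite !big_nil addr0; split; last by apply: Int_ge0.
  have -> : g t - g s - Int s t T = ((g t - G t) - (g x - G x)) - ((g s - G s) - (g x - G x)).
    by rewrite /G (@Int_chasles _ c t s)//; ring.
  have t1 : `|t - x| < r by rewrite ger0_norm ?subr_ge0//; lra.
  have s1 : `|s - x| < r by rewrite ler0_norm ?subr_le0//; lra.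
  have := hr _ t1; have := hr _ s1.
  rewrite (ger0_norm (x := t - x)) ?subr_ge0// (ler0_norm (x := s - x)) ?subr_le0//.
  have := ler_normB (g t - G t - (g x - G x)) (g s - G s - (g x - G x)).
  have : 0 <= Int s t (fun t => `|T t| * chi t).
    by apply: Int_ge0 => y _; rewrite mulr_ge0.
  lra.
have S1 : \sum_(p <- l) `|g p.2 - g p.1| < e.
  by apply: H1 => //; exact: le_lt_trans Ichi.
apply: le_trans l1 _.
have -> : e' = e * (d - c) + e + e by rewrite /e; field; exact: lt0r_neq0.
by rewrite lerD ?lerD// ltW.
Unshelve. all: by end_near.
Qed.

Lemma abs_continuous_dens c d g g' : abs_continuous c d g ->
  {ae mu, forall t : R, t \in `]c, d[ -> is_derive t 1 g (g' t)} ->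
  intg c d g' -> dens c d g g'.
Proof.
move=> ac dg hg'; split => // t /andP[ct td].
rewrite -(@abs_continuous_end c t g g')//; first by rewrite addrC subrK.
- move=> e e0; have [delta d0 h] := ac e e0; exists delta => // n u v huv.
  by apply: h => i; have [? [? ?]] := huv i; split => //; split => //; exact: le_trans td.
- have FF : Filter (nbhs (almost_everywhere mu)).
    exact: (ae_filter_ringOfSetsType mu).
  apply: filterS dg => x h; rewrite in_itv /= => /andP[cx xt]; apply: h.
  by rewrite in_itv /= cx (lt_le_trans xt).
- exact: intgS hg'.
Qed.

End AbsolutelyContinuous.

(** * Calculus of Sobolev functions of one variable *)

Section Regularity.
Variable R : realType.
Local Notation mR := (measurableTypeR R).
Implicit Types (a b c d x : R) (f g : R -> R).

Lemma eq_dens a b f g f' g' : (forall t, a <= t <= b -> f t = g t) ->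
  (forall t, a <= t <= b -> f' t = g' t) -> dens a b f f' -> dens a b g g'.
Proof.
move=> fg fg' [hf hd]; split; first exact: eq_intg fg' hf.
move=> t tab; have /andP[at_ tb] := tab; rewrite -fg// hd// -fg ?lexx ?(le_trans at_)//.
by congr (_ + _); apply: eq_Int => s /andP[h1 h2]; rewrite fg'// h1 (le_trans h2).
Qed.

Lemma densD a b f g f' g' : dens a b f f' -> dens a b g g' ->
  dens a b (fun t => f t + g t) (fun t => f' t + g' t).
Proof.
move=> [hf df] [hg dg]; split; first exact: intgD.
move=> t tab; have /andP[h1 h2] := tab.
rewrite (df t tab) (dg t tab) IntD; first by rewrite addrACA.
  exact: intgS hf.
exact: intgS hg.
Qed.

Lemma densZ a b k f f' : dens a b f f' ->
  dens a b (fun t => k * f t) (fun t => k * f' t).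
Proof.
move=> [hf df]; split; first exact: intgZ.
move=> t tab; have /andP[h1 h2] := tab.
rewrite (df t tab) IntZ ?mulrDr//; exact: intgS hf.
Qed.

Lemma dens_cst a b k : dens a b (fun=> k) (fun=> 0).
Proof.
split; first exact: intg_cst.
by move=> t /andP[h1 h2]; rewrite Int_cst// mul0r addr0.
Qed.

Lemma dens_sum (I : Type) (r : seq I) a b (F F' : I -> R -> R) :
  (forall i, dens a b (F i) (F' i)) ->
  dens a b (fun t => \sum_(i <- r) F i t) (fun t => \sum_(i <- r) F' i t).
Proof.
move=> h; elim: r => [|i r ih].
  by apply: eq_dens (dens_cst a b 0) => t _; rewrite big_nil.
by apply: eq_dens (densD (h i) ih) => t _; rewrite big_cons.
Qed.

Lemma densS a b c d f f' : a <= c -> d <= b -> dens a b f f' -> dens c d f f'.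
Proof.
move=> ac db df; split; first by case: df => hf _; exact: intgS hf.
move=> t /andP[ct td]; rewrite -(dens_sub df) 1?addrC ?subrK//.
exact: le_trans db.
Qed.

Lemma dens_affine a b c d f f' : 0 < c -> dens (c * a + d) (c * b + d) f f' ->
  dens a b (fun t => f (c * t + d)) (fun t => c * f' (c * t + d)).
Proof.
move=> c0 [hf df].
have le s t : (c * s + d <= c * t + d) = (s <= t) by rewrite lerD2r ler_pM2l.
split; first by apply: intgZ; exact: intg_affine.
move=> t /andP[h1 h2]; rewrite df ?le ?h1//; congr (_ + _).
have hf' : intg (c * a + d) (c * t + d) f' by apply: intgS hf; rewrite ?le.
by rewrite Int_affine// IntZ//; exact: intg_affine.
Qed.

Lemma dens_shift a b d f f' : dens (a + d) (b + d) f f' ->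
  dens a b (fun t => f (t + d)) (fun t => f' (t + d)).
Proof.
move=> df; have := @dens_affine a b 1 d f f' ltr01.
rewrite !mul1r => /(_ df); apply: eq_dens => t _; rewrite ?mul1r//.
Qed.

Lemma dens_refl a b c f f' : dens a b f f' ->
  dens (c - b) (c - a) (fun t => f (c - t)) (fun t => - f' (c - t)).
Proof.
move=> df; have hf : intg a b f' by case: df.
split; first by apply: intgN; exact: intg_refl.
move=> t /andP[h1 h2]; have ct : a <= c - t <= b by lra.
have /andP[ct1 ct2] := ct; have ab : a <= b := le_trans ct1 ct2.
suff e : Int (c - b) t (fun t => - f' (c - t)) = f (c - t) - f b.
  by rewrite e subKr addrCA subrr addr0.
rewrite IntN; last first.
  by apply: (@intgS _ (c - b) (c - a)) => //; exact: intg_refl.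
have -> : f (c - t) - f b = - (f b - f (c - t)) by rewrite opprB.
rewrite (dens_sub df)//; congr (- _).
rewrite -(Int_refl c (intgS ct1 (lexx b) hf)); congr Int.
by rewrite subKr.
Qed.

Lemma within_inL2 a b f : a <= b -> {within `[a, b], continuous f} -> inL2 a b f.
Proof.
move=> ab cf; have cc := continuous_clamp ab cf.
by apply: eq_inL2 (inL2_cont a b cc) => t tab; rewrite /= clamp_id.
Qed.

Lemma dens_inL2 a b f f' : a <= b -> dens a b f f' -> inL2 a b f.
Proof. by move=> ab /dens_within; exact: within_inL2. Qed.

(* The Sobolev space W^{m,2}. *)
Fixpoint Reg a b (m : nat) f : Prop :=
  if m is m'.+1 then exists2 f', Reg a b m' f' & dens a b f f' else inL2 a b f.

Lemma Reg_inL2 a b m f : a <= b -> Reg a b m f -> inL2 a b f.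
Proof. by move=> ab; case: m => [//|m [f' _]]; exact: dens_inL2. Qed.

Lemma RegW a b m f : a <= b -> Reg a b m.+1 f -> Reg a b m f.
Proof.
move=> ab; elim: m f => [|m ih] f; first by case=> f' _; exact: dens_inL2.
by case=> f' /ih h df; exists f'.
Qed.

Lemma Reg_within a b m f : Reg a b m.+1 f -> {within `[a, b], continuous f}.
Proof. by case=> f' _; exact: dens_within. Qed.

Lemma eq_Reg a b m f g : (forall t, a <= t <= b -> f t = g t) ->
  Reg a b m f -> Reg a b m g.
Proof.
case: m => [|m] fg; first exact: eq_inL2.
by move=> [f' hf' df]; exists f' => //; apply: eq_dens df.
Qed.

Lemma RegD a b m f g : Reg a b m f -> Reg a b m g -> Reg a b m (fun t => f t + g t).
Proof.
elim: m f g => [|m ih] f g; first exact: inL2D.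
case=> f' hf' df [g' hg' dg]; exists (fun t => f' t + g' t); first exact: ih.
exact: densD.
Qed.

Lemma RegZ a b m k f : Reg a b m f -> Reg a b m (fun t => k * f t).
Proof.
elim: m f => [|m ih] f; first exact: inL2Z.
case=> f' hf' df; exists (fun t => k * f' t); first exact: ih.
exact: densZ.
Qed.

Lemma RegN a b m f : Reg a b m f -> Reg a b m (fun t => - f t).
Proof. by move=> /(RegZ (-1)); apply: eq_Reg => t _; rewrite mulN1r. Qed.

Lemma RegB a b m f g : Reg a b m f -> Reg a b m g -> Reg a b m (fun t => f t - g t).
Proof. by move=> hf /RegN; exact: RegD. Qed.

Lemma Reg_cst a b m k : Reg a b m (fun=> k).
Proof.
elim: m k => [|m ih] k; first by apply: inL2_cont; exact: cst_continuous.
by exists (fun=> 0) => //; exact: dens_cst.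
Qed.

Lemma Reg_sum (I : Type) (r : seq I) a b m (F : I -> R -> R) :
  (forall i, Reg a b m (F i)) -> Reg a b m (fun t => \sum_(i <- r) F i t).
Proof.
move=> h; elim: r => [|i r ih].
  by apply: eq_Reg (Reg_cst a b m 0) => t _; rewrite big_nil.
by apply: eq_Reg (RegD (h i) ih) => t _; rewrite big_cons.
Qed.

Lemma Reg_prim a b m k f : a <= b -> Reg a b m f ->
  Reg a b m.+1 (fun t => k + Int a t f).
Proof.
move=> ab hf; exists f => //; split; first exact/inL2_intg/(Reg_inL2 ab hf).
by move=> t _; rewrite Int_pt addr0.
Qed.

(** L^2 is not closed under products; at m = 0 the extra derivative makes g bounded. In the
    inductive step the term f' g keeps the roles of the factors, and the term f g' exchanges
    them. *)
Lemma RegMS a b m f g : a <= b -> Reg a b m f -> Reg a b m.+1 g ->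
  Reg a b m (fun t => f t * g t).
Proof.
move=> ab; elim: m f g => [|m ih] f g.
  move=> hf hg; have cg := continuous_clamp ab (Reg_within hg).
  have [M _ hM] := cont_bounded a b cg.
  apply: (inL2M_bounded (M := M)) => //.
    by have [] := Reg_inL2 ab hg.
  by move=> t tab; have := hM t tab; rewrite /= clamp_id.
move=> [f' hf' df] /= hg; have [g' hg' dg] := hg.
exists (fun t => f' t * g t + f t * g' t); last exact: densM.
apply: RegD; first by apply: ih => //; exact: RegW.
apply: (@eq_Reg _ _ _ (fun t => g' t * f t)); first by move=> t _; rewrite mulrC.
by apply: ih; [exact: RegW|exists f'].
Qed.

Lemma RegM a b m f g : a <= b -> Reg a b m.+1 f -> Reg a b m.+1 g ->
  Reg a b m.+1 (fun t => f t * g t).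
Proof.
move=> ab hf hg; have [f' hf' df] := hf; have [g' hg' dg] := hg.
exists (fun t => f' t * g t + f t * g' t); last exact: densM.
apply: RegD; first exact: RegMS.
apply: (@eq_Reg _ _ _ (fun t => g' t * f t)); first by move=> t _; rewrite mulrC.
exact: RegMS.
Qed.

Lemma inL2_affine a b c d f : 0 < c -> inL2 (c * a + d) (c * b + d) f ->
  inL2 a b (fun t => f (c * t + d)).
Proof.
move=> c0 hf; split; last by have [_ h] := hf; have := intg_affine c0 h.
by have := intg_affine c0 (inL2_intg hf); exact: intg_meas.
Qed.

Lemma Reg_affine a b c d m f : 0 < c -> Reg (c * a + d) (c * b + d) m f ->
  Reg a b m (fun t => f (c * t + d)).
Proof.
move=> c0; elim: m f => [|m ih] f; first exact: inL2_affine.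
case=> f' hf' df; exists (fun t => c * f' (c * t + d)); last exact: dens_affine.
by apply: RegZ; exact: ih.
Qed.

Lemma Reg_refl a b c m f : Reg a b m f -> Reg (c - b) (c - a) m (fun t => f (c - t)).
Proof.
elim: m f => [|m ih] f.
  move=> hf; split; last by have [_ h] := hf; have := intg_refl c h.
  by have := intg_refl c (inL2_intg hf); exact: intg_meas.
case=> f' hf' df; exists (fun t => - f' (c - t)); last exact: dens_refl.
by apply: RegN; exact: ih.
Qed.

End Regularity.

(** * Goursat problems *)

Section Goursat.
Variables (R : realType) (I : finType) (b : R).
Local Notation mR := (measurableTypeR R).

Lemma continuous_bigsum (T : topologicalType) (J : Type) (r : seq J)
  (f : J -> T -> R) : (forall j, continuous (f j)) ->
  continuous (fun t => \sum_(j <- r) f j t).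
Proof.
move=> cf t; elim: r => [|j r ih].
  under eq_fun do rewrite big_nil.
  exact: cvg_cst.
under eq_fun do rewrite big_cons.
by apply: cvgD; [exact: cf|exact: ih].
Qed.

Lemma cont2_bounded (F : R * R -> R) c : continuous F -> exists2 M, 0 <= M &
  forall s t, 0 <= s <= c -> 0 <= t <= c -> `|F (s, t)| <= M.
Proof.
move=> cF; have cpt : compact (`[0, c] `*` `[0, c] : set (R * R)).
  by apply: compact_setX; exact: segment_compact.
have := @compact_bounded _ _ (F @` (`[0, c] `*` `[0, c])).
move=> /(_ (continuous_compact (continuous_subspaceT cF) cpt))[M [_ hM]].
exists (Num.max M 0 + 1); first by rewrite addr_ge0// le_max lexx orbT.
move=> s t sc tc; apply: (hM (Num.max M 0 + 1)).
  by rewrite ltr_pwDr// le_max lexx.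
by exists (s, t) => //; split; rewrite /= in_itv.
Qed.

Lemma le_Int_sub (f : R -> R) a a' c c' : a' <= a -> a <= c -> c <= c' ->
  intg a' c' f -> (forall t, 0 <= f t) -> Int a c f <= Int a' c' f.
Proof.
move=> aa ac cc hf f0; rewrite (@Int_chasles _ a' c' a)//; last exact: le_trans cc.
rewrite (@Int_chasles _ a c' c)//; last exact: intgS hf.
by rewrite addrCA lerDl addr_ge0// Int_ge0.
Qed.

(* The system (d/dv) F_i(u, v) = sum_j A_ij(u + v) F_j(v, u), F_i(u, 0) = g_i(u),
   integrated along its characteristics. *)
Definition goursat (A : I -> I -> R -> R) (g : I -> R -> R) (F : I -> R * R -> R) :=
  forall i u v, 0 <= u -> 0 <= v -> u + v <= b ->
  F i (u, v) = g i u + Int 0 v (fun s => \sum_j A i j (u + s) * F j (s, u)).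

Variables (A A' : I -> I -> R -> R) (g g' : I -> R -> R) (F : I -> R * R -> R).
Hypotheses (cA : forall i j, continuous (A i j))
  (mA' : forall i j, measurable_fun setT (A' i j))
  (iA' : forall i j a c, intg a c (A' i j))
  (dA : forall i j, dens 0 b (A i j) (A' i j))
  (dg : forall i, dens 0 b (g i) (g' i))
  (cF : forall i, continuous (F i)) (GF : goursat A g F).

Let cE i (h k l : R -> R) : continuous h -> continuous k -> continuous l ->
  continuous (fun s => \sum_j A i j (h s) * F j (k s, l s)).
Proof.
move=> ch ck cl; apply: continuous_bigsum => j s; apply: cvgM.
  by apply: (@continuous_comp _ _ _ h (A i j)); [exact: ch|exact: cA].
by have := @continuous2_comp R (F j) k l (@cF j) ck cl s.
Qed.

Let cid : continuous (fun s : R => s). Proof. by move=> ?; exact: cvg_id. Qed.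
Let ccst (k : R) : continuous (fun s : R => k). Proof. by move=> ?; exact: cvg_cst. Qed.
Let caddl (k : R) : continuous (fun s : R => k + s).
Proof. by move=> s; apply: cvgD; [exact: cvg_cst|exact: cvg_id]. Qed.
Let caddr (k : R) : continuous (fun s : R => s + k).
Proof. by move=> s; apply: cvgD; [exact: cvg_id|exact: cvg_cst]. Qed.
Let csub (k : R) : continuous (fun s : R => k - s).
Proof. by move=> s; apply: cvgB; [exact: cvg_cst|exact: cvg_id]. Qed.

(* Dg is the derivative in u of the integrand of [goursat], Gg that of
   F i (u, x - u). *)
Definition Dg i s u := \sum_j (A' i j (u + s) * F j (s, u) +
  A i j (u + s) * \sum_k A j k (s + u) * F k (u, s)).

Definition Gg i (z : R * R) := g' i z.1 -
  \sum_j A i j (z.1 + z.2) * F j (z.2, z.1) + Int 0 z.2 (fun s => Dg i s z.1).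

Let F_dens j s : 0 <= s <= b -> dens 0 (b - s) (fun u => F j (s, u))
  (fun u => \sum_k A j k (s + u) * F k (u, s)).
Proof.
move=> /andP[s0 sb]; split; first by apply: intg_cont; exact: cE.
move=> u /andP[u0 us]; rewrite (@GF j s u)//; last by rewrite -lerBrDl.
by rewrite (@GF j s 0) ?addr0// Int_pt addr0.
Qed.

Let E_dens i s : 0 <= s <= b ->
  dens 0 (b - s) (fun u => \sum_j A i j (u + s) * F j (s, u)) (Dg i s).
Proof.
move=> sb; apply: dens_sum => j; apply: densM; last exact: F_dens.
apply: dens_shift; rewrite add0r subrK; apply: densS (dA i j) => //.
by case/andP: sb.
Qed.

Let mDg i (p q : R * R -> R) : continuous p -> continuous q ->
  measurable_fun [set: mR * mR] (fun z => Dg i (p z) (q z)).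
Proof.
move=> cp cq; have m2 (h : R * R -> R) : continuous h ->
    measurable_fun [set: mR * mR] h by exact: continuous2_measurable.
have cpq : continuous (fun z => q z + p z) by move=> z; apply: cvgD; [exact: cq|exact: cp].
have cqp : continuous (fun z => p z + q z) by move=> z; apply: cvgD; [exact: cp|exact: cq].
have mF k (h l : R * R -> R) : continuous h -> continuous l ->
    measurable_fun [set: mR * mR] (fun z => F k (h z, l z)).
  by move=> ch cl; apply: m2; exact: continuous2_comp2.
have mA i' j (h : R * R -> R) : continuous h ->
    measurable_fun [set: mR * mR] (fun z => A i' j (h z)).
  move=> ch; apply: m2 => z; apply: (@continuous_comp _ _ _ h (A i' j)).
    exact: ch.
  exact: cA.
apply: measurable_sum => j; apply: measurable_funD.
  apply: measurable_funM; last exact: mF.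
  by apply: (measurableT_comp (mA' i j)); exact: m2.
apply: measurable_funM; first exact: mA.
by apply: measurable_sum => k; apply: measurable_funM; [exact: mA|exact: mF].
Qed.

Let Dg_intg1 i s x a c : intg a c (fun t => Dg i s (x - t)).
Proof.
apply: intg_sum => j; apply: intgD.
  apply: intgM_cont; last exact: (continuous2_comp (@cF j) (@ccst s) (@csub x)).
  have := intg_refl (x + s) (iA' i j (x + s - c) (x + s - a)).
  rewrite !subKr; apply: eq_intg => t _; congr A'; ring.
apply: intg_cont; move=> t; apply: cvgM.
  apply: (@continuous_comp _ _ _ (fun t => x - t + s) (A i j)); last exact: cA.
  by apply: cvgD; [exact: csub|exact: cvg_cst].
apply: (@cE j (fun t => s + (x - t)) (fun t => x - t) (fun=> s)) => //.
by move=> r; apply: cvgD; [exact: cvg_cst|exact: csub].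
Qed.

Let Dg_intg2 i u a c : intg a c (fun s => Dg i s u).
Proof.
apply: intg_sum => j; apply: intgD.
  apply: intgM_cont; last exact: (continuous2_comp (@cF j) cid (@ccst u)).
  have := intg_shift (iA' i j (a + u) (c + u)).
  by apply: eq_intg => t _; rewrite addrC.
apply: intg_cont; move=> t; apply: cvgM.
  by apply: (@continuous_comp _ _ _ (fun t => u + t) (A i j)); [exact: caddl|exact: cA].
exact: (@cE j (fun t => t + u) (fun=> u) (fun t => t)).
Qed.

Let Dg_intg3 i s a c : intg a c (Dg i s).
Proof.
have := intg_refl 0 (Dg_intg1 i s 0 (- c) (- a)); rewrite !sub0r !opprK.
by apply: eq_intg => t _; rewrite !sub0r opprK.
Qed.

(** [A'] is only integrable, so [Dg] has no uniform bound. A dominating function of u + s alone can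
    be integrated along any horizontal, vertical or characteristic segment after a change of
    variable. *)
Let Dg_bound i : exists W : R -> R, [/\ forall a c, intg a c W,
  forall t, 0 <= W t & forall s u, 0 <= s <= b -> 0 <= u <= b ->
   `|Dg i s u| <= W (u + s)].
Proof.
have cG j : continuous (fun z : R * R => A i j (z.2 + z.1) *
    \sum_k A j k (z.1 + z.2) * F k (z.2, z.1)).
  move=> z; apply: cvgM.
    apply: (@continuous_comp _ _ _ (fun z : R * R => z.2 + z.1) (A i j)); last exact: cA.
    by apply: cvgD; [exact: snd_cont|exact: fst_cont].
  apply: continuous_bigsum => k {}z; apply: cvgM.
    apply: (@continuous_comp _ _ _ (fun z : R * R => z.1 + z.2) (A j k)); last exact: cA.
    by apply: cvgD; [exact: fst_cont|exact: snd_cont].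
  by apply: (continuous2_comp2 (@cF k)); [exact: snd_cont|exact: fst_cont].
have h j := cont2_bounded b (@cF j).
have h' j := cont2_bounded b (@cG j).
pose M j := sval (cid2 (h j)); pose M' j := sval (cid2 (h' j)).
have M0 j : 0 <= M j by rewrite /M; case: cid2.
have M'0 j : 0 <= M' j by rewrite /M'; case: cid2.
exists (fun t => \sum_j (`|A' i j t| * M j + M' j)); split.
- move=> a c; apply: intg_sum => j; apply: intgD; last exact: intg_cst.
  by apply: intgZr; exact: intg_norm.
- by move=> t; apply: sumr_ge0 => j _; rewrite addr_ge0// mulr_ge0.
- move=> s u sb ub; apply: le_trans (ler_norm_sum _ _ _) _.
  apply: ler_sum => j _; apply: le_trans (ler_normD _ _) _; apply: lerD.
    by rewrite normrM ler_wpM2l// /M; case: cid2 => /= ? ?; exact.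
  by rewrite /M'; case: cid2 => /= ? ? /(_ s u sb ub).
Qed.

(** * Differentiation along a line u + v = x *)

Section Line.
Variables (i : I) (x : R).
Hypothesis xb : 0 <= x <= b.

Let H u := Int 0 (x - u) (fun s => Dg i s u).
Let P u := \sum_j A i j x * F j (x - u, u).

Let x0 : 0 <= x. Proof. by case/andP: xb. Qed.
Let xb' : x <= b. Proof. by case/andP: xb. Qed.

(** The substitution r = x - t maps the region r >= u, s >= 0, r + s <= x onto the triangle s <= t
    <= x - u, where the order of integration can be exchanged. The bound on [H] serves
    [goursat_line_inL2]. *)
Let H_triangle u : 0 <= u <= x ->
  [/\ intg u x H, Int 0 (x - u) (fun s => Int u (x - s) (Dg i s)) = Int u x H,
   intg 0 (x - u) (fun s => Int u (x - s) (Dg i s)) &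
   exists C, forall r, 0 <= r <= x -> `|H r| <= C].
Proof.
move=> /andP[u0 ux]; have [W [iW W0 DW]] := Dg_bound i; move: (xb') => xb2.
have [|||||e1 e2 e3] := @Int_triangle R 0 (x - u) (fun s t => Dg i s (x - t))
  (fun=> Int 0 (b + b) W).
- apply: mDg; first exact: fst_cont.
  by move=> z; apply: cvgB; [exact: cvg_cst|exact: snd_cont].
- by move=> s _; exact: Dg_intg1.
- by move=> t _; exact: Dg_intg2.
- exact: intg_cst.
- move=> s /andP[s0 su].
  apply: (@le_trans _ _ (Int 0 (x - u) (fun t => W (x + s - t)))).
    apply: le_Int; first by apply: intg_norm; exact: Dg_intg1.
      have := intg_refl (x + s) (iW (x + s - (x - u)) (x + s)).
      by rewrite subrr subKr.
    move=> t /andP[t0 tu]; rewrite addrAC; apply: DW; first by rewrite s0 /=; lra.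
    by apply/andP; split; lra.
  have := Int_refl (x + s) (iW (x + s - (x - u)) (x + s)).
  rewrite subrr subKr => ->; apply: le_Int_sub => //; lra.
have HE t : 0 <= t <= x - u -> Int 0 t (fun s => Dg i s (x - t)) = H (x - t).
  by move=> _; rewrite /H subKr.
have iH : intg u x H.
  have := @intg_refl R x 0 (x - u) _ e2; rewrite subKr subr0.
  by apply: eq_intg => t _; rewrite subKr.
have ED s : 0 <= s <= x - u ->
    Int s (x - u) (fun t => Dg i s (x - t)) = Int u (x - s) (Dg i s).
  move=> hs; rewrite -(@Int_refl R x u (x - s)); first by rewrite subKr.
  exact: Dg_intg3.
split; first exact: iH.
- rewrite (@eq_Int R 0 (x - u) _ _ (fun s hs => esym (ED s hs))) e3.
  by rewrite -(Int_refl x iH) subrr; exact: eq_Int.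
- exact: eq_intg e1.
- exists (Int 0 b W) => r /andP[r0 rx].
  apply: le_trans (le_normr_Int _) _; first exact: Dg_intg2.
  apply: (@le_trans _ _ (Int 0 (x - r) (fun s => W (s + r)))).
    apply: le_Int; first by apply: intg_norm; exact: Dg_intg2.
      exact: intg_shift.
    move=> s /andP[s0 sr]; rewrite addrC; apply: DW.
    + apply/andP; split; first exact: s0.
      have xr : x - r <= x by rewrite lerBlDr lerDl.
      exact: (le_trans sr (le_trans xr xb')).
    + by rewrite r0 (le_trans rx).
  rewrite (Int_shift (iW _ _)) add0r subrK; exact: le_Int_sub.
Qed.

Let GgE u : Gg i (u, x - u) = g' i u - P u + H u.
Proof.
rewrite /Gg /H /=; congr (_ - _ + _); apply: eq_bigr => j _.
by rewrite addrC subrK.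
Qed.

(** By [E_dens], the integrand of the Goursat equation at (s, u) is its value at (s, x - s) minus
    the integral of [Dg] from u to x - s. The first part is P (x - s); the second gives [H] after
    exchanging the order of integration. Hence F (u, x - u) is g plus integrals from u to x, visibly
    a primitive in u. *)
Lemma goursat_line_dens :
  dens 0 x (fun u => F i (u, x - u)) (fun u => Gg i (u, x - u)).
Proof.
have cP : continuous P.
  move=> t; apply: continuous_bigsum => j {}t; apply: cvgM; first exact: cvg_cst.
  by have := @continuous2_comp R (F j) (fun u => x - u) (fun u => u) (@cF j) (@csub x) cid t.
have iP a c : intg a c P by exact: intg_cont.
have star u : 0 <= u <= x ->
    F i (u, x - u) = g i u + (Int u x P - Int u x H).
  move=> hu; have /andP[u0 ux] := hu; have [iH e iD _] := H_triangle hu.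
  have xu0 : 0 <= x - u by rewrite subr_ge0.
  have uxb : u + (x - u) <= b by rewrite addrC subrK.
  rewrite (@GF i u (x - u) u0 xu0 uxb); congr (_ + _).
  have iP' : intg 0 (x - u) (fun t => P (x - t)).
    by have := @intg_refl R x _ _ _ (iP u x); rewrite subrr.
  rewrite -e -(Int_refl x (iP u x)) subrr -(IntB iP' iD).
  apply: eq_Int => s /andP[s0 sx].
  have sb : 0 <= s <= b.
    apply/andP; split; first exact: s0.
    have xux : x - u <= x by rewrite lerBlDr lerDl.
    exact: (le_trans sx (le_trans xux xb')).
  have sx' : x - s <= b - s by rewrite lerB.
  have us : u <= x - s by rewrite lerBrDr -lerBrDl.
  have -> : P (x - s) = \sum_j A i j (x - s + s) * F j (s, x - s).
    by rewrite /P subrK subKr.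
  rewrite -(dens_sub (E_dens i sb) u0 us sx') opprB.
  by rewrite addrCA subrr addr0.
have [iH _ _ _] := H_triangle (u := 0) ltac:(by rewrite lexx).
have ig : intg 0 x (g' i) by have [h _] := dg i; exact: intgS h.
have GE u : 0 <= u <= x -> Gg i (u, x - u) = g' i u - P u + H u.
  by move=> _; exact: GgE.
have iG : intg 0 x (fun u => Gg i (u, x - u)).
  have h : intg 0 x (fun u => g' i u - P u + H u) by apply: intgD => //; exact: intgB.
  by apply: eq_intg h => t /GE.
split => // u hu; have /andP[u0 ux] := hu.
have h0 : (0 : R) <= 0 <= x by apply/andP; split; [exact: lexx|exact: x0].
rewrite (star u hu) (star 0 h0).
rewrite (@eq_Int R 0 u _ (fun u => g' i u - P u + H u)); last first.
  by move=> t /andP[t0 tu]; rewrite GE// t0 (le_trans tu).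
have igu := intgS (lexx 0) ux ig; have iHu := intgS (lexx 0) ux iH.
rewrite IntD//; last exact: intgB.
rewrite IntB// (@Int_chasles R 0 x u P)// (@Int_chasles R 0 x u H)//.
have [_ ->] := dg i; last by rewrite u0 (le_trans ux).
ring.
Qed.

(** [P] is continuous and [H] bounded, so square integrability is inherited from g'. *)
Lemma goursat_line_inL2 : inL2 0 b (g' i) -> inL2 0 x (fun u => Gg i (u, x - u)).
Proof.
move=> hg; have cP : continuous P.
  move=> t; apply: continuous_bigsum => j {}t; apply: cvgM; first exact: cvg_cst.
  by have := @continuous2_comp R (F j) (fun u => x - u) (fun u => u) (@cF j) (@csub x) cid t.
have [iH _ _ [C hC]] := H_triangle (u := 0) ltac:(by rewrite lexx).
have h : inL2 0 x (fun u => g' i u - P u + 1 * H u).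
  apply: inL2D; first by apply: inL2B; [exact: inL2S hg|exact: inL2_cont].
  apply: (inL2M_bounded (M := C)) => //; first by apply: inL2_cont; exact: cst_continuous.
  exact: intg_meas iH.
by apply: eq_inL2 h => t _; rewrite GgE mul1r.
Qed.

End Line.
Section Step.
Hypotheses (cA' : forall i j, continuous (A' i j))
  (cg' : forall i, continuous (g' i)).

Let cDg i : continuous (fun z : R * R => Dg i z.1 z.2).
Proof.
have c12 : continuous (fun z : R * R => z.1 + z.2).
  by move=> z; apply: cvgD; [exact: fst_cont|exact: snd_cont].
have c21 : continuous (fun z : R * R => z.2 + z.1).
  by move=> z; apply: cvgD; [exact: snd_cont|exact: fst_cont].
apply: continuous_bigsum => j z; apply: cvgD; apply: cvgM.
- by apply: (@continuous_comp _ _ _ (fun z : R * R => z.2 + z.1) (A' i j));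
    [exact: c21|exact: cA'].
- exact: (continuous2_comp2 (@cF j) (@fst_cont R) (@snd_cont R)).
- by apply: (@continuous_comp _ _ _ (fun z : R * R => z.2 + z.1) (A i j));
    [exact: c21|exact: cA].
apply: continuous_bigsum => k {}z; apply: cvgM.
  by apply: (@continuous_comp _ _ _ (fun z : R * R => z.1 + z.2) (A j k));
    [exact: c12|exact: cA].
exact: (continuous2_comp2 (@cF k) (@snd_cont R) (@fst_cont R)).
Qed.

Lemma Gg_continuous i : continuous (Gg i).
Proof.
move=> z; apply: cvgD; first apply: cvgB.
- by apply: (@continuous_comp _ _ _ (fun z : R * R => z.1) (g' i));
    [exact: fst_cont|exact: cg'].
- apply: continuous_bigsum => j {}z; apply: cvgM.
    apply: (@continuous_comp _ _ _ (fun z : R * R => z.1 + z.2) (A i j)).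
      by apply: cvgD; [exact: fst_cont|exact: snd_cont].
    exact: cA.
  exact: (continuous2_comp2 (@cF j) (@snd_cont R) (@fst_cont R)).
- exact: (Int_param_continuous (@cDg i)).
Qed.

Let cDg1 i s : continuous (Dg i s).
Proof.
by have := @continuous2_comp R _ (fun=> s) (fun u => u) (@cDg i) (@ccst s) cid.
Qed.

Let cDg2 i u : continuous (fun s => Dg i s u).
Proof.
by have := @continuous2_comp R _ (fun s => s) (fun=> u) (@cDg i) cid (@ccst u).
Qed.

(** The derivative of [F j (s, u)] in s, the variable in which the system prescribes no derivative;
    it is found by differentiating the Goursat equation under the integral sign, and [F1_dens]
    justifies this by Fubini. *)
Let F1 u j s := g' j s + Int 0 u (fun r => Dg j r s).

Let cF1 u j : continuous (F1 u j).
Proof.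
move=> s; apply: cvgD; first exact: cg'.
exact: (continuous2_comp (Int_param_continuous (@cDg j)) cid (@ccst u)).
Qed.

Let F1_dens u j : 0 <= u <= b -> dens 0 (b - u) (fun s => F j (s, u)) (F1 u j).
Proof.
move=> /andP[u0 ub]; split; first by apply: intg_cont; exact: cF1.
move=> s /andP[s0 su].
have sub : s + u <= b by rewrite -lerBrDr.
have ub' : 0 + u <= b by rewrite add0r.
rewrite (@GF j s u s0 u0 sub) (@GF j 0 u (lexx 0) u0 ub').
have cEr (y : R) : continuous (fun r => \sum_k A j k (y + r) * F k (r, y)).
  exact: (cE (@caddl y) cid (@ccst y)).
have [M _ hM] := cont2_bounded b (@cDg j).
have [|||||e1 e2 e3] := @Int_Fubini R 0 u 0 s (fun r y => Dg j r y)
    (fun=> M * (s - 0)).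
- by apply: continuous2_measurable; exact: cDg.
- by move=> r _; apply: intg_cont; exact: cDg1.
- by move=> y _; apply: intg_cont; exact: cDg2.
- exact: intg_cst.
- move=> r /andP[r0 ru]; rewrite -(Int_cst M s0); apply: le_Int.
  + by apply: intg_norm; apply: intg_cont; exact: cDg1.
  + exact: intg_cst.
  + move=> y /andP[y0 ys]; apply: hM; apply/andP; split=> //.
      exact: le_trans ub.
    by apply: (le_trans ys); rewrite (le_trans su)// lerBlDr lerDl.
rewrite /F1 IntD; [|by apply: intg_cont; exact: cg'|exact: e2].
rewrite -e3 (@eq_Int R 0 u (fun r => Int 0 s (Dg j r)) (fun r => (\sum_k A j k (s + r) * F k (r, s)) -
    (\sum_k A j k (0 + r) * F k (r, 0)))); last first.
  move=> r /andP[r0 ru]; have rb : 0 <= r <= b by rewrite r0 (le_trans ru).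
  have srb : s <= b - r by rewrite (le_trans su)// lerB.
  exact: (esym (dens_sub (E_dens j rb) (lexx 0) s0 srb)).
rewrite IntB; [|by apply: intg_cont; exact: cEr|by apply: intg_cont; exact: cEr].
have [_ dgj] := dg j; rewrite (dgj s); last first.
  by rewrite s0 (le_trans su)// lerBlDr lerDl.
by ring.
Qed.

(** The value of [Gg] on the line v = 0, that is, the datum of the differentiated problem. *)
Definition g1 i u := g' i u - \sum_j A i j u * F j (0, u).

(* The derivatives of F along the lines u + v = x solve again a Goursat problem,
   so that the regularity of F can be bootstrapped. *)
Lemma goursat_step : goursat (fun i j u => - A i j u) g1 Gg.
Proof.
move=> i u v u0 v0 uvb.
have ub : 0 <= u <= b by rewrite u0 (le_trans _ uvb)// lerDl.
have vb : v <= b - u by rewrite lerBrDr addrC.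
pose S s := \sum_j (A' i j (u + s) * F j (s, u) + A i j (u + s) * F1 u j s).
have dS : dens 0 v (fun s => \sum_j A i j (u + s) * F j (s, u)) S.
  apply: dens_sum => j; apply: densM; last exact: densS (F1_dens j ub).
  have h : dens 0 v (fun s => A i j (s + u)) (fun s => A' i j (s + u)).
    by apply: dens_shift; rewrite add0r; apply: densS (dA i j) => //; rewrite addrC.
  by apply: eq_dens h => s _; rewrite addrC.
have e := dens_sub dS (lexx 0) v0 (lexx v).
have iS : intg 0 v S by case: dS.
have iD : intg 0 v (fun s => Dg i s u) by exact: Dg_intg2.
(* The terms with [A'] cancel in the difference. As [S] is the derivative in s of the Goursat
   integrand, its integral is a difference of two boundary values. *)
rewrite (@eq_Int R 0 v _ (fun s => Dg i s u - S s)); last first.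
  move=> s _; rewrite /Dg /S -sumrB; apply: eq_bigr => j _.
  rewrite /Gg /F1 /=; ring.
by rewrite IntB// -e /Gg /g1 /= addr0; ring.
Qed.

End Step.
End Goursat.

Section GoursatRegularity.
Variables (R : realType) (I : finType) (b : R).
Hypothesis b0 : 0 <= b.

(** At m = 0 the derivatives of A and g are merely square integrable, so [Gg] need not be continuous
    and only its restrictions to lines are used. For larger m these derivatives have continuous
    representatives, and the induction hypothesis applies to [Gg], with coefficients -A and data
    [g1]. *)
Lemma goursat_Reg m (A : I -> I -> R -> R) (g : I -> R -> R) (F : I -> R * R -> R) :
  (forall i j, continuous (A i j)) -> (forall i j, Reg 0 b m.+1 (A i j)) ->
  (forall i, Reg 0 b m.+1 (g i)) -> (forall i, continuous (F i)) ->
  goursat b A g F ->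
  forall i x, 0 <= x <= b -> Reg 0 x m.+1 (fun u => F i (u, x - u)).
Proof.
elim: m A g F => [|m ih] A g F cA hA hg cF GF i x xb.
  pose A0 i j := sval (cid2 (hA i j)); pose g' i := sval (cid2 (hg i)).
  pose A' i j := trim 0 b (A0 i j).
  have hA0 i' j : inL2 0 b (A0 i' j) by rewrite /A0; case: cid2.
  have iA0 i' j := inL2_intg (hA0 i' j).
  have mA' i' j : measurable_fun setT (A' i' j).
    by apply: measurable_trim; have [] := hA0 i' j.
  have iA' i' j a c : intg a c (A' i' j) by apply: intg_trim; exact: iA0.
  have dA i' j : dens 0 b (A i' j) (A' i' j).
    have h : dens 0 b (A i' j) (A0 i' j) by rewrite /A0; case: cid2.
    by apply: eq_dens h => t tb //; rewrite /A' trim_id.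
  have dg i' : dens 0 b (g i') (g' i') by rewrite /g'; case: cid2.
  have hg' i' : inL2 0 b (g' i') by rewrite /g'; case: cid2.
  exists (fun u => Gg A A' g' F i (u, x - u)).
    exact: (goursat_line_inL2 cA mA' iA' cF xb (hg' i)).
  exact: (goursat_line_dens cA mA' iA' dA dg cF GF i xb).
pose A0 i j := sval (cid2 (hA i j)); pose g0 i := sval (cid2 (hg i)).
have hA0 i' j : Reg 0 b m.+1 (A0 i' j) by rewrite /A0; case: cid2.
have hg0 i' : Reg 0 b m.+1 (g0 i') by rewrite /g0; case: cid2.
pose A' i j := A0 i j \o clamp 0 b; pose g' i := g0 i \o clamp 0 b.
have cA' i' j : continuous (A' i' j).
  by apply: continuous_clamp => //; exact: Reg_within (hA0 i' j).
have cg' i' : continuous (g' i').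
  by apply: continuous_clamp => //; exact: Reg_within (hg0 i').
have mA' i' j : measurable_fun setT (A' i' j) by exact: continuous_measurable_fun.
have iA' i' j a c : intg a c (A' i' j) by exact: intg_cont.
have dA i' j : dens 0 b (A i' j) (A' i' j).
  have h : dens 0 b (A i' j) (A0 i' j) by rewrite /A0; case: cid2.
  by apply: eq_dens h => t tb //; rewrite /A' /= clamp_id.
have dg i' : dens 0 b (g i') (g' i').
  have h : dens 0 b (g i') (g0 i') by rewrite /g0; case: cid2.
  by apply: eq_dens h => t tb //; rewrite /g' /= clamp_id.
exists (fun u => Gg A A' g' F i (u, x - u)); last first.
  exact: (goursat_line_dens cA mA' iA' dA dg cF GF i xb).
apply: (ih (fun i j u => - A i j u) (g1 A g' F) (Gg A A' g' F)) => //.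
- by move=> i' j t; apply: cvgN; exact: cA.
- by move=> i' j; apply: RegN; apply: RegW => //; exact: hA.
- move=> i'; apply: RegB.
    by apply: eq_Reg (hg0 i') => t tb; rewrite /g' /= clamp_id.
  apply: Reg_sum => j; apply: RegM => //; first by apply: RegW => //; exact: hA.
  have F0 k s : 0 <= s <= b -> F k (s, 0) = g k s.
    by move=> /andP[s0 sb]; rewrite GF ?addr0// Int_pt addr0.
  (* The boundary values F j (0, u), which enter [g1], are primitives of sums of products of A and
     g, because F k (s, 0) = g k s. *)
  have h : Reg 0 b m.+2 (fun u => F j (0, 0) + Int 0 u (fun s => \sum_k A j k s * g k s)).
    apply: Reg_prim => //; apply: Reg_sum => k.
    by apply: RegM => //; apply: RegW => //; exact: hg.
  apply: RegW => //; apply: eq_Reg h => u /andP[u0 ub].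
  rewrite (GF j 0 u)// ?add0r// F0 ?lexx//; congr (_ + _).
  apply: eq_Int => s /andP[s0 su]; apply: eq_bigr => k _.
  by rewrite add0r F0// s0 (le_trans su).
- by move=> i'; exact: Gg_continuous.
- exact: goursat_step.
Qed.

End GoursatRegularity.

(** * Complex-valued functions *)

Section ComplexValued.
Variable R : realType.
Local Notation Re := (@complex.Re R).
Local Notation Im := (@complex.Im R).
Implicit Types (z w : R[i]) (a b c x : R) (f g : R -> R[i]).

Lemma cReD z w : Re (z + w) = Re z + Re w. Proof. by case: z; case: w. Qed.
Lemma cImD z w : Im (z + w) = Im z + Im w. Proof. by case: z; case: w. Qed.
Lemma cReN z : Re (- z) = - Re z. Proof. by case: z. Qed.
Lemma cImN z : Im (- z) = - Im z. Proof. by case: z. Qed.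
Lemma cReM z w : Re (z * w) = Re z * Re w - Im z * Im w.
Proof. by case: z; case: w. Qed.
Lemma cImM z w : Im (z * w) = Re z * Im w + Im z * Re w.
Proof. by case: z => a b; case: w. Qed.

Lemma complex_eq z w : Re z = Re w -> Im z = Im w -> z = w.
Proof. by case: z => a b; case: w => c d /= -> ->. Qed.

Lemma Re_sum (J : Type) (r : seq J) (P : pred J) (F : J -> R[i]) :
  Re (\sum_(j <- r | P j) F j) = \sum_(j <- r | P j) Re (F j).
Proof. by apply: (big_morph Re cReD). Qed.

Lemma Im_sum (J : Type) (r : seq J) (P : pred J) (F : J -> R[i]) :
  Im (\sum_(j <- r | P j) F j) = \sum_(j <- r | P j) Im (F j).
Proof. by apply: (big_morph Im cImD). Qed.

Definition cis x : R[i] := cos x +i* sin x.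

Lemma cisD x y : cis (x + y) = cis x * cis y.
Proof. by apply: complex_eq; rewrite /cis ?cReM ?cImM /= ?cosD ?sinD// addrC. Qed.

Lemma cis0 : cis 0 = 1.
Proof. by rewrite /cis cos0 sin0. Qed.

Lemma cisN x : cis x * cis (- x) = 1.
Proof. by rewrite -cisD subrr cis0. Qed.

Definition cder x f (d : R[i]) :=
  is_derive x 1 (fun t => Re (f t)) (Re d) /\ is_derive x 1 (fun t => Im (f t)) (Im d).

Lemma cderD x f g d e : cder x f d -> cder x g e -> cder x (fun t => f t + g t) (d + e).
Proof.
move=> [f1 f2] [g1 g2]; split; rewrite ?cReD ?cImD.
  by under eq_fun do rewrite cReD; exact: is_deriveD.
by under eq_fun do rewrite cImD; exact: is_deriveD.
Qed.

Lemma cderM x f g d e : cder x f d -> cder x g e ->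
  cder x (fun t => f t * g t) (d * g x + f x * e).
Proof.
move=> [f1 f2] [g1 g2]; split; rewrite ?cReD ?cImD ?cReM ?cImM.
  under eq_fun do rewrite cReM.
  by apply: is_derive_eq; rewrite /GRing.scale /=; ring.
under eq_fun do rewrite cImM.
by apply: is_derive_eq; rewrite /GRing.scale /=; ring.
Qed.

Lemma cder_cst x k : cder x (fun=> k) 0.
Proof. by split; exact: is_derive_cst. Qed.

Lemma cderZ x k f d : cder x f d -> cder x (fun t => k * f t) (k * d).
Proof. by move=> h; have := cderM (cder_cst x k) h; rewrite mul0r add0r. Qed.

Lemma cder_cis k x : cder x (fun t => cis (k * t)) ('i%C * k%:C * cis (k * x)).
Proof.
split; rewrite ?cReM ?cImM /=.
  have h : is_derive x 1 (fun t => k * t) k.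
    by apply: is_derive_eq; rewrite scaler1.
  have h' : is_derive x 1 (fun t => cos (k * t)) (- sin (k * x) * k).
    exact: (is_derive1_comp (is_derive_cos (k * x)) h).
  by apply: (is_derive_eq h'); ring.
have h : is_derive x 1 (fun t => k * t) k.
  by apply: is_derive_eq; rewrite scaler1.
have h' : is_derive x 1 (fun t => sin (k * t)) (cos (k * x) * k).
  exact: (is_derive1_comp (is_derive_sin (k * x)) h).
by apply: (is_derive_eq h'); ring.
Qed.

Definition ccont (T : topologicalType) (f : T -> R[i]) :=
  continuous (fun t => Re (f t)) /\ continuous (fun t => Im (f t)).

Section Ccont.
Variable T : topologicalType.
Implicit Types (h k : T -> R[i]).

Lemma ccontD h k : ccont h -> ccont k -> ccont (fun t => h t + k t).
Proof.
move=> [h1 h2] [k1 k2]; split.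
  by under eq_fun do rewrite cReD; move=> t; apply: cvgD; [exact: h1|exact: k1].
by under eq_fun do rewrite cImD; move=> t; apply: cvgD; [exact: h2|exact: k2].
Qed.

Lemma ccontM h k : ccont h -> ccont k -> ccont (fun t => h t * k t).
Proof.
move=> [h1 h2] [k1 k2]; split.
  under eq_fun do rewrite cReM; move=> t; apply: cvgB; apply: cvgM;
    by [exact: h1|exact: k1|exact: h2|exact: k2].
under eq_fun do rewrite cImM; move=> t; apply: cvgD; apply: cvgM;
  by [exact: h1|exact: k1|exact: h2|exact: k2].
Qed.

Lemma ccont_cst (z : R[i]) : ccont (fun _ : T => z).
Proof. by split => t; exact: cvg_cst. Qed.

Lemma ccontN h : ccont h -> ccont (fun t => - h t).
Proof.
move=> [h1 h2]; split.
  by under eq_fun do rewrite cReN; move=> t; apply: cvgN; exact: h1.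
by under eq_fun do rewrite cImN; move=> t; apply: cvgN; exact: h2.
Qed.

Lemma ccont_cis (h : T -> R) : continuous h -> ccont (fun t => cis (h t)).
Proof.
move=> ch; split => t /=.
  by apply: continuous_comp; [exact: ch|exact: continuous_cos].
by apply: continuous_comp; [exact: ch|exact: continuous_sin].
Qed.

End Ccont.

Lemma ccont_comp (S T : topologicalType) (h : S -> T) (k : T -> R[i]) :
  continuous h -> ccont k -> ccont (fun t => k (h t)).
Proof.
move=> ch [k1 k2]; split => t.
  by apply: (@continuous_comp _ _ _ h (fun t => Re (k t))); [exact: ch|exact: k1].
by apply: (@continuous_comp _ _ _ h (fun t => Im (k t))); [exact: ch|exact: k2].
Qed.

Definition cintg a b f := intg a b (fun t => Re (f t)) /\ intg a b (fun t => Im (f t)).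

Definition Cint a b f : R[i] := Int a b (fun t => Re (f t)) +i* Int a b (fun t => Im (f t)).

Lemma ccont_cintg a b f : ccont f -> cintg a b f.
Proof. by move=> [h1 h2]; split; exact: intg_cont. Qed.

Lemma eq_Cint a b f g : (forall t, a <= t <= b -> f t = g t) -> Cint a b f = Cint a b g.
Proof.
by move=> fg; rewrite /Cint; congr Complex; apply: eq_Int => t tab; rewrite fg.
Qed.

Lemma CintD a b f g : cintg a b f -> cintg a b g ->
  Cint a b (fun t => f t + g t) = Cint a b f + Cint a b g.
Proof.
move=> [f1 f2] [g1 g2]; apply: complex_eq; rewrite ?cReD ?cImD /= -IntD//.
  by apply: eq_Int => t _; rewrite cReD.
by apply: eq_Int => t _; rewrite cImD.
Qed.

Lemma cintgZ a b k f : cintg a b f -> cintg a b (fun t => k * f t).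
Proof.
move=> [f1 f2]; split.
  by under eq_fun do rewrite cReM; apply: intgB; exact: intgZ.
by under eq_fun do rewrite cImM; apply: intgD; exact: intgZ.
Qed.

Lemma CintZ a b k f : cintg a b f -> Cint a b (fun t => k * f t) = k * Cint a b f.
Proof.
move=> [f1 f2]; apply: complex_eq; rewrite ?cReM ?cImM /= -!IntZ//.
  by rewrite -IntB; [apply: eq_Int => t _; rewrite cReM|exact: intgZ|exact: intgZ].
by rewrite -IntD; [apply: eq_Int => t _; rewrite cImM|exact: intgZ|exact: intgZ].
Qed.

Lemma CintB a b f g : cintg a b f -> cintg a b g ->
  Cint a b (fun t => f t - g t) = Cint a b f - Cint a b g.
Proof.
move=> hf hg; rewrite -mulN1r -CintZ// -CintD//; last exact: cintgZ.
by apply: eq_Cint => t _; rewrite mulN1r.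
Qed.

Lemma Cint_FTC a b f g : a <= b -> ccont f -> ccont g ->
  (forall t, a < t < b -> cder t f (g t)) -> Cint a b g = f b - f a.
Proof.
move=> ab [f1 f2] [g1 g2] d; apply: complex_eq; rewrite ?cReD ?cImD ?cReN ?cImN /=.
  by apply: (Int_FTC (F := fun t => Re (f t))) => // [| |t /d[]//];
    exact: continuous_subspaceT.
by apply: (Int_FTC (F := fun t => Im (f t))) => // [| |t /d[]//];
  exact: continuous_subspaceT.
Qed.

Lemma Cint_affine a b c d f : 0 < c -> ccont f ->
  Cint (c * a + d) (c * b + d) f = c%:C * Cint a b (fun t => f (c * t + d)).
Proof.
move=> c0 [f1 f2]; apply: complex_eq; rewrite ?cReM ?cImM /= !mul0r ?subr0 ?addr0.
  by apply: (@Int_affine _ c d a b (fun t => Re (f t))) => //; exact: intg_cont.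
by apply: (@Int_affine _ c d a b (fun t => Im (f t))) => //; exact: intg_cont.
Qed.

Lemma Cint_refl c a b f : ccont f ->
  Cint (c - b) (c - a) (fun t => f (c - t)) = Cint a b f.
Proof.
move=> [f1 f2]; apply: complex_eq.
  by apply: (@Int_refl _ c a b (fun t => Re (f t))); exact: intg_cont.
by apply: (@Int_refl _ c a b (fun t => Im (f t))); exact: intg_cont.
Qed.

Lemma Int_triangle_cont b (h : R * R -> R) : continuous h ->
  Int 0 b (fun s => Int s b (fun t => h (s, t))) =
  Int 0 b (fun t => Int 0 t (fun s => h (s, t))).
Proof.
move=> ch; have [bn|b0] := ltP b 0; first by rewrite !Int_itv_ge.
have c1 s : continuous (fun t => h (s, t)).
  by apply: continuous2_comp => // t; [exact: cvg_cst|exact: cvg_id].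
have c2 t : continuous (fun s => h (s, t)).
  by apply: continuous2_comp => // s; [exact: cvg_id|exact: cvg_cst].
have [M _ hM] := cont2_bounded b ch.
have [|||||_ _ e] := @Int_triangle R 0 b (fun s t => h (s, t)) (fun=> M * (b - 0)).
- apply: continuous2_measurable.
  exact: (continuous2_comp2 ch (@fst_cont R) (@snd_cont R)).
- by move=> s _; exact: intg_cont.
- by move=> t _; exact: intg_cont.
- exact: intg_cst.
- move=> s sb; rewrite -(Int_cst M b0); apply: le_Int.
  + by apply: intg_norm; exact: intg_cont.
  + exact: intg_cst.
  + by move=> t tb; exact: hM.
- exact: e.
Qed.

Lemma Cint_triangle b (h : R * R -> R[i]) : ccont h ->
  Cint 0 b (fun s => Cint s b (fun t => h (s, t))) =
  Cint 0 b (fun t => Cint 0 t (fun s => h (s, t))).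
Proof.
move=> [h1 h2]; apply: complex_eq.
  exact: (Int_triangle_cont b h1).
exact: (Int_triangle_cont b h2).
Qed.

Lemma Cint_param (h : R * R -> R[i]) : ccont h ->
  ccont (fun z : R * R => Cint 0 z.2 (fun s => h (s, z.1))).
Proof.
move=> [h1 h2]; split.
  exact: (Int_param_continuous h1).
exact: (Int_param_continuous h2).
Qed.

End ComplexValued.

(** * Fourier uniqueness and Zakharov-Shabat systems *)

Section FourierUniqueness.
Variable R : realType.
Implicit Types (x s w : R) (h : R -> R).

(* h is orthogonal to every trigonometric polynomial, in particular to the
   translates of cos^n, which concentrate at s as n grows. *)
Lemma trig_kernel_power x mu s h : continuous h ->
  (forall lam, Int 0 x (fun w => h w * cos (lam * w)) = 0) ->
  (forall lam, Int 0 x (fun w => h w * sin (lam * w)) = 0) ->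
  forall n lam, Int 0 x (fun w => h w * cos (mu * (w - s)) ^+ n *
    cos (lam * (w - s))) = 0.
Proof.
move=> ch hc hs.
have ctr (f : R -> R) (k : R) : continuous f -> continuous (fun w => f (k * w)).
  move=> cf w; apply: (@continuous_comp _ _ _ (fun w => k * w) f); last exact: cf.
  by apply: cvgM; [exact: cvg_cst|exact: cvg_id].
have ctr' (f : R -> R) (k : R) : continuous f -> continuous (fun w => f (k * (w - s))).
  move=> cf w; apply: (@continuous_comp _ _ _ (fun w => k * (w - s)) f); last exact: cf.
  by apply: cvgM; [exact: cvg_cst|apply: cvgB; [exact: cvg_id|exact: cvg_cst]].
have cX n : continuous (fun w : R => cos (mu * (w - s)) ^+ n).
  move=> w; apply: (@continuous_comp _ _ _ (fun w => cos (mu * (w - s))) (fun y => y ^+ n)).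
    exact: (ctr' _ _ (@continuous_cos R)).
  exact: exprn_continuous.
elim=> [|n ih] lam.
  rewrite (@eq_Int R 0 x _ (fun w => cos (lam * s) * (h w * cos (lam * w)) +
     sin (lam * s) * (h w * sin (lam * w)))).
    rewrite IntD ?IntZ ?hc ?hs ?mulr0 ?addr0//; try apply: intgZ;
      apply: intg_cont => w; apply: cvgM; try exact: ch;
      by [exact: (ctr _ _ (@continuous_cos R))|exact: (ctr _ _ (@continuous_sin R))].
  by move=> w _; rewrite expr0 mulr1 mulrBr cosB; ring.
have i1 l : intg 0 x (fun w => h w * cos (mu * (w - s)) ^+ n * cos (l * (w - s))).
  apply: intg_cont => w; apply: cvgM; last exact: (ctr' _ _ (@continuous_cos R)).
  by apply: cvgM; [exact: ch|exact: cX].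
rewrite (@eq_Int R 0 x _ (fun w =>
    2^-1 * (h w * cos (mu * (w - s)) ^+ n * cos ((lam + mu) * (w - s))) +
    2^-1 * (h w * cos (mu * (w - s)) ^+ n * cos ((lam - mu) * (w - s))))).
  by rewrite IntD ?IntZ ?ih ?mulr0 ?addr0//; exact: intgZ.
by move=> w _; rewrite exprS [(lam + mu) * _]mulrDl [(lam - mu) * _]mulrBl cosD cosB; field.
Qed.

(** With the frequency pi / (2 x) the angle mu |w - s| stays in [0, pi / 2], where the cosine is
    nonnegative and decreasing. On an interval of length d within distance d of s the integrand is
    at least (h s / 2) r1^n, and farther than de from s it is at least -M r2^n. Since r2 < r1, the
    integral is positive for large n. *)
Lemma peak_contra x s h : 0 < x -> 0 <= s <= x -> continuous h -> 0 < h s ->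
  (forall n, Int 0 x (fun w => h w * cos (pi / 2 / x * (w - s)) ^+ n) = 0) -> False.
Proof.
move=> x0 /andP[s0 sx] ch hs0 hI; set mu := pi / 2 / x in hI.
have mu0 : 0 < mu by rewrite /mu !divr_gt0 ?pi_gt0.
have mux : mu * x = pi / 2 by rewrite /mu divfK// lt0r_neq0.
have hs2 : 0 < h s / 2 by rewrite divr_gt0.
have [de [de0 dex hde]] : exists de, [/\ 0 < de, de <= x &
    forall w, `|w - s| <= de -> h s / 2 <= h w].
  have := ch s => /cvgrPdist_lt /(_ _ hs2) /nbhs_ballP[e /= e0 he].
  exists (Num.min (e / 2) x); split.
  - by rewrite lt_min x0 divr_gt0.
  - by rewrite ge_min lexx orbT.
  - move=> w; rewrite le_min => /andP[we _].
    have := he w; rewrite /ball /= distrC => /(_ _).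
    have -> : `|w - s| < e by rewrite (le_lt_trans we)// gtr_pMr// invf_lt1// ltr1n.
    by move=> /(_ isT); rewrite ltr_norml => /andP[h1 h2]; lra.
pose d := de / 2; have d0 : 0 < d by rewrite divr_gt0.
have [M M0 hM] := cont_bounded 0 x ch.
have ang w : 0 <= w <= x -> 0 <= mu * `|w - s| <= pi / 2.
  move=> /andP[w0 wx]; rewrite mulr_ge0 ?(ltW mu0)//= -mux ler_pM2l//.
  by rewrite ler_norml; apply/andP; split; lra.
have pi2 : (pi : R) / 2 <= pi by rewrite ler_pdivrMr// ler_peMr ?pi_ge0// ler1n.
have in_pi (t : R) : 0 <= t <= pi / 2 -> t \in `[0, pi].
  by move=> /andP[h1 h2]; rewrite in_itv /= h1 (le_trans h2 pi2).
have cosA w : cos (mu * (w - s)) = cos (mu * `|w - s|).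
  by rewrite -{2}(gtr0_norm mu0) -normrM cos_norm.
have cos0' w : 0 <= w <= x -> 0 <= cos (mu * (w - s)).
  move=> /ang /andP[h1 h2]; rewrite cosA cos_ge0_pihalf// h2 andbT.
  by rewrite (le_trans _ h1)// oppr_le0 divr_ge0// pi_ge0.
have amu t : 0 <= t -> t <= x -> 0 <= mu * t <= pi / 2.
  by move=> t0 tx; rewrite mulr_ge0 ?(ltW mu0)//= -mux ler_pM2l.
have dx : d <= x by rewrite /d; lra.
pose r1 := cos (mu * d); pose r2 := cos (mu * de).
have r21 : r2 < r1.
  rewrite /r2 /r1 ltr_cos ?in_pi ?amu// ?(ltW d0)// ?(ltW de0)//.
  by rewrite ltr_pM2l// /d; lra.
have r20 : 0 <= r2.
  have /andP[h1 h2] := amu de (ltW de0) dex.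
  by rewrite /r2 cos_ge0_pihalf// h2 andbT (le_trans _ h1)// oppr_le0 divr_ge0// pi_ge0.
have r10 : 0 < r1 by exact: le_lt_trans r21.
(* As s may be an end point of [0, x], the interval around the peak lies on one side of s; on one of
   the two sides it fits because 2 d = de <= x. *)
have [p [q [p0 pq qx qpd near]]] : exists p q, [/\ 0 <= p, p <= q, q <= x, q - p = d &
    forall w, p <= w <= q -> `|w - s| <= d].
  have [h1|h1] := leP (s + d) x.
    exists s, (s + d); split => //; rewrite ?lerDl ?ltW//; first by ring.
    by move=> w /andP[h2 h3]; rewrite ler_norml; apply/andP; split; lra.
  exists (s - d), s; split => //; rewrite ?gerBl ?(ltW d0)//; last 2 first.
  - by ring.
  - by move=> w /andP[h2 h3]; rewrite ler_norml; apply/andP; split; lra.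
  - by rewrite /d in h1 *; lra.
have key n : h s / 2 * r1 ^+ n * d <= M * r2 ^+ n * x.
  pose f w := h w * cos (mu * (w - s)) ^+ n.
  have cf : continuous f.
    move=> w; apply: cvgM; first exact: ch.
    apply: (@continuous_comp _ _ _ (fun w => cos (mu * (w - s))) (fun y => y ^+ n)).
      apply: (@continuous_comp _ _ _ (fun w => mu * (w - s)) cos).
        by apply: cvgM; [exact: cvg_cst|apply: cvgB; [exact: cvg_id|exact: cvg_cst]].
      exact: continuous_cos.
    exact: exprn_continuous.
  have if_ a b : intg a b f by exact: intg_cont.
  have lo w : 0 <= w <= x -> - (M * r2 ^+ n) <= f w.
    move=> wx; have c0 := cos0' _ wx.
    have [near'|far] := leP `|w - s| de.
      apply: (@le_trans _ _ 0); first by rewrite oppr_le0 mulr_ge0// exprn_ge0.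
      by rewrite mulr_ge0 ?exprn_ge0// (le_trans _ (hde _ near'))// ltW.
    have cr : cos (mu * (w - s)) <= r2.
      rewrite cosA /r2 ltW// ltr_cos ?in_pi ?ang ?amu// ?(ltW de0)//.
      by rewrite ltr_pM2l.
    have : `|f w| <= M * r2 ^+ n.
      rewrite normrM ler_pM// ?hM// ger0_norm ?exprn_ge0//.
      by rewrite lerXn2r ?nnegrE.
    by rewrite ler_norml => /andP[].
  have hi w : p <= w <= q -> h s / 2 * r1 ^+ n <= f w.
    move=> wpq; have /andP[wp wq] := wpq; have nw := near _ wpq.
    have wx : 0 <= w <= x by rewrite (le_trans p0)// (le_trans wq).
    have nd : `|w - s| <= de by rewrite (le_trans nw)// /d; lra.
    rewrite ler_pM ?exprn_ge0 ?(ltW hs2) ?(ltW r10)//; first exact: hde.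
    rewrite lerXn2r ?nnegrE ?(ltW r10) ?cos0'//.
    rewrite cosA /r1 leNgt ltr_cos ?in_pi ?ang ?amu// ?(ltW d0)//.
    by rewrite ltr_pM2l// -leNgt.
  have px : p <= x by exact: le_trans qx.
  have := hI n; rewrite -/f (@Int_chasles _ 0 x p)// (@Int_chasles _ p x q)// => e.
  have l1 : - (M * r2 ^+ n) * (p - 0) <= Int 0 p f.
    rewrite -Int_cst//; apply: le_Int => //; first exact: intg_cst.
    by move=> t /andP[t0 tp]; rewrite lo// t0 (le_trans tp).
  have l2 : h s / 2 * r1 ^+ n * (q - p) <= Int p q f.
    by rewrite -Int_cst//; apply: le_Int => //; exact: intg_cst.
  have l3 : - (M * r2 ^+ n) * (x - q) <= Int q x f.
    rewrite -Int_cst//; apply: le_Int => //; first exact: intg_cst.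
    by move=> t /andP[t0 tp]; rewrite lo// tp (le_trans p0)// (le_trans pq).
  rewrite qpd in l2.
  have l4 : 0 <= M * r2 ^+ n * (q - p).
    by rewrite mulr_ge0 ?subr_ge0// mulr_ge0// exprn_ge0.
  move: l1 l2 l3 l4 e; set X := M * _; set Y := _ * d; nra.
pose r := r2 / r1.
have rn : `|r| < 1 by rewrite ger0_norm ?divr_ge0 ?(ltW r10)// ltr_pdivrMr// mul1r.
have := cvg_expr rn => /cvgrPdist_lt.
have e0 : 0 < h s / 2 * d / (M * x + 1).
  by rewrite divr_gt0 ?mulr_gt0// ltr_wpDl// mulr_ge0// ltW.
move=> /(_ _ e0) [n _ /(_ n (leqnn n))].
rewrite sub0r normrN ger0_norm ?exprn_ge0 ?divr_ge0 ?(ltW r10)// => hr.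
have := key n; have rn0 : 0 < r1 ^+ n by rewrite exprn_gt0.
have -> : M * r2 ^+ n * x = M * x * r ^+ n * r1 ^+ n.
  by rewrite /r exprMn exprVn; field; exact: lt0r_neq0.
rewrite mulrAC ler_pM2r// leNgt => /negP; apply.
have Mx : 0 <= M * x by rewrite mulr_ge0// ltW.
have Mx1 : 0 < M * x + 1 by rewrite ltr_wpDl.
rewrite ltr_pdivlMr// in hr.
apply: le_lt_trans hr; rewrite mulrC ler_wpM2l ?lerDl// exprn_ge0// divr_ge0//.
exact: ltW.
Qed.

Lemma fourier_uniqueness x h : 0 < x -> continuous h ->
  (forall lam, Int 0 x (fun w => h w * cos (lam * w)) = 0) ->
  (forall lam, Int 0 x (fun w => h w * sin (lam * w)) = 0) ->
  forall s, 0 <= s <= x -> h s = 0.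
Proof.
move=> x0 ch hc hs s sx.
have key n : Int 0 x (fun w => h w * cos (pi / 2 / x * (w - s)) ^+ n) = 0.
  rewrite -[RHS](trig_kernel_power (pi / 2 / x) s ch hc hs n 0).
  by apply: eq_Int => w _; rewrite mul0r cos0 mulr1.
have ci n : intg 0 x (fun w => h w * cos (pi / 2 / x * (w - s)) ^+ n).
  apply: intg_cont => w; apply: cvgM; first exact: ch.
  apply: (@continuous_comp _ _ _ (fun w => cos (pi / 2 / x * (w - s))) (fun y => y ^+ n)).
    apply: (@continuous_comp _ _ _ (fun w => pi / 2 / x * (w - s)) cos).
      by apply: cvgM; [exact: cvg_cst|apply: cvgB; [exact: cvg_id|exact: cvg_cst]].
    exact: continuous_cos.
  exact: exprn_continuous.
have [hn|hp|//] := ltgtP (h s) 0; exfalso.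
  apply: (@peak_contra x s (fun w => - h w)) => //.
  - by move=> w; apply: cvgN; exact: ch.
  - by rewrite oppr_gt0.
  - move=> n; transitivity (- Int 0 x (fun w => h w * cos (pi / 2 / x * (w - s)) ^+ n)).
      by rewrite -IntN//; apply: eq_Int => w _; rewrite mulNr.
    by rewrite key oppr0.
exact: (@peak_contra x s h).
Qed.

Lemma fourier_uniqueness_complex x (h : R -> R[i]) : 0 < x -> ccont h ->
  (forall lam, Cint 0 x (fun w => h w * cis (lam * w)) = 0) ->
  forall s, 0 <= s <= x -> h s = 0.
Proof.
move=> x0 [h1 h2] hI s sx.
have ctr (k : R) (f g : R -> R) : continuous f -> continuous g ->
    intg 0 x (fun w => f w * g (k * w)).
  move=> cf cg; apply: intg_cont => w; apply: cvgM; first exact: cf.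
  apply: (@continuous_comp _ _ _ (fun w => k * w) g); last exact: cg.
  by apply: cvgM; [exact: cvg_cst|exact: cvg_id].
have cc := @continuous_cos R; have cs := @continuous_sin R.
have E lam : let f1 := fun w => complex.Re (h w) in let f2 := fun w => complex.Im (h w) in
    [/\ Int 0 x (fun w => f1 w * cos (lam * w)) - Int 0 x (fun w => f2 w * sin (lam * w)) = 0 &
    Int 0 x (fun w => f1 w * sin (lam * w)) + Int 0 x (fun w => f2 w * cos (lam * w)) = 0].
  move=> f1 f2; have := hI lam; rewrite /Cint => -[e1 e2]; split.
    rewrite -[RHS]e1 -IntB; [|exact: ctr|exact: ctr].
    by apply: eq_Int => w _; rewrite cReM.
  rewrite -[RHS]e2 -IntD; [|exact: ctr|exact: ctr].
  by apply: eq_Int => w _; rewrite cImM.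
(* The frequencies lam and -lam together separate the cosine integrals from the sine integrals. *)
have P lam : let f1 := fun w => complex.Re (h w) in let f2 := fun w => complex.Im (h w) in
    [/\ Int 0 x (fun w => f1 w * cos (lam * w)) = 0, Int 0 x (fun w => f1 w * sin (lam * w)) = 0,
    Int 0 x (fun w => f2 w * cos (lam * w)) = 0 & Int 0 x (fun w => f2 w * sin (lam * w)) = 0].
  move=> f1 f2; have [e1 e2] := E lam; have [] := E (- lam); rewrite -/f1 -/f2.
  have cN (f : R -> R) : Int 0 x (fun w => f w * cos (- lam * w)) = Int 0 x (fun w => f w * cos (lam * w)).
    by apply: eq_Int => w _; rewrite mulNr cosN.
  have sN (f : R -> R) : continuous f ->
      Int 0 x (fun w => f w * sin (- lam * w)) = - Int 0 x (fun w => f w * sin (lam * w)).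
    move=> cf; rewrite -IntN; last exact: ctr.
    by apply: eq_Int => w _; rewrite mulNr sinN mulrN.
  rewrite !cN !sN// -/f1 -/f2 in e1 e2 *.
  move: e1 e2; rewrite -/f1 -/f2; set a := Int _ _ _; set b := Int _ _ _.
  set c := Int _ _ _; set d := Int _ _ _ => e1 e2 e3 e4; split; lra.
apply: complex_eq.
  by apply: (fourier_uniqueness x0 h1) => // lam; have [] := P lam.
by apply: (fourier_uniqueness x0 h2) => // lam; have [] := P lam.
Qed.

End FourierUniqueness.

(** * From transmutation formulas to a Goursat problem *)

Section ZakharovShabat.
Variable R : realType.
Implicit Types (x lam : R).

Lemma ccont2_comp (T : topologicalType) (h : R * R -> R[i]) (p q : T -> R) : ccont h ->
  continuous p -> continuous q -> ccont (fun t => h (p t, q t)).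
Proof.
move=> ch cp cq; apply: (ccont_comp (h := fun t => (p t, q t))) => //.
by move=> t; exact: (cvg_pair (cp t) (cq t)).
Qed.

Lemma Cint0 a b : Cint a b (fun=> 0 : R[i]) = 0.
Proof.
apply: complex_eq; rewrite /Cint /=.
  by rewrite /Int /Rintegral integral0.
by rewrite /Int /Rintegral integral0.
Qed.

Lemma Cint_shift a b d (f : R -> R[i]) : ccont f ->
  Cint a b (fun t => f (t + d)) = Cint (a + d) (b + d) f.
Proof.
move=> cf; have := @Cint_affine R a b 1 d f ltr01 cf; rewrite !mul1r => ->.
by apply: eq_Cint => t _; rewrite mul1r.
Qed.

(** Exchanging the order of integration turns the right-hand side into a Fourier integral over w
    with density r a + 2 V, and uniqueness compares densities. The number r is the initial value of
    the other unknown: u2 (0) = 0 in [zs1], u1 (0) = 1 in [zs2]. *)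
Lemma volterra_fourier x (a : R -> R[i]) (f g : R * R -> R[i]) (r : R[i]) : 0 < x ->
  ccont a -> ccont f -> ccont g ->
  (forall lam, 2 * Cint 0 x (fun w => f (w, x - w) * cis (lam * w)) =
    Cint 0 x (fun y => a y * (r * cis (lam * y) +
      2 * Cint 0 y (fun w => g (y - w, w) * cis (lam * w))))) ->
  forall w, 0 <= w <= x ->
  f (w, x - w) = r / 2 * a w + Cint 0 (x - w) (fun s => a (w + s) * g (s, w)).
Proof.
move=> x0 ca cf cg H.
have cid : continuous (fun w : R => w) by move=> w; exact: cvg_id.
have csub (k : R) : continuous (fun w : R => k - w).
  by move=> w; apply: cvgB; [exact: cvg_cst|exact: cvg_id].
have cmul (k : R) : continuous (fun w : R => k * w).
  by move=> w; apply: cvgM; [exact: cvg_cst|exact: cvg_id].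
have c2 : ccont (fun z : R * R => a (z.2 + z.1) * g (z.1, z.2)).
  apply: ccontM; last by apply: ccont2_comp => //; [exact: fst_cont|exact: snd_cont].
  apply: (ccont_comp (h := fun z : R * R => z.2 + z.1)) => // z.
  by apply: cvgD; [exact: snd_cont|exact: fst_cont].
pose V w := Cint 0 (x - w) (fun s => a (w + s) * g (s, w)).
have cV : ccont V.
  by have := ccont2_comp (Cint_param c2) cid (@csub x).
have cfx : ccont (fun w => f (w, x - w)) by apply: ccont2_comp.
pose h w := f (w, x - w) - (r / 2 * a w + V w).
have ch : ccont h.
  apply: ccontD => //; apply: ccontN; apply: ccontD => //.
  by apply: ccontM => //; exact: ccont_cst.
suff h0 : forall w, 0 <= w <= x -> h w = 0.
  by move=> w wx; apply/eqP; rewrite -subr_eq0; apply/eqP; exact: h0.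
apply: fourier_uniqueness_complex => // lam.
have cc : ccont (fun w : R => cis (lam * w)) by apply: ccont_cis; exact: cmul.
have cVc : ccont (fun w => V w * cis (lam * w)) by exact: ccontM.
have cac : ccont (fun w => a w * cis (lam * w)) by exact: ccontM.
have cfc : ccont (fun w => f (w, x - w) * cis (lam * w)) by exact: ccontM.
have tri : Cint 0 x (fun y => Cint 0 y (fun w => a y * (g (y - w, w) * cis (lam * w)))) =
    Cint 0 x (fun w => V w * cis (lam * w)).
  rewrite -(@Cint_triangle R x (fun z : R * R => a z.2 * (g (z.2 - z.1, z.1) * cis (lam * z.1)))).
    apply: eq_Cint => w /andP[w0 wx] /=.
    pose k s := a (w + s) * g (s, w).
    have ck : ccont k.
      apply: ccontM; last by apply: ccont2_comp => // s; exact: cvg_cst.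
      apply: (ccont_comp (h := fun s => w + s)) => // s.
      by apply: cvgD; [exact: cvg_cst|exact: cvg_id].
    have -> : V w = Cint w x (fun y => k (y - w)).
      by rewrite (@Cint_shift w x (- w) k)// subrr.
    rewrite [RHS]mulrC -CintZ.
      by apply: eq_Cint => y _; rewrite /k [w + _]addrC subrK; ring.
    apply: ccont_cintg; apply: (ccont_comp (h := fun y => y - w)) => // y.
    by apply: cvgB; [exact: cvg_id|exact: cvg_cst].
  apply: ccontM; first by apply: ccont_comp => //; exact: snd_cont.
  apply: ccontM.
    apply: ccont2_comp => //; last exact: fst_cont.
    by move=> z; apply: cvgB; [exact: snd_cont|exact: fst_cont].
  by apply: (ccont_comp (h := fun z : R * R => z.1) (k := fun w => cis (lam * w))) => //; exact: fst_cont.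
have E := H lam.
have e1 : Cint 0 x (fun y => a y * (r * cis (lam * y) +
      2 * Cint 0 y (fun w => g (y - w, w) * cis (lam * w)))) =
   r * Cint 0 x (fun w => a w * cis (lam * w)) + 2 * Cint 0 x (fun w => V w * cis (lam * w)).
  rewrite -tri -CintZ; last exact: ccont_cintg.
  have cT : ccont (fun y => Cint 0 y (fun w => a y * (g (y - w, w) * cis (lam * w)))).
    pose k (z : R * R) := a z.2 * (g (z.2 - z.1, z.1) * cis (lam * z.1)).
    apply: (@ccont2_comp _ (fun z : R * R => Cint 0 z.2 (fun s => k (s, z.1))) id id) => //.
    apply: Cint_param; apply: ccontM; first by apply: ccont_comp => //; exact: snd_cont.
    apply: ccontM.
      apply: ccont2_comp => //; last exact: fst_cont.
      by move=> z; apply: cvgB; [exact: snd_cont|exact: fst_cont].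
    by apply: (ccont_comp (h := fun z : R * R => z.1) (k := fun w => cis (lam * w))) => //; exact: fst_cont.
  rewrite -CintZ; last exact: ccont_cintg.
  rewrite -CintD; last 2 first.
  - by apply: cintgZ; exact: ccont_cintg.
  - by apply: cintgZ; exact: ccont_cintg.
  apply: eq_Cint => y _; rewrite CintZ; first by ring.
  apply: ccont_cintg; apply: ccontM => //.
  by apply: ccont2_comp.
rewrite e1 in E.
have -> : Cint 0 x (fun w => h w * cis (lam * w)) =
    Cint 0 x (fun w => f (w, x - w) * cis (lam * w)) -
    (r / 2 * Cint 0 x (fun w => a w * cis (lam * w)) + Cint 0 x (fun w => V w * cis (lam * w))).
  rewrite -CintZ; last exact: ccont_cintg.
  rewrite -CintD; [|by apply: cintgZ; exact: ccont_cintg|exact: ccont_cintg].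
  rewrite -CintB; [|exact: ccont_cintg|].
    by apply: eq_Cint => w _; rewrite /h; ring.
  apply: ccont_cintg; apply: ccontD => //; apply: ccontM => //; exact: ccont_cst.
have two0 : (2 : R[i]) != 0 by rewrite pnatr_eq0.
apply: (mulfI two0); rewrite mulr0 mulrBr E; by field.
Qed.

(* (f1, f2) is the transmutation kernel in the characteristic coordinates
   (w, x - w). *)
Variables (b : R) (a c : R -> R[i]) (f1 f2 : R * R -> R[i]) (u1 u2 : R -> R -> R[i]).
Hypotheses (b0 : 0 < b) (ca : ccont a) (cc : ccont c) (cf1 : ccont f1) (cf2 : ccont f2)
  (cu1 : forall lam, ccont (u1 lam)) (cu2 : forall lam, ccont (u2 lam))
  (u10 : forall lam, u1 lam 0 = 1) (u20 : forall lam, u2 lam 0 = 0)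
  (du1 : forall lam x, 0 < x < b ->
    cder x (u1 lam) (- ('i%C * lam%:C) * u1 lam x + a x * u2 lam x))
  (du2 : forall lam x, 0 < x < b ->
    cder x (u2 lam) ('i%C * lam%:C * u2 lam x + c x * u1 lam x))
  (tr1 : forall lam x, 0 < x <= b -> u1 lam x =
    cis (- (lam * x)) * (1 + 2 * Cint 0 x (fun w => f1 (w, x - w) * cis (2 * lam * w))))
  (tr2 : forall lam x, 0 < x <= b -> u2 lam x =
    cis (lam * x) * (2 * Cint 0 x (fun w => f2 (w, x - w) * cis (- (2 * lam * w))))).

Let cid : continuous (fun w : R => w). Proof. by move=> w; exact: cvg_id. Qed.

Let cmul (k : R) : continuous (fun w : R => k * w).
Proof. by move=> w; apply: cvgM; [exact: cvg_cst|exact: cvg_id]. Qed.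

Let csub (k : R) : continuous (fun w : R => k - w).
Proof. by move=> w; apply: cvgB; [exact: cvg_cst|exact: cvg_id]. Qed.

(** The reflection of w into y - w matches the phases of the transmutation formulas with those in
    [volterra_fourier]. *)
Let flip lam y (f : R * R -> R[i]) : ccont f ->
  cis (lam * y) * Cint 0 y (fun w => f (w, y - w) * cis (- (lam * w))) =
  Cint 0 y (fun w => f (y - w, w) * cis (lam * w)).
Proof.
move=> cf; have cg : ccont (fun w => f (y - w, w) * cis (lam * w)).
  by apply: ccontM; [exact: ccont2_comp|apply: ccont_cis; exact: cmul].
have := Cint_refl y 0 y cg; rewrite subrr subr0 => <-.
rewrite -CintZ; first apply: eq_Cint => w _.
  by rewrite subKr mulrBr cisD; ring.
apply: ccont_cintg; apply: ccontM; first exact: ccont2_comp.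
by apply: (@ccont_cis R R (fun w => - (lam * w))) => w; apply: cvgN; exact: cmul.
Qed.

(** The integrating factor cis (l y) removes the diagonal term of the equation for u1. Integrating
    the rest over [0, x] and inserting both transmutation formulas yields the hypothesis of
    [volterra_fourier]. The same argument with the opposite phase gives [zs2]. *)
Let zs1 x : 0 < x <= b -> forall w, 0 <= w <= x ->
  f1 (w, x - w) = Cint 0 (x - w) (fun s => a (w + s) * f2 (s, w)).
Proof.
move=> xb; have /andP[x0 xb'] := xb.
suff H : forall lam, 2 * Cint 0 x (fun w => f1 (w, x - w) * cis (lam * w)) =
    Cint 0 x (fun y => a y * (0 * cis (lam * y) +
      2 * Cint 0 y (fun w => f2 (y - w, w) * cis (lam * w)))).
  by move=> w wx; rewrite (volterra_fourier x0 ca cf1 cf2 H wx) mul0r mul0r add0r.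
(* In the coordinates (w, x - w) the kernels are integrated against the doubled frequency 2 l. *)
move=> lam; pose l := lam / 2; have El : lam = 2 * l by rewrite /l; field.
have cF : ccont (fun y => cis (l * y) * u1 l y).
  by apply: ccontM => //; apply: ccont_cis; exact: cmul.
have cG : ccont (fun y => cis (l * y) * (a y * u2 l y)).
  by apply: ccontM; [apply: ccont_cis; exact: cmul|exact: ccontM].
have := Cint_FTC (ltW x0) cF cG _ => /(_ _).
rewrite u10 mulr0 cis0 mulr1 (tr1 l xb) mulrA cisN mul1r => FTC.
rewrite El; transitivity (1 + 2 * Cint 0 x (fun w => f1 (w, x - w) * cis (2 * l * w)) - 1).
  by ring.
rewrite -FTC; last first.
  move=> t /andP[t0 tx]; have tb : 0 < t < b by rewrite t0 (lt_le_trans tx).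
  have h := cderM (cder_cis l t) (du1 l tb).
  rewrite (_ : _ * _ = 'i%C * l%:C * cis (l * t) * u1 l t +
    cis (l * t) * (- ('i%C * l%:C) * u1 l t + a t * u2 l t)) //; ring.
apply: eq_Cint => y /andP[y0 yx].
have [->|yn0] := eqVneq y 0.
  by rewrite u20 /Cint !Int_pt (_ : 0 +i* 0 = 0)// !mul0r !mulr0 addr0 !mulr0.
have yb : 0 < y <= b by rewrite lt_neqAle eq_sym yn0 y0 (le_trans yx).
rewrite (tr2 l yb) mul0r add0r -flip//.
rewrite (_ : cis (2 * l * y) = cis (l * y) * cis (l * y)); last first.
  by rewrite -cisD; congr cis; ring.
ring.
Qed.

Let zs2 x : 0 < x <= b -> forall w, 0 <= w <= x ->
  f2 (w, x - w) = c w / 2 + Cint 0 (x - w) (fun s => c (w + s) * f1 (s, w)).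
Proof.
move=> xb; have /andP[x0 xb'] := xb.
suff H : forall lam, 2 * Cint 0 x (fun w => f2 (w, x - w) * cis (lam * w)) =
    Cint 0 x (fun y => c y * (1 * cis (lam * y) +
      2 * Cint 0 y (fun w => f1 (y - w, w) * cis (lam * w)))).
  by move=> w wx; rewrite (volterra_fourier x0 cc cf2 cf1 H wx) mulrAC mul1r mulrC.
move=> lam; pose l := - (lam / 2); have El : lam = - (2 * l) by rewrite /l; field.
have cF : ccont (fun y => cis (- l * y) * u2 l y).
  by apply: ccontM => //; apply: ccont_cis; exact: cmul.
have cG : ccont (fun y => cis (- l * y) * (c y * u1 l y)).
  by apply: ccontM; [apply: ccont_cis; exact: cmul|exact: ccontM].
have := Cint_FTC (ltW x0) cF cG _ => /(_ _).
rewrite u20 mulr0 subr0 (tr2 l xb) mulNr mulrA [cis (- _) * _]mulrC cisN mul1r => FTC.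
transitivity (2 * Cint 0 x (fun w => f2 (w, x - w) * cis (- (2 * l * w)))).
  by congr (_ * _); apply: eq_Cint => w _; rewrite El mulNr.
rewrite -FTC; last first.
  move=> t /andP[t0 tx]; have tb : 0 < t < b by rewrite t0 (lt_le_trans tx).
  have h := cderM (cder_cis (- l) t) (du2 l tb).
  rewrite (_ : _ * _ = 'i%C * (- l)%:C * cis (- l * t) * u2 l t +
    cis (- l * t) * ('i%C * l%:C * u2 l t + c t * u1 l t)) //.
  by rewrite (_ : (- l)%:C = - l%:C); [ring|apply: complex_eq; rewrite /= ?oppr0].
apply: eq_Cint => y /andP[y0 yx].
have [->|yn0] := eqVneq y 0.
  by rewrite u10 /Cint !Int_pt (_ : 0 +i* 0 = 0)// !mulr0 !cis0 addr0 !mulr1 mul1r.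
have yb : 0 < y <= b by rewrite lt_neqAle eq_sym yn0 y0 (le_trans yx).
rewrite (tr1 l yb) mul1r -flip//.
rewrite (_ : cis (lam * y) = cis (- l * y) * cis (- l * y)); last first.
  by rewrite -cisD El; congr cis; ring.
rewrite (_ : - (l * y) = - l * y) ?mulNr//.
have -> : Cint 0 y (fun w => f1 (w, y - w) * cis (- (lam * w))) =
    Cint 0 y (fun w => f1 (w, y - w) * cis (2 * l * w)).
  by apply: eq_Cint => w _; rewrite El mulNr opprK.
ring.
Qed.

(** The transmutation formula is available for x > 0 only, so the corner u = v = 0 is reached by
    continuity. *)
Let zero_at0 (h : R -> R[i]) : ccont h -> (forall v, 0 < v <= b -> h v = 0) -> h 0 = 0.
Proof.
move=> [h1 h2] hv.
have key (k : R -> R) : continuous k -> (forall v, 0 < v <= b -> k v = 0) -> k 0 = 0.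
  move=> ck kv; apply/eqP; apply/negPn/negP => k0.
  have := ck 0 => /cvgrPdist_lt /(_ `|k 0|); rewrite normr_gt0 => /(_ k0).
  move=> /nbhs_ballP[e /= e0 he].
  pose v := Num.min (e / 2) b.
  have v0 : 0 < v by rewrite lt_min b0 divr_gt0.
  have ve : v < e by rewrite gt_min gtr_pMr// invf_lt1// ltr1n.
  have := he v; rewrite /ball /= sub0r normrN gtr0_norm// => /(_ ve).
  have vb : 0 < v <= b by apply/andP; split; rewrite // /v ge_min lexx orbT.
  by rewrite (kv v vb) subr0 ltxx.
apply: complex_eq; first by apply: (key _ h1) => v /hv ->.
by apply: (key _ h2) => v /hv ->.
Qed.

Lemma zs_goursat u v : 0 <= u -> 0 <= v -> u + v <= b ->
  f1 (u, v) = Cint 0 v (fun s => a (u + s) * f2 (s, u)) /\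
  f2 (u, v) = c u / 2 + Cint 0 v (fun s => c (u + s) * f1 (s, u)).
Proof.
move=> u0 v0 uvb; have [x0|uv0] := ltP 0 (u + v).
  have xb : 0 < u + v <= b by rewrite x0.
  have ux : 0 <= u <= u + v by rewrite u0 lerDl.
  by have := zs1 xb ux; have := zs2 xb ux; rewrite addrAC subrr add0r.
have -> : u = 0 by apply/eqP; rewrite eq_le u0 andbT; lra.
have -> : v = 0 by apply/eqP; rewrite eq_le v0 andbT; lra.
have cpar (h : R -> R[i]) (f : R * R -> R[i]) : ccont h -> ccont f ->
    ccont (fun y => Cint 0 y (fun s => h (0 + s) * f (s, 0))).
  move=> ch cf; have c2 : ccont (fun z : R * R => h (z.2 + z.1) * f (z.1, z.2)).
    apply: ccontM; last by apply: ccont2_comp => //; [exact: fst_cont|exact: snd_cont].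
    apply: (ccont_comp (h := fun z : R * R => z.2 + z.1)) => // z.
    by apply: cvgD; [exact: snd_cont|exact: fst_cont].
  by apply: (@ccont2_comp _ _ (fun=> 0) (fun y => y) (Cint_param c2)) => // y; exact: cvg_cst.
have c0 (f : R * R -> R[i]) : ccont f -> ccont (fun y => f (0, y)).
  by move=> cf; apply: ccont2_comp => // y; exact: cvg_cst.
split.
  have := @zero_at0 (fun y => f1 (0, y) - Cint 0 y (fun s => a (0 + s) * f2 (s, 0))).
  move=> /(_ _ _)/eqP; rewrite subr_eq0 => h; apply/eqP; apply: h.
    by apply: ccontD; [exact: c0|apply: ccontN; exact: cpar].
  move=> y yb; have := zs1 yb (w := 0); rewrite subr0 => ->; rewrite ?subrr// lexx.
  by case/andP: yb => /ltW.
have := @zero_at0 (fun y => f2 (0, y) - (c 0 / 2 + Cint 0 y (fun s => c (0 + s) * f1 (s, 0)))).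
move=> /(_ _ _)/eqP; rewrite subr_eq0 => h; apply/eqP; apply: h.
  apply: ccontD; [exact: c0|apply: ccontN; apply: ccontD; [exact: ccont_cst|exact: cpar]].
move=> y yb; have := zs2 yb (w := 0); rewrite subr0 => ->; rewrite ?subrr// lexx.
by case/andP: yb => /ltW.
Qed.

End ZakharovShabat.

(** * Legendre polynomials *)

Section PolynomialIntegral.
Variable R : realType.
Implicit Types (p q : {poly R}) (n m k : nat).

Definition pint p : R := Int (-1) 1 (fun t => p.[t]).

Lemma intg_horner a b p : intg a b (fun t => p.[t]).
Proof. by apply: intg_cont; exact: continuous_horner. Qed.

Lemma pintD p q : pint (p + q) = pint p + pint q.
Proof.
rewrite /pint -IntD; [|exact: intg_horner..].
by apply: eq_Int => t _; rewrite hornerD.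
Qed.

Lemma pintZ (k : R) p : pint (k *: p) = k * pint p.
Proof.
by rewrite /pint -IntZ; [apply: eq_Int => t _; rewrite hornerZ|exact: intg_horner].
Qed.

Lemma pintN p : pint (- p) = - pint p.
Proof. by rewrite -scaleN1r pintZ mulN1r. Qed.

Lemma pint0 : pint 0 = 0.
Proof. by rewrite -(scale0r 0) pintZ mul0r. Qed.

Lemma pint_sum (I : Type) (r : seq I) (P : pred I) (F : I -> {poly R}) :
  pint (\sum_(i <- r | P i) F i) = \sum_(i <- r | P i) pint (F i).
Proof. by apply: (big_morph pint pintD pint0). Qed.

Lemma is_derive_horner p (t : R) : is_derive t 1 (fun s => p.[s]) p^`().[t].
Proof.
apply: DeriveDef; first exact: derivable_horner.
by rewrite -derive1E derivE.
Qed.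

Lemma Int_deriv a b p : a <= b -> Int a b (fun t => p^`().[t]) = p.[b] - p.[a].
Proof.
move=> ab; apply: (Int_FTC (F := fun t => p.[t])) => //.
- by apply: continuous_subspaceT; exact: continuous_horner.
- by apply: continuous_subspaceT; exact: continuous_horner.
- by move=> t _; exact: is_derive_horner.
Qed.

Lemma pint_deriv p : pint p^`() = p.[1] - p.[-1].
Proof. by apply: Int_deriv; lra. Qed.

Lemma pint_parts p q : (p * q).[1] = 0 -> (p * q).[-1] = 0 ->
  pint (p^`() * q) = - pint (p * q^`()).
Proof.
move=> h1 h2; have := pint_deriv (p * q).
by rewrite derivM pintD h1 h2 subr0 => /eqP; rewrite addr_eq0 => /eqP.
Qed.

(** A nonzero polynomial cannot vanish at as many of the points 1/2, 1/3, 1/4, ... as its size. Near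
    one where it does not vanish its square contributes a positive integral. *)
Lemma pint_sqr_eq0 p : pint (p ^+ 2) = 0 -> p = 0.
Proof.
move=> h; apply/eqP; apply/negPn/negP => p0.
have [t0 [t01 pt0]] : exists t, -1 < t < 1 /\ p.[t] != 0.
  apply: contrapT => hn; move/negP: p0; apply; apply/eqP.
  apply: (@roots_geq_poly_eq0 _ p [seq (i.+2%:R)^-1 | i <- iota 0 (size p)]).
  - apply/allP => _ /mapP[i _ ->]; rewrite rootE; apply/negPn/negP => ht.
    apply: hn; exists (i.+2%:R)^-1; split => //.
    by rewrite (lt_trans (ltrN10 R)) ?invr_gt0//= invf_lt1// ltr1n.
  - rewrite map_inj_uniq ?iota_uniq// => i j /invr_inj /eqP.
    by rewrite eqr_nat => /eqP[].
  - by rewrite size_map size_iota.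
pose f t := (p ^+ 2).[t]; have cf : continuous f by exact: continuous_horner.
have f0 : 0 < f t0 / 2.
  by rewrite divr_gt0// /f horner_exp exprn_even_gt0.
have := cf t0 => /cvgrPdist_lt /(_ _ f0) /nbhs_ballP[e /= e0 he].
have fge t : 0 <= f t by rewrite /f horner_exp sqr_ge0.
have /andP[t1 t2] := t01.
pose r := Num.min (t0 + e / 2) 1.
have tr : t0 < r by rewrite lt_min t2 ltrDl divr_gt0.
have r1 : r <= 1 by rewrite ge_min lexx orbT.
have re : r <= t0 + e / 2 by rewrite ge_min lexx.
have if_ a b : intg a b f by exact: intg_horner.
have l1 : f t0 / 2 * (r - t0) <= Int t0 r f.
  rewrite -Int_cst ?(ltW tr)//; apply: le_Int => //; first exact: intg_cst.
  move=> t /andP[h1 h2].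
  have : `|f t0 - f t| < f t0 / 2.
    by apply: he; rewrite /ball /= ltr_norml; apply/andP; split; lra.
  by rewrite ltr_norml => /andP[h4 h5]; lra.
have l2 : Int t0 r f <= Int (-1) 1 f by apply: le_Int_sub => //; exact: ltW.
have : 0 < f t0 / 2 * (r - t0) by rewrite mulr_gt0// subr_gt0.
by move: l1 l2 h; rewrite /pint -/f; lra.
Qed.

Lemma pint_refl p : pint (p \Po - 'X) = pint p.
Proof.
rewrite /pint -[RHS](Int_refl 0 (intg_horner (-1) 1 p)) !sub0r opprK.
by apply: eq_Int => t _; rewrite horner_comp hornerN hornerX sub0r.
Qed.

End PolynomialIntegral.

(** * Moments, norms and differential equation of the Legendre polynomials *)

Section Legendre.
Variable R : realType.
Implicit Types (p q : {poly R}) (n m k : nat).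

Let w : {poly R} := 'X^2 - 1.
Local Notation P := (legendre R).

Let cP n : R := ((2 ^ n * n`!)%:R)^-1.

Let legendreE n : P n = cP n *: (w ^+ n)^`(n). Proof. by []. Qed.

Let w1 : w.[1] = 0. Proof. by rewrite !hornerE /=; ring. Qed.
Let wN1 : w.[-1] = 0. Proof. by rewrite !hornerE /=; ring. Qed.

Lemma derivn_factor p n k : (k <= n)%N -> exists q, (p ^+ n)^`(k) = p ^+ (n - k) * q.
Proof.
elim: k => [|k ih] kn; first by exists 1; rewrite subn0 mulr1.
have [q e] := ih (ltnW kn); rewrite derivnS e derivM.
have -> : (n - k = (n - k.+1).+1)%N by rewrite subnSK.
exists (p^`() *+ (n - k.+1).+1 * q + p * q^`()).
rewrite deriv_exp /= exprS; set A := p ^+ _; rewrite mulrDr; congr (_ + _); last by ring.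
by rewrite -!mulrnAl; ring.
Qed.

(** Derivatives of w^n of order below n retain a factor w, which vanishes at 1 and -1; repeated
    integration by parts thus leaves no boundary terms. *)
Lemma pint_rodrigues n q k : (k <= n)%N ->
  pint ((w ^+ n)^`(n) * q) = (-1) ^+ k * pint ((w ^+ n)^`(n - k) * q^`(k)).
Proof.
elim: k => [|k ih] kn; first by rewrite subn0 expr0 mul1r.
rewrite ih ?(ltnW kn)//; have -> : (n - k = (n - k.+1).+1)%N by rewrite subnSK.
have [q' e] := @derivn_factor w n (n - k.+1) (leq_subr _ _).
have e' : (n - (n - k.+1) = k.+1)%N by rewrite subKn.
rewrite [in LHS]derivnS pint_parts.
- by rewrite -derivnS exprS; ring.
- by rewrite e e' !hornerM horner_exp w1 expr0n !mul0r.
- by rewrite e e' !hornerM horner_exp wN1 expr0n !mul0r.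
Qed.

Lemma legendre_pint n q : pint (P n * q) = (-1) ^+ n * cP n * pint (w ^+ n * q^`(n)).
Proof.
by rewrite legendreE -scalerAl pintZ (pint_rodrigues q (leqnn n)) subnn derivn0; ring.
Qed.

Lemma legendre_orth n q : (size q <= n)%N -> pint (P n * q) = 0.
Proof. by move=> h; rewrite legendre_pint derivn_poly0// mulr0 pint0 mulr0. Qed.

Let monic_w : w \is monic. Proof. by rewrite /w -(rmorph1 polyC) monicXnsubC. Qed.
Let size_w : size w = 3. Proof. by rewrite /w -(rmorph1 polyC) size_XnsubC. Qed.

Let size_wn n : size (w ^+ n) = (2 * n).+1.
Proof.
elim: n => [|n ih]; first by rewrite expr0 size_poly1.
by rewrite exprS size_monicM ?monic_exp// -?size_poly_eq0 ?ih ?size_w//; lia.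
Qed.

Lemma size_legendre n : (size (P n) <= n.+1)%N.
Proof.
apply/leq_sizeP => j jn; rewrite legendreE coefZ coef_derivn.
rewrite [(w ^+ n)`_(n + j)]nth_default ?mul0rn ?mulr0// size_wn.
by rewrite mul2n -addnn -addSn addnC leq_add2l.
Qed.

Lemma legendre_lead n : (P n)`_n = cP n * (2 * n)`!%:R / n`!%:R.
Proof.
rewrite legendreE coefZ coef_derivn addnn -mul2n.
have -> : (w ^+ n)`_(2 * n) = 1.
  by have /monicP := monic_exp n monic_w; rewrite /lead_coef size_wn.
have := ffact_fact (leq_addr n n); rewrite addnK addnn -mul2n => <-.
by rewrite natrM -mulrA -mulrA mulfV ?mulr1// pnatr_eq0 -lt0n fact_gt0.
Qed.

Let fact_neq0 n : n`!%:R != 0 :> R.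
Proof. by rewrite pnatr_eq0 -lt0n fact_gt0. Qed.

Let odf_neq0 n : (odd_dfact n)%:R != 0 :> R.
Proof.
rewrite pnatr_eq0 -lt0n /odd_dfact; apply: prodn_gt0 => i.
by rewrite addn1.
Qed.

Let odfS n : odd_dfact n.+1 = (odd_dfact n * (2 * n.+1 + 1))%N.
Proof. by rewrite /odd_dfact big_ord_recr. Qed.

Lemma fact_odd_dfact n : ((2 * n + 1)`! = 2 ^ n * n`! * odd_dfact n)%N.
Proof.
elim: n => [|n ih]; first by rewrite /odd_dfact big_ord_recr big_ord0.
rewrite odfS; have -> : (2 * n.+1 + 1 = (2 * n + 1).+2)%N by ring.
rewrite !factS ih expnS; ring.
Qed.

(** The derivative of (1 - X^2)^(n + 1) X^(2k + 1) has integral 0, which expresses the case (n + 1,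
    k) by the case (n, k + 1). *)
Lemma pint_beta n k : pint ((1 - 'X^2 : {poly R}) ^+ n * 'X^(2 * k)) =
  2 * (2 ^ n * n`!)%:R * (2 * k)`!%:R / (2 ^ k * k`! * odd_dfact (n + k))%:R.
Proof.
elim: n k => [|n ih] k.
  rewrite expr0 mul1r; have := pint_deriv ('X^((2 * k).+1) : {poly R}).
  rewrite derivXn /= -scaler_nat pintZ !hornerXn expr1n.
  have -> : (-1 : R) ^+ (2 * k).+1 = -1 by rewrite -signr_odd /= oddM.
  rewrite opprK => h.
  have n0 : ((2 * k).+1)%:R != 0 :> R by rewrite pnatr_eq0.
  apply: (mulfI n0); rewrite h add0n -fact_odd_dfact addn1 factS !natrM mul1r mulr1.
  move: ((2 * k).+1)%:R ((2 * k)`!)%:R n0 (fact_neq0 (2 * k)%N) => c d c0 d0.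
  by field; rewrite c0 d0.
have k1 : ((2 * k + 1)%:R : R) != 0 by rewrite pnatr_eq0 addn1.
apply: (mulfI k1).
have := pint_deriv ((1 - 'X^2 : {poly R}) ^+ n.+1 * 'X^((2 * k).+1)).
rewrite !hornerM !horner_exp !hornerD !hornerN !hornerC !hornerXn.
rewrite sqrrN !expr1n subrr expr0n !mul0r subrr derivM pintD.
rewrite deriv_exp derivXn /= derivD derivN derivC derivXn /= add0r.
have -> : - ('X *+ 2) * (1 - 'X^2) ^+ n *+ n.+1 * 'X^((2 * k).+1) =
    - (2 * n.+1)%:R *: ((1 - 'X^2) ^+ n * 'X^(2 * k.+1)) :> {poly R}.
  have -> : (2 * k.+1 = (2 * k).+2)%N by ring.
  rewrite scaleNr scaler_nat !exprS -[_ *+ n.+1]mulr_natr -[_ *+ 2]mulr_natr -[_ *+ (_ * _)]mulr_natr natrM; ring.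
have -> : (1 - 'X^2) ^+ n.+1 * ('X^(2 * k) *+ (2 * k).+1) =
    (2 * k).+1%:R *: ((1 - 'X^2) ^+ n.+1 * 'X^(2 * k)) :> {poly R}.
  by rewrite scaler_nat mulrnAr.
rewrite pintZ [X in _ + X = _]pintZ ih addn1.
move=> /eqP; rewrite addrC addr_eq0 => /eqP ->.
rewrite addSnnS mulNr opprK.
have -> : ((2 * k.+1)`! = (2 * k).+2 * (2 * k).+1 * (2 * k)`!)%N.
  by have -> : (2 * k.+1 = (2 * k).+2)%N by [ring]; rewrite !factS mulnA.
rewrite !factS !expnS !natrM.
have k2 : k.+1%:R != 0 :> R by rewrite pnatr_eq0.
have p2 : (2 ^ k)%:R != 0 :> R by rewrite pnatr_eq0 expn_eq0.
have -> : ((2 * k).+2)%:R = 2 * k.+1%:R :> R by rewrite -natrM; congr (_%:R); ring.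
move: (k.+1)%:R (2 ^ k)%:R (k`!)%:R (odd_dfact _)%:R k2 p2 (fact_neq0 k) (odf_neq0 (n + k.+1)%N).
 move=> c d e f c0 d0 e0 f0; move: (_`!)%:R => g. by field; rewrite c0 d0 e0 f0.
Qed.

(** Up to the factor 2 (n + 2k)! and a sign these are the coefficients of [sph_bessel], so that
    integrating the exponential series term by term against P_n produces the Bessel series. *)
Lemma legendre_moment n k : pint (P n * 'X^(n + 2 * k)) =
  2 * (n + 2 * k)`!%:R / (2 ^ k * k`! * odd_dfact (n + k))%:R.
Proof.
rewrite legendre_pint derivnXn addKn -scaler_nat -scalerAr pintZ.
have -> : w ^+ n * 'X^(2 * k) = (-1 : R) ^+ n *: ((1 - 'X^2) ^+ n * 'X^(2 * k)).
  by rewrite scalerAl; congr (_ * _); rewrite -exprZn scaleN1r opprB.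
rewrite pintZ pint_beta.
have := ffact_fact (leq_addr (2 * k) n); rewrite addKn => e.
have -> : (n + 2 * k)`!%:R = ((n + 2 * k) ^_ n)%:R * (2 * k)`!%:R :> R.
  by rewrite -natrM e.
have sq : (-1) ^+ n * (-1) ^+ n = 1 :> R by rewrite -expr2 sqrr_sign.
have c0 : (2 ^ n * n`!)%:R != 0 :> R by rewrite pnatr_eq0 muln_eq0 expn_eq0 -lt0n fact_gt0.
have d0 : (2 ^ k * k`! * odd_dfact (n + k))%:R != 0 :> R.
  by rewrite !natrM !mulf_neq0// pnatr_eq0 expn_eq0.
rewrite /cP; move: ((-1) ^+ n : R) sq c0 d0 => s sq.
move: (2 ^ n * n`!)%:R (2 ^ k * k`! * odd_dfact (n + k))%:R => c d.
move: ((n + 2 * k) ^_ n)%:R ((2 * k)`!)%:R => e1 e2 c0 d0.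
rewrite [LHS](_ : _ = s * s * (c^-1 * (e1 * (2 * c * e2 / d)))); last by ring.
by rewrite sq mul1r; field; rewrite c0 d0.
Qed.

Lemma legendre_moment_lt n m : (m < n)%N -> pint (P n * 'X^m) = 0.
Proof. by move=> mn; apply: legendre_orth; rewrite size_polyXn. Qed.

Lemma legendre_moment_odd n k : pint (P n * 'X^(n + (2 * k).+1)) = 0.
Proof.
rewrite legendre_pint derivnXn addKn -scaler_nat -scalerAr pintZ.
set q := w ^+ n * _.
have qN : q \Po - 'X = - q.
  rewrite /q comp_polyM.
  have hX j : 'X^j \Po (- 'X) = (- 'X) ^+ j :> {poly R} by rewrite rmorphXn /= comp_polyX.
  have -> : w ^+ n \Po (- 'X) = w ^+ n.
    by rewrite rmorphXn /= comp_polyB hX comp_polyC sqrrN.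
  by rewrite hX exprS mulNr exprM sqrrN -exprM -exprS mulrN.
have := pint_refl q; rewrite qN pintN => h.
have -> : pint q = 0 by lra.
by rewrite !mulr0.
Qed.

Lemma legendre_top n q : (size q <= n.+1)%N -> pint (P n * q) = q`_n * pint (P n * 'X^n).
Proof.
move=> sq; rewrite -pintZ -(subrK (q`_n *: 'X^n) q) mulrDr pintD.
rewrite legendre_orth ?add0r; first by rewrite subrK scalerAr.
apply/leq_sizeP => j; rewrite leq_eqVlt => /predU1P[<-|nj].
  by rewrite coefB coefZ coefXn eqxx mulr1 subrr.
rewrite coefB coefZ coefXn gtn_eqF// mulr0 subr0 nth_default//.
exact: leq_trans nj.
Qed.

Lemma legendre_norm n : pint (P n * P n) = 2 / (2 * n + 1)%:R.
Proof.
rewrite legendre_top ?size_legendre// legendre_lead.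
have := legendre_moment n 0; rewrite muln0 addn0 => ->.
rewrite expn0 fact0 mul1n mul1n /cP.
have -> : (odd_dfact n)%:R = (2 * n + 1)%:R * (2 * n)`!%:R / (2 ^ n * n`!)%:R :> R.
  have := fact_odd_dfact n; rewrite addn1 factS => e.
  rewrite -natrM e natrM; field.
  by rewrite fact_neq0 pnatr_eq0 expn_eq0.
have c0 : (2 ^ n * n`!)%:R != 0 :> R by rewrite pnatr_eq0 muln_eq0 expn_eq0 -lt0n fact_gt0.
have c1 : (2 * n + 1)%:R != 0 :> R by rewrite pnatr_eq0 addn1.
move: c0 c1 (fact_neq0 n) (fact_neq0 (2 * n)%N).
move: (2 ^ n * n`!)%:R (2 * n + 1)%:R n`!%:R ((2 * n)`!)%:R => c d e1 e2 c0 d0 h1 h2.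
by field; rewrite c0 d0 h1 h2.
Qed.

(** The operator L p = ((1 - X^2) p')' is symmetric for the integral and multiplies the leading
    coefficient in degree n by -n (n + 1). Hence r = L P_n + n (n + 1) P_n has degree below n. The
    integral of r^2 reduces by symmetry to integrals of P_n against L r and r, both 0 by
    orthogonality. *)
Lemma legendre_ode n :
  ((1 - 'X^2) * (P n)^`())^`() = - ((n * n.+1)%:R *: P n).
Proof.
set u : {poly R} := 1 - 'X^2.
have u1 : u.[1] = 0 by rewrite !hornerE /=; ring.
have uN1 : u.[-1] = 0 by rewrite !hornerE /=; ring.
pose L (p : {poly R}) : {poly R} := (u * p^`())^`().
have szL p k : (size p <= k)%N -> (size (L p) <= k)%N.
  case: k => [|k] sp.
    by move: sp; rewrite leqn0 size_poly_eq0 => /eqP ->; rewrite /L deriv0 mulr0 deriv0 size_poly0.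
  apply/leq_sizeP => j kj; rewrite /L coef_deriv /u mulrBl mul1r coefB coefXnM.
  have co i : (k.+1 <= i)%N -> p`_i = 0 by move=> h; rewrite nth_default// (leq_trans sp).
  rewrite !coef_deriv; case: ifP => _; rewrite ?subr0 ?co ?mul0rn ?subr0 ?mul0rn//;
    lia.
have topL p k : (size p <= k.+1)%N -> (L p)`_k = - (k * k.+1)%:R * p`_k.
  move=> sp; rewrite /L coef_deriv /u mulrBl mul1r coefB coefXnM !coef_deriv.
  have -> : p`_k.+2 = 0 by rewrite nth_default// (leq_trans sp).
  rewrite mul0rn sub0r; case: k sp => [|k] sp; first by rewrite ?(mul0r, mul0n, oppr0, mul0rn, subrr).
  have -> : (k.+2 - 2 = k)%N by lia.
  by rewrite /= mulNrn -mulrnA mulNr mulr_natl.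
have sym p q : pint (L p * q) = pint (p * L q).
  rewrite /L pint_parts; [|by rewrite !hornerM u1 !mul0r|by rewrite !hornerM uN1 !mul0r].
  rewrite -[X in - X](opprK _) opprK; apply/eqP; rewrite eqr_oppLR; apply/eqP.
  have := @pint_parts R (u * q^`()) p.
  rewrite !hornerM u1 uN1 !mul0r => /(_ erefl erefl).
  by rewrite [p * _]mulrC => ->; rewrite opprK; congr pint; ring.
pose r := L (P n) + (n * n.+1)%:R *: P n.
suff r0 : r = 0.
  by apply/eqP; rewrite -subr_eq0 opprK; apply/eqP.
have sr : (size r <= n)%N.
  apply/leq_sizeP => j; rewrite leq_eqVlt => /predU1P[<-|nj].
    by rewrite /r coefD coefZ topL ?size_legendre// mulNr addNr.
  rewrite /r coefD coefZ !nth_default ?mulr0 ?addr0//.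
    exact: leq_trans (size_legendre n) nj.
  exact: leq_trans (szL _ _ (size_legendre n)) nj.
apply: pint_sqr_eq0; rewrite expr2 {1}/r mulrDl pintD sym legendre_orth ?szL//.
by rewrite -scalerAl pintZ legendre_orth// mulr0 addr0.
Qed.

End Legendre.

(** * Polynomial approximation of continuous functions by Bernstein's method *)

Section Weierstrass.
Variable R : realType.
Implicit Types (f : R -> R) (t : R) (g h : nat -> R).

Let tau : {poly R} := 2^-1 *: (1 + 'X).

(* The Bernstein polynomial of g, i.e. the mean of g(k) for k binomial of
   parameters n and tau = (1 + X) / 2. *)
Fixpoint bern n g : {poly R} :=
  if n is n'.+1 then (1 - tau) * bern n' g + tau * bern n' (g \o S) else (g 0%N)%:P.

Let tauE t : tau.[t] = (1 + t) / 2.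
Proof. by rewrite /tau hornerZ hornerD hornerC hornerX mulrC. Qed.

Let bernS n g t : (bern n.+1 g).[t] =
  (1 - (1 + t) / 2) * (bern n g).[t] + (1 + t) / 2 * (bern n (g \o S)).[t].
Proof. by rewrite /= hornerD !hornerM hornerD hornerN hornerC tauE. Qed.

Lemma le_bern n g h t : -1 <= t <= 1 -> (forall k, (k <= n)%N -> g k <= h k) ->
  (bern n g).[t] <= (bern n h).[t].
Proof.
move=> /andP[t1 t2]; elim: n g h => [|n ih] g h gh; first by rewrite /= !hornerC gh.
rewrite !bernS lerD// ler_wpM2l//; [lra| |lra|].
- by apply: ih => k kn; apply: gh; exact: leqW.
- by apply: ih => k kn; exact: gh.
Qed.

(** The binomial law has mean n tau and variance n tau (1 - tau). The shift s absorbs the successor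
    that the recursion puts on k. *)
Lemma bern_quadratic n (c a s : R) t : (bern n (fun k => c + a * (k%:R + s) ^+ 2)).[t] =
  c + a * ((n%:R * ((1 + t) / 2) + s) ^+ 2 + n%:R * ((1 + t) / 2) * (1 - (1 + t) / 2)).
Proof.
elim: n s => [|n ih] s; first by rewrite /= hornerC !mul0r add0r addr0.
rewrite bernS ih.
have -> : (fun k => c + a * (k%:R + s) ^+ 2) \o S = (fun k => c + a * (k%:R + (s + 1)) ^+ 2).
  by apply/funext => k /=; rewrite -natr1; congr (_ + _ * _ ^+ 2); ring.
by rewrite ih -natr1; field.
Qed.

(** Boundedness and uniform continuity give |f s - f t| <= e / 2 + (2 M / d^2) (s - t)^2 for all s
    and t in [-1, 1]. As [bern] is monotone in its nodes' values, the error is at most e / 2 plus a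
    variance term of order 1 / N. *)
Lemma Weierstrass f (e : R) : continuous f -> 0 < e ->
  exists p : {poly R}, forall t, -1 <= t <= 1 -> `|f t - p.[t]| <= e.
Proof.
move=> cf e0; have e20 : 0 < e / 2 by rewrite divr_gt0.
(* With this function of two variables, [cont2_tube] on [0, 2] yields uniform continuity of f on
   [-1, 1]. *)
have cF : continuous (fun z : R * R => f (z.1 - 1 + z.2)).
  move=> z; apply: (@continuous_comp _ _ _ (fun z : R * R => z.1 - 1 + z.2) f); last exact: cf.
  by apply: cvgD; [apply: cvgB; [exact: fst_cont|exact: cvg_cst]|exact: snd_cont].
have /nbhs_ballP[d /= d0 hd] := @cont2_tube _ _ 2 0 _ cF e20.
have [M M0 fM] := cont_bounded (-1) 1 cf.
have close s t : -1 <= s <= 1 -> -1 <= t <= 1 ->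
    `|f s - f t| <= e / 2 + 2 * M / d ^+ 2 * (s - t) ^+ 2.
  move=> s1 t1; have d2 : 0 < d ^+ 2 by rewrite exprn_gt0.
  have [st|st] := ltP `|s - t| d.
    have := hd (s - t); rewrite /ball /= sub0r normrN => /(_ st (t + 1)).
    rewrite !addrK subrKC !addr0 => h.
    apply: (@le_trans _ _ (e / 2)); first by apply: ltW; apply: h; lra.
    by rewrite lerDl mulr_ge0 ?sqr_ge0// divr_ge0 ?(ltW d2)// mulr_ge0.
  have h1 : `|f s - f t| <= 2 * M.
    apply: le_trans (ler_normB _ _) _.
    by rewrite mulr_natl mulr2n lerD ?fM.
  have h2 : 1 <= (s - t) ^+ 2 / d ^+ 2.
    by rewrite ler_pdivlMr// mul1r -[(s - t) ^+ 2](real_normK (num_real (s - t))) ler_pXn2r// nnegrE ltW.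
  apply: (le_trans h1); apply: (@le_trans _ _ (2 * M * ((s - t) ^+ 2 / d ^+ 2))).
    by rewrite ler_peMr ?mulr_ge0.
  by rewrite mulrA mulrAC lerDr ltW.
pose N := (Num.bound (4 * M / d ^+ 2 / e)).+1.
have N0 : 0 < N%:R :> R by rewrite ltr0n.
have hN : 2 * M / d ^+ 2 / N%:R <= e / 2.
  have : 4 * M / d ^+ 2 / e <= N%:R.
    apply: (@le_trans _ _ ((Num.bound (4 * M / d ^+ 2 / e))%:R)); last by rewrite ler_nat.
    have h0 : 0 <= 4 * M / d ^+ 2 / e by rewrite !divr_ge0 ?mulr_ge0 ?exprn_ge0// ltW.
    exact: ltW (@archi_boundP _ (4 * M / d ^+ 2 / e) h0).
  rewrite ler_pdivrMr// => h.
  rewrite ler_pdivrMr//.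
  suff -> : 2 * M / d ^+ 2 = (4 * M / d ^+ 2) / 2 by lra.
  by field; rewrite lt0r_neq0.
pose node k : R := 2 * (k%:R / N%:R) - 1.
have node1 k : (k <= N)%N -> -1 <= node k <= 1.
  move=> kN; have h0 : 0 <= (k%:R / N%:R : R) by rewrite divr_ge0.
  have h1 : k%:R / N%:R <= 1 :> R by rewrite ler_pdivrMr// mul1r ler_nat.
  by rewrite /node; apply/andP; split; lra.
exists (bern N (f \o node)) => t t1.
have [t2 t3] := andP t1.
set ta := (1 + t) / 2.
(* node k - t equals (2 / N) (k - N ta), so C is 2 M / d^2 times 4 / N^2. *)
pose C := 8 * M / d ^+ 2 / N%:R ^+ 2.
have nodeC k : 2 * M / d ^+ 2 * (node k - t) ^+ 2 = C * (k%:R + - (N%:R * ta)) ^+ 2.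
  by rewrite /node /C /ta; field; rewrite !lt0r_neq0.
have var : C * ((N%:R * ta + - (N%:R * ta)) ^+ 2 + N%:R * ta * (1 - ta)) <= e / 2.
  rewrite subrr expr0n add0r; apply: le_trans hN.
  have -> : C * (N%:R * ta * (1 - ta)) = 2 * M / d ^+ 2 / N%:R * (4 * ta * (1 - ta)).
    by rewrite /C; field; rewrite !lt0r_neq0.
  rewrite ler_piMr//; first by rewrite !divr_ge0 ?mulr_ge0 ?exprn_ge0// ltW.
  by have := sqr_ge0 (1 - 2 * ta); lra.
have cl k : (k <= N)%N -> `|f (node k) - f t| <= e / 2 + C * (k%:R + - (N%:R * ta)) ^+ 2.
  by move=> kN; rewrite -nodeC; apply: close => //; exact: node1.
have up : (bern N (f \o node)).[t] <= f t + e / 2 + C * ((N%:R * ta + - (N%:R * ta)) ^+ 2 + N%:R * ta * (1 - ta)).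
  rewrite -bern_quadratic; apply: le_bern => // k kN /=.
  by have := cl k kN; rewrite ler_norml => /andP[]; lra.
have dn : f t - e / 2 + (- C) * ((N%:R * ta + - (N%:R * ta)) ^+ 2 + N%:R * ta * (1 - ta)) <= (bern N (f \o node)).[t].
  rewrite -bern_quadratic; apply: le_bern => // k kN /=.
  by have := cl k kN; rewrite ler_norml mulNr => /andP[]; lra.
by rewrite ler_norml; move: var up dn; rewrite mulNr; set X := C * _; lra.
Qed.

End Weierstrass.

(** * Best approximation and error of Legendre partial sums *)

Section LegendreApproximation.
Variable R : realType.
Implicit Types (f : R -> R) (p q : {poly R}) (n m N : nat).

Local Notation P := (legendre R).
Local Notation I f := (Int (-1) 1 f).
Local Notation inL f := (inL2 (-1) 1 f).

Let m11 : -1 <= 1 :> R. Proof. by lra. Qed.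

Lemma inL2_horner a b p : inL2 a b (fun t => p.[t]).
Proof. by apply: inL2_cont; exact: continuous_horner. Qed.

Lemma intgM_horner f p : inL f -> intg (-1) 1 (fun t => f t * p.[t]).
Proof. by move=> hf; apply: inL2M => //; exact: inL2_horner. Qed.

Lemma dens_horner a b p : dens a b (fun t => p.[t]) (fun t => p^`().[t]).
Proof.
split; first exact: intg_horner.
by move=> t /andP[at_ tb]; rewrite Int_deriv// addrC subrK.
Qed.

Definition lcoef f n : R := I (fun t => f t * (P n).[t]) / (2 / (2 * n + 1)%:R).

Definition lproj N f : {poly R} := \sum_(n < N.+1) lcoef f n *: P n.

Let dist2 f q : R := I (fun t => (f t - q.[t]) ^+ 2).

Let h0 n : 2 / (2 * n + 1)%:R != 0 :> R.
Proof. by rewrite mulf_neq0// invr_eq0 pnatr_eq0 addn1. Qed.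

Let hp n : 0 < 2 / (2 * n + 1)%:R :> R.
Proof. by rewrite divr_gt0// ltr0n addn1. Qed.

Lemma size_lproj N f : (size (lproj N f) <= N.+1)%N.
Proof.
apply: (leq_trans (size_sum _ _ _)); apply/bigmax_leqP => i _.
exact: leq_trans (size_scale_leq _ _) (leq_trans (size_legendre R _) (ltn_ord i)).
Qed.

Lemma legendre_orthogonal n m : n != m -> pint (P n * P m) = 0.
Proof.
rewrite neq_ltn => /orP[nm|mn].
  by rewrite mulrC legendre_orth// (leq_trans (size_legendre R n)).
by rewrite legendre_orth// (leq_trans (size_legendre R m)).
Qed.

Lemma pint_lsum (r : seq nat) (c : nat -> R) m : uniq r ->
  pint (P m * (\sum_(n <- r) c n *: P n)) =
  if m \in r then c m * (2 / (2 * m + 1)%:R) else 0.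
Proof.
move=> ur; rewrite mulr_sumr pint_sum; case: ifPn => mr.
  rewrite (bigD1_seq m)//= big1 ?addr0.
    by rewrite -scalerAr pintZ legendre_norm.
  by move=> i im; rewrite -scalerAr pintZ legendre_orthogonal ?mulr0// eq_sym.
rewrite big_seq big1// => i ir; rewrite -scalerAr pintZ legendre_orthogonal ?mulr0//.
by apply: contraNneq mr => ->.
Qed.

Lemma lprojE N f : lproj N f = \sum_(n <- iota 0 N.+1) lcoef f n *: P n.
Proof. by rewrite /lproj -(big_mkord xpredT (fun n => lcoef f n *: P n)) /index_iota subn0. Qed.

Lemma legendre_lead_neq0 n : (P n)`_n != 0.
Proof.
have f0 k : (k`!)%:R != 0 :> R by rewrite pnatr_eq0 -lt0n fact_gt0.
rewrite legendre_lead !mulf_neq0// invr_eq0//.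
Qed.

Lemma lproj_orth f N q : inL f -> (size q <= N.+1)%N ->
  I (fun t => (f t - (lproj N f).[t]) * q.[t]) = 0.
Proof.
move=> hf; pose T p := I (fun t => (f t - (lproj N f).[t]) * p.[t]).
have hr : inL (fun t => f t - (lproj N f).[t]) by apply: inL2B => //; exact: inL2_horner.
have TD p1 p2 : T (p1 + p2) = T p1 + T p2.
  rewrite /T -IntD; [|exact: intgM_horner..].
  by apply: eq_Int => t _; rewrite hornerD mulrDr.
have TZ c p : T (c *: p) = c * T p.
  rewrite /T -IntZ; last exact: intgM_horner.
  by apply: eq_Int => t _; rewrite hornerZ mulrCA.
have TP n : (n <= N)%N -> T (P n) = 0.
  move=> nN; rewrite /T.
  rewrite (@eq_Int _ _ _ (fun t => (f t - (lproj N f).[t]) * (P n).[t])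
    (fun t => f t * (P n).[t] - (P n * lproj N f).[t])); last first.
    by move=> t _; rewrite hornerM mulrBl [_ * (P n).[t] in X in _ - X]mulrC.
  rewrite IntB; [|exact: intgM_horner|exact: intg_horner].
  rewrite -[X in _ - X]/(pint _) lprojE pint_lsum ?iota_uniq// mem_iota add0n ltnS nN /=.
  by rewrite /lcoef divfK// subrr.
suff H k : (k <= N.+1)%N -> forall p, (size p <= k)%N -> T p = 0 by move=> /H; exact.
elim: k => [|k ih] kN p sp.
  move: sp; rewrite leqn0 size_poly_eq0 => /eqP ->.
  by rewrite -(scale0r 0) TZ mul0r.
rewrite -(subrK ((p`_k / (P k)`_k) *: P k) p) TD TZ TP// mulr0 addr0.
apply: ih; first exact: ltnW.
apply/leq_sizeP => j; rewrite leq_eqVlt => /predU1P[<-|kj].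
  by rewrite coefB coefZ divfK ?subrr// legendre_lead_neq0.
by rewrite coefB coefZ (nth_default 0 (leq_trans sp kj)) (nth_default 0 (leq_trans (size_legendre R k) kj)) mulr0 subr0.
Qed.

Lemma lproj_best f N q : inL f -> (size q <= N.+1)%N ->
  dist2 f (lproj N f) = dist2 f q - I (fun t => (lproj N f - q).[t] ^+ 2).
Proof.
move=> hf sq; set S := lproj N f.
have hr : inL (fun t => f t - S.[t]) by apply: inL2B => //; exact: inL2_horner.
have o : I (fun t => (f t - S.[t]) * (S - q).[t]) = 0.
  apply: lproj_orth => //; apply: leq_trans (size_polyD _ _) _.
  by rewrite geq_max size_polyN size_lproj.
have e : dist2 f q = I (fun t => (f t - S.[t]) ^+ 2 + 2 * ((f t - S.[t]) * (S - q).[t]) + (S - q).[t] ^+ 2).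
  by apply: eq_Int => t _; rewrite hornerD hornerN; ring.
have i1 : intg (-1) 1 (fun t => (f t - S.[t]) ^+ 2) by case: hr.
have i2 := intgM_horner (S - q) hr.
have i3 : intg (-1) 1 (fun t => (S - q).[t] ^+ 2) by case: (inL2_horner (-1) 1 (S - q)).
rewrite e IntD//; last by apply: intgD => //; exact: intgZ.
by rewrite IntD//; [rewrite IntZ// o mulr0 addr0 addrK|exact: intgZ].
Qed.

Lemma lproj_le f N q : inL f -> (size q <= N.+1)%N -> dist2 f (lproj N f) <= dist2 f q.
Proof.
move=> hf sq; rewrite (lproj_best hf sq) gerBl; apply: Int_ge0 => t _; exact: sqr_ge0.
Qed.

Lemma lproj_bound f N : inL f -> dist2 f (lproj N f) <= I (fun t => f t ^+ 2).
Proof.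
move=> hf; apply: le_trans (lproj_le (q := 0) hf _) _; first by rewrite size_poly0.
rewrite /dist2 le_eqVlt; apply/orP; left; apply/eqP.
by apply: eq_Int => t _; rewrite hornerC subr0.
Qed.

Lemma lproj_cvg f (e : R) : continuous f -> 0 < e ->
  exists M, forall N, (M <= N)%N -> dist2 f (lproj N f) <= e.
Proof.
move=> cf e0; have s0 : 0 < Num.sqrt (e / 2) by rewrite sqrtr_gt0 divr_gt0.
have [q hq] := Weierstrass cf s0.
exists (size q) => N qN; have hf : inL f by exact: inL2_cont.
apply: le_trans (lproj_le (q := q) hf (leqW qN)) _.
have -> : e = e / 2 * (1 - -1) by field.
rewrite -(Int_cst (e / 2) m11); apply: le_Int; last first.
- move=> t t1; rewrite -(@sqr_sqrtr _ (e / 2)) ?(divr_ge0 (ltW e0))//.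
  by rewrite -[(f t - _) ^+ 2](real_normK (num_real _)) lerXn2r ?nnegrE ?sqrtr_ge0// hq.
- exact: intg_cst.
- by have [] : inL (fun t => f t - q.[t]) by apply: inL2B => //; exact: inL2_horner.
Qed.

(* Bessel's inequality for the functions (1 - t^2) P_n', which by [legendre_ode]
   are orthogonal for the weight 1 / (1 - t^2). *)
Lemma lproj_Bessel f f' N M : dens (-1) 1 f f' -> inL f' -> (N <= M)%N ->
  I (fun t => (lproj M f - lproj N f).[t] ^+ 2) <=
  I (fun t => f' t ^+ 2) / ((N.+1)%:R * (N.+2)%:R).
Proof.
move=> df hf' NM; have hf : inL f by exact: dens_inL2 df.
pose r := iota N.+1 (M - N); pose q : {poly R} := \sum_(n <- r) lcoef f n *: P n.
have -> : lproj M f - lproj N f = q.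
  rewrite !lprojE -(subnKC NM) -addSn iotaD big_cat /= addrAC subrr add0r.
  by rewrite /q /r add0n.
have ur : uniq r by exact: iota_uniq.
pose u : {poly R} := 1 - 'X^2.
have uE t : u.[t] = 1 - t ^+ 2 by rewrite /u hornerD hornerN hornerXn hornerC.
have Lq : (u * q^`())^`() = - (\sum_(n <- r) ((n * n.+1)%:R * lcoef f n) *: P n).
  rewrite /q raddf_sum mulr_sumr raddf_sum -sumrN; apply: eq_bigr => n _.
  by rewrite /= derivZ -scalerAr derivZ legendre_ode scalerN scalerA mulrC.
(* T is the integral of u q'^2 and also that of u f' q'. Expanding the nonnegative integral of u (f'
   - q')^2 therefore gives T <= integral of u f'^2, and each weight n (n + 1) in T is at least (N +
   1) (N + 2). *)
pose T := \sum_(n <- r) (n * n.+1)%:R * (lcoef f n ^+ 2 * (2 / (2 * n + 1)%:R)).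
have qq : pint (q * q) = \sum_(n <- r) lcoef f n ^+ 2 * (2 / (2 * n + 1)%:R).
  rewrite {1}/q mulr_suml pint_sum big_seq [in RHS]big_seq; apply: eq_bigr => n nr.
  by rewrite -scalerAl pintZ pint_lsum// nr mulrA -expr2.
have T1 : pint (u * q^`() * q^`()) = T.
  have := @pint_parts R (u * q^`()) q; rewrite !hornerM !uE expr1n sqrrN expr1n subrr !mul0r.
  move=> /(_ erefl erefl) /eqP; rewrite -eqr_oppLR => /eqP <-.
  rewrite Lq mulNr pintN opprK mulr_suml pint_sum big_seq /T [in RHS]big_seq.
  apply: eq_bigr => n nr.
  by rewrite -scalerAl pintZ pint_lsum// nr expr2 !mulrA.
have T2 : I (fun t => f' t * (u * q^`()).[t]) = T.
  have [_ /(_ 1)] := densM df (dens_horner (-1) 1 (u * q^`())).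
  rewrite lexx m11 !hornerM !uE sqrrN expr1n subrr !mul0r !mulr0 add0r => /(_ erefl) /esym.
  rewrite IntD; [|exact: intgM_horner..].
  rewrite Lq => /eqP; rewrite addr_eq0 => /eqP ->.
  rewrite -IntN; last exact: intgM_horner.
  rewrite (@eq_Int _ _ _ (fun t => - (f t * _.[t]))
    (fun t => \sum_(n <- r) ((n * n.+1)%:R * lcoef f n) * (f t * (P n).[t]))); last first.
    move=> t _; rewrite hornerN mulrN opprK horner_sum mulr_sumr; apply: eq_bigr => n _.
    by rewrite hornerZ mulrCA.
  rewrite Int_sum; last by move=> n; apply: intgZ; exact: intgM_horner.
  apply: eq_bigr => n _; rewrite IntZ; last exact: intgM_horner.
  by rewrite expr2 -[in RHS]mulrA {2}/lcoef divfK// mulrA.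
have TI : T <= I (fun t => f' t ^+ 2).
  have hg : inL (fun t => f' t - q^`().[t]) by apply: inL2B => //; exact: inL2_horner.
  have i1 : intg (-1) 1 (fun t => f' t ^+ 2) by case: hf'.
  have cu : continuous (fun t => u.[t]) by exact: continuous_horner.
  have i2 := intgM_cont i1 cu.
  have i3 : intg (-1) 1 (fun t => (f' t - q^`().[t]) ^+ 2) by case: hg.
  have i4 := intgM_cont i3 cu.
  have u01 t : -1 <= t <= 1 -> 0 <= u.[t] <= 1.
    by move=> /andP[t1 t2]; rewrite uE; apply/andP; split; [nra|have := sqr_ge0 t; lra].
  have : 0 <= I (fun t => (f' t - q^`().[t]) ^+ 2 * u.[t]).
    by apply: Int_ge0 => t /u01 /andP[h _]; rewrite mulr_ge0 ?sqr_ge0.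
  rewrite (@eq_Int _ _ _ (fun t => (f' t - q^`().[t]) ^+ 2 * u.[t])
    (fun t => f' t ^+ 2 * u.[t] - 2 * (f' t * (u * q^`()).[t]) + (u * q^`() * q^`()).[t])); last first.
    by move=> t _; rewrite !hornerM; ring.
  have i5 := intgM_horner (u * q^`()) hf'.
  rewrite IntD; [|by apply: intgB => //; exact: intgZ|exact: intg_horner].
  rewrite IntB//; last exact: intgZ.
  rewrite IntZ// T2 -[X in _ + X]/(pint _) T1.
  suff : I (fun t => f' t ^+ 2 * u.[t]) <= I (fun t => f' t ^+ 2) by lra.
  apply: le_Int => // t /u01 /andP[_ h]; rewrite ler_piMr ?sqr_ge0//.
rewrite (@eq_Int _ _ _ (fun t => q.[t] ^+ 2) (fun t => (q * q).[t])); last first.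
  by move=> t _; rewrite hornerM expr2.
rewrite -[leLHS]/(pint _) qq ler_pdivlMr ?mulr_gt0 ?ltr0n//.
apply: le_trans TI; rewrite /T mulr_suml big_seq [leRHS]big_seq; apply: ler_sum => n.
rewrite mem_iota => /andP[Nn _].
rewrite mulrC; apply: ler_wpM2r; first by rewrite mulr_ge0 ?sqr_ge0// ltW.
by rewrite -natrM ler_nat leq_mul.
Qed.

(** The bound of [lproj_Bessel] does not depend on M, and the projections of degree M converge to f
    in L^2 by [lproj_cvg]; Pythagoras in the form of [lproj_best] combines the two. *)
Lemma lproj_deriv0 f f' N : dens (-1) 1 f f' -> inL f' ->
  dist2 f (lproj N f) <= I (fun t => f' t ^+ 2) / ((N.+1)%:R * (N.+2)%:R).
Proof.
move=> df hf'; apply/ler_addgt0Pl => e e0.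
pose F : R -> R := f \o clamp (-1) 1.
have cF : continuous F by apply: continuous_clamp => //; exact: dens_within df.
have Ff t : -1 <= t <= 1 -> F t = f t by move=> t1; rewrite /F /= clamp_id.
have hf : inL f by exact: dens_inL2 df.
have lF n : lproj n F = lproj n f.
  by apply: eq_bigr => k _; rewrite /lcoef; congr (_ / _ *: _); apply: eq_Int => t /Ff ->.
have [M hM] := lproj_cvg cF e0.
pose M' := maxn M N.
have h1 : dist2 f (lproj M' f) <= e.
  have := hM M' (leq_maxl _ _); rewrite lF; congr (_ <= _).
  by apply: eq_Int => t /Ff ->.
have s : (size (lproj N f) <= M'.+1)%N.
  by apply: leq_trans (size_lproj _ _) _; rewrite ltnS leq_maxr.
have := lproj_best hf s; have := lproj_Bessel df hf' (leq_maxr M N); rewrite -/M'.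
move: h1; set A := dist2 _ _; set B := I _; set C := I _ / _.
by set D := dist2 _ _; lra.
Qed.

End LegendreApproximation.

(** * Iterated primitives and weak derivatives *)

Section DerivativeChains.
Variable R : realType.
Implicit Types (a b : R) (f g D : R -> R) (m n N K : nat).

(* D is the m-th derivative of f in W^{m,2}. *)
Fixpoint Chain a b m f D : Prop :=
  if m is m'.+1 then exists2 f', Chain a b m' f' D & dens a b f f'
  else inL2 a b D /\ f = D.

Lemma Reg_Chain a b m f : Reg a b m f -> exists D, Chain a b m f D.
Proof.
elim: m f => [|m ih] f; first by exists f.
by case=> f' /ih[D hD] df; exists D, f'.
Qed.

Lemma Chain_top a b m f D : Chain a b m f D -> inL2 a b D.
Proof. by elim: m f => [|m ih] f; [case|case=> f' /ih]. Qed.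

Lemma Chain_inL2 a b m f D : a <= b -> Chain a b m f D -> inL2 a b f.
Proof.
move=> ab; case: m => [|m]; first by case=> hD ->.
by case=> f' _; exact: dens_inL2.
Qed.

Lemma ChainZ a b m k f D : Chain a b m f D ->
  Chain a b m (fun t => k * f t) (fun t => k * D t).
Proof.
elim: m f => [|m ih] f; first by case=> hD ->; split => //; exact: inL2Z.
by case=> f' /ih h df; exists (fun t => k * f' t) => //; exact: densZ.
Qed.

Lemma Chain_affine a b c d m f D : 0 < c -> Chain (c * a + d) (c * b + d) m f D ->
  Chain a b m (fun t => f (c * t + d)) (fun t => c ^+ m * D (c * t + d)).
Proof.
move=> c0; elim: m f => [|m ih] f.
  case=> hD ->; split; last by apply/funext => t; rewrite mul1r.
  by apply: inL2Z; exact: inL2_affine.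
case=> f' /ih h df; exists (fun t => c * f' (c * t + d)); last exact: dens_affine.
rewrite (_ : (fun t => c ^+ m.+1 * _) = fun t => c * (c ^+ m * D (c * t + d))); first exact: ChainZ.
by apply/funext => t; rewrite exprS mulrA.
Qed.

Lemma derive1n_out (phi : R -> R) c d k t :
  (forall s, s \notin `[c, d] -> phi s = 0) -> t \notin `[c, d] -> derive1n k phi t = 0.
Proof.
move=> h; elim: k t => [|k ih] t tcd; first exact: h.
rewrite derive1nS derive1E.
have e : {near t, (cst 0 : R -> R) =1 derive1n k phi}.
  have : nbhs t (~` `[c, d]).
    apply: open_nbhs_nbhs; split; last by move: tcd => /negP.
    exact/closed_openC/interval_closed.
  by apply: filterS => s /= /negP hs; rewrite ih.
by rewrite -(near_eq_derive _ e) ?oner_neq0// derive_cst.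
Qed.

Lemma dens_test a b (phi : R -> R) k :
  (forall (k : nat) (t : R), derivable (derive1n k phi) t 1) ->
  dens a b (derive1n k phi) (derive1n k.+1 phi).
Proof.
move=> h; have cd j : continuous (derive1n j phi).
  by move=> t; apply/differentiable_continuous/derivable1_diffP/h.
split; first by apply: intg_cont; exact: cd.
move=> t /andP[at_ tb].
have -> : Int a t (derive1n k.+1 phi) = derive1n k phi t - derive1n k phi a.
  apply: Int_FTC => //.
  - by apply: continuous_subspaceT; exact: cd.
  - by apply: continuous_subspaceT; exact: cd.
  - by move=> s _; rewrite derive1nS derive1E; apply: derivableP; exact: h.
by rewrite subrKC.
Qed.

(** Integration by parts m times; a test function vanishes near the end points together with its
    derivatives. *)
Lemma Chain_weak a b m f D (phi : R -> R) : a <= b -> Chain a b m f D ->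
  test_function a b phi ->
  Int a b (fun t => derive1n m phi t * f t) = (-1) ^+ m * Int a b (fun t => phi t * D t).
Proof.
move=> ab + [hd [c' [d' [ac db h0]]]].
have out k : derive1n k phi a = 0 /\ derive1n k phi b = 0.
  split; apply: (derive1n_out _ h0); rewrite in_itv /= negb_and -!ltNge ?ac ?db ?orbT//.
elim: m f => [|m ih] f; first by case=> _ ->; rewrite mul1r.
case=> f' hf' df; rewrite exprS -mulrA -(ih _ hf').
have dp := dens_test a b m hd.
have l1 := dens_inL2 ab (dens_test a b m.+1 hd).
have l2 := dens_inL2 ab dp.
have [_ /(_ b)] := densM dp df.
have [-> ->] := out m; rewrite lexx ab !mul0r => /(_ erefl) /esym.
rewrite IntD; last 2 first.
- by apply: inL2M => //; exact: dens_inL2 df.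
- by apply: inL2M => //; exact: Chain_inL2 hf'.
by move=> /eqP; rewrite add0r addr_eq0 mulN1r => /eqP.
Qed.

End DerivativeChains.

(** * Approximation rate for functions with m derivatives *)

Section ChainApproximation.
Variable R : realType.
Implicit Types (f D : R -> R) (q : {poly R}) (m n N K : nat).
Local Notation P := (legendre R).
Local Notation I f := (Int (-1) 1 f).
Local Notation inL f := (inL2 (-1) 1 f).

Lemma antiderivative q n : (size q <= n)%N ->
  exists2 Q : {poly R}, Q^`() = q & (size Q <= n.+1)%N.
Proof.
move=> sq; exists (\poly_(i < n.+1) (q`_i.-1 / i%:R)); last exact: size_poly.
apply/polyP => i; rewrite coef_deriv coef_poly ltnS.
case: ltnP => h /=; last by rewrite mul0rn nth_default// (leq_trans sq).
by rewrite -[X in X = _]mulr_natr divfK// pnatr_eq0.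
Qed.

(* Compare f with the projection of f - Q plus Q, for Q a primitive of the
   projection of f'. *)
Lemma lproj_deriv f f' N : dens (-1) 1 f f' -> inL f' ->
  I (fun t => (f t - (lproj N.+1 f).[t]) ^+ 2) <=
  I (fun t => (f' t - (lproj N f').[t]) ^+ 2) / (N.+2)%:R ^+ 2.
Proof.
move=> df hf'; have [Q dQ sQ] := antiderivative (size_lproj N f').
have m11 : -1 <= 1 :> R by lra.
pose g t := f t - Q.[t].
have dg : dens (-1) 1 g (fun t => f' t - (lproj N f').[t]).
  have := densD df (densZ (-1) (dens_horner (-1) 1 Q)); rewrite dQ.
  by apply: eq_dens => t _; rewrite /g mulN1r.
have hg' : inL (fun t => f' t - (lproj N f').[t]) by apply: inL2B => //; exact: inL2_horner.
have s : (size (Q + lproj N.+1 g)%R <= N.+2)%N.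
  by apply: leq_trans (size_polyD _ _) _; rewrite geq_max sQ size_lproj.
apply: (le_trans (lproj_le (dens_inL2 m11 df) s)).
have -> : I (fun t => (f t - (Q + lproj N.+1 g).[t]) ^+ 2) =
          I (fun t => (g t - (lproj N.+1 g).[t]) ^+ 2).
  by apply: eq_Int => t _; rewrite /g hornerD opprD addrA.
apply: (le_trans (lproj_deriv0 _ dg hg')).
apply: ler_wpM2l; first by apply: Int_ge0 => t _; exact: sqr_ge0.
rewrite lef_pV2 ?posrE ?mulr_gt0 ?exprn_gt0 ?ltr0n//.
by rewrite -natrM -natrX ler_nat leq_mul.
Qed.

(** Each derivative lowers the index of the projection by one and gains at least a factor K + 1,
    starting from index K + m so that index K is left for the last derivative. *)
Lemma lproj_Chain m K f D : Chain (-1) 1 m f D ->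
  I (fun t => (f t - (lproj (K + m) f).[t]) ^+ 2) <=
  I (fun t => D t ^+ 2) / (K.+1)%:R ^+ (2 * m).
Proof.
have m11 : -1 <= 1 :> R by lra.
elim: m f => [|m ih] f.
  by case=> hD ->; rewrite divr1; exact: lproj_bound.
case=> f' h df; rewrite addnS; apply: (le_trans (lproj_deriv _ df (Chain_inL2 m11 h))).
rewrite mulnS exprD [X in _ <= _ * X]invfM mulrA mulrAC.
apply: ler_pM; [|by rewrite invr_ge0 exprn_ge0| |].
- by apply: Int_ge0 => t _; exact: sqr_ge0.
- exact: ih.
- rewrite lef_pV2 ?posrE ?exprn_gt0 ?ltr0n// -!natrX ler_nat leq_exp2r//.
  by rewrite ltnS (leq_trans (leq_addr m K)).
Qed.

Lemma Int_scale (x : R) f : 0 < x -> intg (-x) x f ->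
  Int (-x) x f = x * I (fun s => f (x * s)).
Proof.
move=> x0 hf; have := @Int_affine _ x 0 (-1) 1 f x0.
rewrite !addr0 mulr1 mulrN1 => /(_ hf) ->; congr (_ * _).
by apply: eq_Int => t _; rewrite addr0.
Qed.

(** Rescaling to [-1, 1] multiplies the m-th derivative by x^m. *)
Lemma legendre_approx (x : R) m K f D : 0 < x -> Chain (-x) x m f D ->
  n2 (-x) x (fun t => f t - (lproj (K + m) (fun s => f (x * s))).[t / x]) <=
  (x / K.+1%:R) ^+ m * n2 (-x) x D.
Proof.
move=> x0 h; set q := lproj _ _.
have xx : - x <= x by rewrite ge0_cp// ltW.
have hf := Chain_inL2 xx h; have [_ hD] := Chain_top h.
have cq : continuous (fun t : R => q.[t / x]).
  move=> t; apply: (@continuous_comp _ _ _ (fun t : R => t / x) (horner q)).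
    by apply: cvgMr_tmp; exact: cvg_id.
  exact: continuous_horner.
have hg : intg (-x) x (fun t => (f t - q.[t / x]) ^+ 2).
  by have [] : inL2 (-x) x (fun t => f t - q.[t / x]) by apply: inL2B => //; exact: inL2_cont.
have h' : Chain (-1) 1 m (fun s => f (x * s)) (fun s => x ^+ m * D (x * s)).
  have := @Chain_affine _ (-1) 1 x 0 m f D x0; rewrite !addr0 mulr1 mulrN1 => /(_ h).
  by under eq_fun do rewrite addr0; under [X in Chain _ _ _ _ X]eq_fun do rewrite addr0.
rewrite -(@ler_pXn2r _ 2)// ?nnegrE ?n2_ge0 ?mulr_ge0 ?n2_ge0 ?exprn_ge0 ?divr_ge0 ?(ltW x0)//.
rewrite exprMn !n2_sqr Int_scale// [Int _ _ _ in X in _ <= X]Int_scale//.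
rewrite (@eq_Int _ (-1) 1 (fun s => (f (x * s) - q.[x * s / x]) ^+ 2)
  (fun s => (f (x * s) - q.[s]) ^+ 2)); last first.
  by move=> t _; rewrite [x * t]mulrC mulfK ?lt0r_neq0.
rewrite mulrCA ler_pM2l//; apply: (le_trans (lproj_Chain K h')).
rewrite (@eq_Int _ (-1) 1 (fun s => (x ^+ m * D (x * s)) ^+ 2)
  (fun s => x ^+ (2 * m) * D (x * s) ^+ 2)); last first.
  by move=> t _; rewrite exprMn -exprM mulnC.
have hD' : intg (-1) 1 (fun s => D (x * s) ^+ 2).
  have := @intg_affine _ x 0 (-1) 1 (fun t => D t ^+ 2) x0.
  rewrite !addr0 mulr1 mulrN1 => /(_ hD); apply: eq_intg => t _.
  by rewrite addr0.
by rewrite IntZ// -exprM [(m * 2)%N]mulnC expr_div_n mulrAC.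
Qed.

End ChainApproximation.

(** * Spherical Bessel functions *)

Section ComplexExponential.
Variable R : realType.
Local Notation Re := (@complex.Re R).
Local Notation Im := (@complex.Im R).
Implicit Types (z w : R[i]) (a b t x : R) (f g : R -> R[i]) (k m n : nat).

(** A submultiplicative norm that is linear in the absolute values of the two real components, hence
    convenient for integrals defined componentwise. *)
Definition cl1 z : R := `|Re z| + `|Im z|.

Lemma cl1_ge0 z : 0 <= cl1 z. Proof. by rewrite addr_ge0. Qed.

Lemma cl1D z w : cl1 (z + w) <= cl1 z + cl1 w.
Proof.
rewrite /cl1 cReD cImD; have := ler_normD (Re z) (Re w); have := ler_normD (Im z) (Im w).
lra.
Qed.

Lemma cl1M z w : cl1 (z * w) <= cl1 z * cl1 w.
Proof.
rewrite /cl1 cReM cImM; have := ler_normB (Re z * Re w) (Im z * Im w).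
have := ler_normD (Re z * Im w) (Im z * Re w); rewrite !normrM; lra.
Qed.

Lemma cl1X z k : cl1 (z ^+ k) <= cl1 z ^+ k.
Proof.
elim: k => [|k ih]; first by rewrite /cl1 /= normr1 normr0 addr0.
by rewrite !exprS; apply: (le_trans (cl1M _ _)); rewrite ler_wpM2l ?cl1_ge0.
Qed.

Lemma cl1_real x : cl1 x%:C = `|x|. Proof. by rewrite /cl1 /= normr0 addr0. Qed.

Lemma cl1N z : cl1 (- z) = cl1 z. Proof. by rewrite /cl1 cReN cImN !normrN. Qed.

Lemma Re_cl1 z : `|Re z| <= cl1 z. Proof. by rewrite lerDl. Qed.
Lemma Im_cl1 z : `|Im z| <= cl1 z. Proof. by rewrite lerDr. Qed.

Lemma cl1_cis x : cl1 (cis x) <= 2.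
Proof.
rewrite /cl1 /=.
have h1 : `|cos x| <= 1 by rewrite ler_norml cos_geN1 cos_le1.
have h2 : `|sin x| <= 1 by rewrite ler_norml sin_geN1 sin_le1.
lra.
Qed.

Lemma cl1_Cint a b f : cintg a b f -> cl1 (Cint a b f) <= Int a b (fun t => cl1 (f t)).
Proof.
move=> [f1 f2]; rewrite /cl1 /= IntD; [|exact: intg_norm..].
by apply: lerD; exact: le_normr_Int.
Qed.

Lemma cexpE z t : cexp (z * t%:C) = (expR (Re z * t))%:C * cis (Im z * t).
Proof. by rewrite /cexp cReM cImM /= !mulr0 subr0 add0r. Qed.

Lemma cder_real x (h : R -> R) d : is_derive x 1 h d -> cder x (fun t => (h t)%:C) d%:C.
Proof. by move=> dh; split => //=; exact: is_derive_cst. Qed.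

Lemma ccont_real (T : topologicalType) (h : T -> R) : continuous h ->
  ccont (fun t : T => (h t)%:C).
Proof. by move=> ch; split => //= t; exact: cvg_cst. Qed.

Lemma continuous_scale (k : R) : continuous (fun t : R => k * t).
Proof. by move=> t; apply: cvgMl_tmp; exact: cvg_id. Qed.

Lemma ccont_cexp z : ccont (fun t => cexp (z * t%:C)).
Proof.
under eq_fun do rewrite cexpE; apply: ccontM.
  apply: ccont_real => t.
  by apply: continuous_comp; [exact: continuous_scale|exact: continuous_expR].
by apply: ccont_cis; exact: continuous_scale.
Qed.

Lemma cder_cexp z t : cder t (fun s => cexp (z * s%:C)) (z * cexp (z * t%:C)).
Proof.
have h : is_derive t 1 (fun s => expR (Re z * s)) (expR (Re z * t) * Re z).
  apply: (is_derive1_comp (is_derive_expR (Re z * t))).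
  by apply: is_derive_eq; rewrite scaler1.
have := cderM (cder_real h) (cder_cis (Im z) t).
rewrite (_ : (fun s : R => _ * _) = (fun s => cexp (z * s%:C))); last first.
  by apply/funext => s; rewrite cexpE.
congr cder; rewrite cexpE.
move: (expR _) (cis _) => e [c s]; case: z {h} => p q /=.
by apply: complex_eq; rewrite ?cReD ?cImD !(cReM, cImM) /=; ring.
Qed.

Definition monom k : {poly R} := (k`!%:R)^-1 *: 'X^k.

Lemma deriv_monomS k : (monom k.+1)^`() = monom k.
Proof.
rewrite /monom derivZ derivXn /= (_ : 'X^k *+ k.+1 = k.+1%:R *: 'X^k); last by rewrite scaler_nat.
rewrite scalerA factS natrM invfM.
by rewrite mulrAC mulVf ?mul1r// pnatr_eq0.
Qed.

(** The Taylor remainder of exp(z t) as a function of real t: the remainder of order m + 1 is the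
    primitive of z times that of order m, so a complex Taylor estimate follows from real
    integration. *)
Definition cexp_rem z m t : R[i] :=
  cexp (z * t%:C) - \sum_(k < m) z ^+ k * (monom k).[t]%:C.

Lemma ccont_sum (T : topologicalType) m (F : nat -> T -> R[i]) :
  (forall k, ccont (F k)) -> ccont (fun t : T => \sum_(k < m) F k t).
Proof.
move=> h; elim: m => [|m ih]; first by under eq_fun do rewrite big_ord0; exact: ccont_cst.
by under eq_fun do rewrite big_ord_recr; exact: ccontD.
Qed.

Lemma cder_sum m t (F F' : nat -> R -> R[i]) :
  (forall k, cder t (F k) (F' k t)) -> cder t (fun s => \sum_(k < m) F k s) (\sum_(k < m) F' k t).
Proof.
move=> h; elim: m => [|m ih].
  by under eq_fun do rewrite big_ord0; rewrite big_ord0; exact: cder_cst.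
by under eq_fun do rewrite big_ord_recr; rewrite big_ord_recr; exact: cderD.
Qed.

Lemma ccont_cexp_rem z m : ccont (cexp_rem z m).
Proof.
apply: ccontD; first exact: ccont_cexp.
apply: ccontN; apply: (@ccont_sum _ m (fun k t => z ^+ k * (monom k).[t]%:C)) => k.
by apply: ccontM; [exact: ccont_cst|apply: ccont_real; exact: continuous_horner].
Qed.

Lemma cder_cexp_rem z m t : cder t (cexp_rem z m.+1) (z * cexp_rem z m t).
Proof.
rewrite /cexp_rem mulrBr -mulN1r; apply: cderD; first exact: cder_cexp.
under eq_fun do rewrite -mulN1r.
apply: cderZ; under eq_fun do rewrite big_ord_recl /=.
rewrite -[z * _]add0r mulr_sumr; apply: cderD.
  rewrite -[0](mulr0 1); apply: cderZ.
  by rewrite /monom expr0 fact0 invr1 scale1r; under eq_fun do rewrite hornerC; exact: cder_cst.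
apply: (@cder_sum m t (fun k s => z ^+ k.+1 * (monom k.+1).[s]%:C)
  (fun k s => z * (z ^+ k * (monom k).[s]%:C))) => k.
rewrite mulrA -exprS; apply: cderZ; apply: cder_real.
by have := is_derive_horner (monom k.+1) t; rewrite deriv_monomS.
Qed.

Lemma cexp_rem0 z m : cexp_rem z m.+1 0 = 0.
Proof.
rewrite /cexp_rem big_ord_recl big1; last first.
  by move=> k _; rewrite /= /monom hornerZ hornerXn expr0n mulr0 mulr0.
rewrite addr0 expr0 mul1r /monom expr0 fact0 invr1 scale1r hornerC.
by rewrite cexpE !mulr0 expR0 cis0 mulr1 subrr.
Qed.

Lemma cl1_cexp_rem z m t : 0 <= t <= 1 ->
  cl1 (cexp_rem z m t) <= 2 * expR (cl1 z) * cl1 z ^+ m * (monom m).[t].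
Proof.
elim: m t => [|m ih] t /andP[t0 t1].
  rewrite /cexp_rem big_ord0 subr0 expr0 mulr1 /monom expr0 fact0 invr1 scale1r hornerC mulr1.
  rewrite cexpE mulrC; apply: (le_trans (cl1M _ _)).
  apply: ler_pM; rewrite ?cl1_ge0 ?cl1_cis// cl1_real ger0_norm ?expR_ge0// ler_expR.
  apply: (le_trans (ler_norm _)); rewrite normrM (ger0_norm t0).
  by apply: (le_trans _ (Re_cl1 z)); rewrite ler_piMr.
have cE : ccont (fun s => z * cexp_rem z m s).
  by apply: ccontM; [exact: ccont_cst|exact: ccont_cexp_rem].
have e : cexp_rem z m.+1 t = Cint 0 t (fun s => z * cexp_rem z m s).
  rewrite (Cint_FTC t0 (ccont_cexp_rem z m.+1) cE) ?cexp_rem0 ?subr0// => s _.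
  exact: cder_cexp_rem.
have [i1 i2] := ccont_cintg 0 t cE.
rewrite e; apply: (le_trans (cl1_Cint (conj i1 i2))).
pose D : {poly R} := (2 * expR (cl1 z) * cl1 z ^+ m.+1) *: monom m.+1.
have -> : 2 * expR (cl1 z) * cl1 z ^+ m.+1 * (monom m.+1).[t] = Int 0 t (fun s => D^`().[s]).
  rewrite Int_deriv// /D !hornerZ [in X in _ - X]hornerXn expr0n/= !mulr0 subr0//.
apply: le_Int; [|exact: intg_horner|].
  by apply: intgD; exact: intg_norm.
move=> s /andP[s0 st]; apply: (le_trans (cl1M _ _)).
rewrite /D derivZ deriv_monomS hornerZ exprS.
have -> : 2 * expR (cl1 z) * (cl1 z * cl1 z ^+ m) * (monom m).[s] =
  cl1 z * (2 * expR (cl1 z) * cl1 z ^+ m * (monom m).[s]) by ring.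
by rewrite ler_wpM2l ?cl1_ge0// ih// s0 (le_trans st).
Qed.

Lemma cexp_Taylor z m : cl1 (cexp z - \sum_(k < m) z ^+ k / k`!%:R) <=
  2 * expR (cl1 z) * exp_coeff (cl1 z) m.
Proof.
have := @cl1_cexp_rem z m 1; rewrite ler01 lexx => /(_ erefl).
rewrite /cexp_rem mulr1 /monom hornerZ hornerXn expr1n mulr1 /exp_coeff mulrA.
congr (cl1 (_ - _) <= _); apply: eq_bigr => k _.
by rewrite hornerZ hornerXn expr1n mulr1 fmorphV rmorph_nat.
Qed.

End ComplexExponential.

(** * Legendre transforms of exponentials, cosines and sines *)

Section SphericalBessel.
Variable R : realType.
Local Notation Re := (@complex.Re R).
Local Notation Im := (@complex.Im R).
Implicit Types (z w : R[i]) (n m k : nat).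
Local Notation P := (legendre R).

Lemma cvg_exp_coeff0 (x : R) : exp_coeff x @ \oo --> (0 : R).
Proof. by apply: cvg_series_cvg_0; exact: is_cvg_series_exp_coeff. Qed.

Lemma exp_coeff_ge0 (x : R) m : 0 <= x -> 0 <= exp_coeff x m.
Proof. by move=> x0; rewrite /exp_coeff /= divr_ge0 ?exprn_ge0. Qed.

Let coef n z k : R[i] := (-1) ^+ k * z ^+ (2 * k) / (2 ^ k * k`! * odd_dfact (n + k))%:R.

Let cl1_coef n z k : cl1 (coef n z k) <= exp_coeff (cl1 z ^+ 2) k.
Proof.
rewrite /coef /exp_coeff /=; apply: (le_trans (cl1M _ _)).
apply: ler_pM; rewrite ?cl1_ge0//.
  apply: (le_trans (cl1M _ _)); apply: (@le_trans _ _ (1 * cl1 z ^+ (2 * k))).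
    apply: ler_pM; rewrite ?cl1_ge0 ?cl1X//; apply: (le_trans (cl1X _ _)).
    by rewrite cl1N (cl1_real 1) normr1 expr1n.
  by rewrite mul1r exprM.
rewrite -(rmorph_nat (@real_complex R)) -fmorphV cl1_real ger0_norm ?invr_ge0//.
have od : (0 < odd_dfact (n + k))%N by apply: prodn_gt0 => i; rewrite addn1.
rewrite lef_pV2 ?posrE ?ltr0n ?muln_gt0 ?expn_gt0 ?fact_gt0 ?od// ler_nat.
by rewrite -mulnA mulnCA -[X in (X <= _)%N]muln1 leq_mul2l muln_gt0 expn_gt0 od orbT.
Qed.

Let cvg_part n z (part : R[i] -> R) : (forall w, `|part w| <= cl1 w) ->
  cvgn (series (fun k => part (coef n z k))).
Proof.
move=> hp; apply: normed_cvg; apply: (@series_le_cvg _ _ (exp_coeff (cl1 z ^+ 2))).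
- by move=> k; exact: normr_ge0.
- by move=> k; apply: exp_coeff_ge0; exact: sqr_ge0.
- by move=> k /=; apply: (le_trans (hp _)).
- exact: is_cvg_series_exp_coeff.
Qed.

Lemma Cint_legendre_monom n k : Cint (-1) 1 (fun s : R => (P n).[s]%:C * (s ^+ k)%:C) =
  (pint (P n * 'X^k))%:C.
Proof.
apply: complex_eq => /=.
  by apply: eq_Int => t _; rewrite ?cReM /= ?mul0r ?mulr0 ?subr0 hornerM hornerXn.
by rewrite (@eq_Int _ _ _ _ (fun=> 0)) ?Int_cst ?mul0r//= => t _; rewrite ?cImM /= ?mul0r ?mulr0 ?add0r.
Qed.

(** [part] stands for the real or the imaginary part, since [cseries_sum] takes the two limits
    separately. *)
Lemma cvg_legendre_cexp n z (part : R[i] -> R) : (forall w, `|part w| <= cl1 w) ->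
  (forall v w, part (v - w) = part v - part w) ->
  (fun m => part (\sum_(k < m) z ^+ k / k`!%:R * (pint (P n * 'X^k))%:C)) @ \oo -->
  part (Cint (-1) 1 (fun s : R => (P n).[s]%:C * cexp (z * s%:C))).
Proof.
move=> hp hB; have m11 : -1 <= 1 :> R by lra.
have cP : ccont (fun s : R => (P n).[s]%:C) by apply: ccont_real; exact: continuous_horner.
have cX k : ccont (fun s : R => (P n).[s]%:C * (s ^+ k)%:C).
  apply: ccontM => //; apply: ccont_real.
  by under eq_fun do rewrite -hornerXn; exact: continuous_horner.
have cE := ccontM cP (ccont_cexp z).
have [M M0 hM] := cont_bounded (-1) 1 (@continuous_horner R (P n)).
pose C := M * (2 * expR (cl1 z)) * 2.
have cl s m : -1 <= s <= 1 -> cl1 (cexp (z * s%:C) - \sum_(k < m) z ^+ k / k`!%:R * (s ^+ k)%:C)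
    <= 2 * expR (cl1 z) * exp_coeff (cl1 z) m.
  move=> /andP[s1 s2]; have zs : cl1 (z * s%:C) <= cl1 z.
    apply: (le_trans (cl1M _ _)); rewrite cl1_real ler_piMr ?cl1_ge0//.
    by rewrite ler_norml s1.
  have := cexp_Taylor (z * s%:C) m.
  rewrite (eq_bigr (fun k : 'I_m => z ^+ k / k`!%:R * (s ^+ k)%:C)); last first.
    by move=> k _; rewrite exprMn rmorphXn /= mulrAC.
  move=> h; apply: (le_trans h); apply: ler_pM.
  - by rewrite mulr_ge0// expR_ge0.
  - by apply: exp_coeff_ge0; exact: cl1_ge0.
  - by rewrite ler_wpM2l// ler_expR.
  - by rewrite /exp_coeff /= ler_wpM2r ?invr_ge0// lerXn2r ?nnegrE ?cl1_ge0.
have bd m : cl1 (Cint (-1) 1 (fun s : R => (P n).[s]%:C * cexp (z * s%:C)) -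
    \sum_(k < m) z ^+ k / k`!%:R * (pint (P n * 'X^k))%:C) <= C * exp_coeff (cl1 z) m.
  have -> : \sum_(k < m) z ^+ k / k`!%:R * (pint (P n * 'X^k))%:C =
      Cint (-1) 1 (fun s : R => \sum_(k < m) z ^+ k / k`!%:R * ((P n).[s]%:C * (s ^+ k)%:C)).
    elim: m => [|m ih].
      by rewrite big_ord0; under [X in Cint _ _ X]eq_fun do rewrite big_ord0; rewrite Cint0.
    rewrite big_ord_recr ih /=; under [X in _ = Cint _ _ X]eq_fun do rewrite big_ord_recr.
    rewrite CintD; last 2 first.
    - apply: ccont_cintg.
      apply: (@ccont_sum _ _ m (fun k s => z ^+ k / k`!%:R * ((P n).[s]%:C * (s ^+ k)%:C))) => k.
      by apply: ccontM => //; exact: ccont_cst.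
    - by apply: ccont_cintg; apply: ccontM => //; exact: ccont_cst.
    by rewrite CintZ ?Cint_legendre_monom//; exact: ccont_cintg.
  have cS : ccont (fun s : R => \sum_(k < m) z ^+ k / k`!%:R * ((P n).[s]%:C * (s ^+ k)%:C)).
    apply: (@ccont_sum _ _ m (fun k s => z ^+ k / k`!%:R * ((P n).[s]%:C * (s ^+ k)%:C))) => k.
    by apply: ccontM => //; exact: ccont_cst.
  rewrite -CintB; [|exact: ccont_cintg..].
  have i := ccont_cintg (-1) 1 (ccontD cE (ccontN cS)).
  apply: (le_trans (cl1_Cint i)).
  have -> : C * exp_coeff (cl1 z) m = M * (2 * expR (cl1 z) * exp_coeff (cl1 z) m) * (1 - -1).
    by rewrite /C; ring.
  rewrite -Int_cst//; apply: le_Int; [|exact: intg_cst|].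
    by case: i => i1 i2; apply: intgD; exact: intg_norm.
  move=> s s1; rewrite (_ : _ - _ = (P n).[s]%:C * (cexp (z * s%:C) - \sum_(k < m) z ^+ k / k`!%:R * (s ^+ k)%:C)).
    apply: (le_trans (cl1M _ _)); apply: ler_pM; rewrite ?cl1_ge0 ?cl1_real ?hM//.
    exact: cl.
  by rewrite mulrBr mulr_sumr; congr (_ - _); apply: eq_bigr => k _; rewrite mulrCA.
apply/subr_cvg0.
have cE0 : (fun m => C * exp_coeff (cl1 z) m) @ \oo --> (0 : R).
  rewrite -(mulr0 C); apply: cvgMl_tmp; exact: cvg_exp_coeff0.
apply: (@squeeze_cvgr _ _ _ _ (fun m => - (C * exp_coeff (cl1 z) m)) (fun m => C * exp_coeff (cl1 z) m)) => //.
  near=> m; rewrite -ler_norml -normrN opprB -hB.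
  exact: (le_trans (hp _)).
by rewrite -(oppr0 R); exact: cvgN.
Unshelve. all: by end_near. Qed.

Lemma legendre_cexp n z :
  Cint (-1) 1 (fun s : R => (P n).[s]%:C * cexp ('i%C * z * s%:C)) =
  2 * 'i%C ^+ n * sph_bessel n z.
Proof.
pose u := coef n z.
(* Moments of order below n vanish, and so do those of order n + 2k + 1; the first n + 2m terms of
   the exponential series thus leave m terms of the Bessel series. *)
have e m : \sum_(k < n + 2 * m) ('i%C * z) ^+ k / k`!%:R * (pint (P n * 'X^k))%:C =
    2 * ('i%C * z) ^+ n * \sum_(j < m) u j.
  rewrite big_split_ord /= big1 ?add0r; last first.
    by move=> k _; rewrite legendre_moment_lt// rmorph0 mulr0.
  elim: m => [|m ih]; first by rewrite !big_ord0 mulr0.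
  rewrite mulnS !addSn add0n !big_ord_recr /= ih mulrDr -addrA; congr (_ + _).
  rewrite legendre_moment_odd rmorph0 mulr0 addr0 legendre_moment.
  have f0 : (n + 2 * m)`!%:R != 0 :> R[i] by rewrite pnatr_eq0 -lt0n fact_gt0.
  rewrite rmorphM fmorphV rmorphM !rmorph_nat /u /coef exprD.
  have -> : ('i%C * z) ^+ (2 * m) = (-1) ^+ m * z ^+ (2 * m) by rewrite exprMn exprM sqr_i.
  move: (2 ^ m * m`! * odd_dfact (n + m))%:R^-1 (n + 2 * m)`!%:R f0 => d F f0.
  move: (_ ^+ n) (_ * z ^+ _) => X Y.
  by field; rewrite f0.
have hRe : (forall w, `|Re w| <= cl1 w) by exact: Re_cl1.
have hIm : (forall w, `|Im w| <= cl1 w) by exact: Im_cl1.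
have uR := @cvg_part n z _ hRe; have uI := @cvg_part n z _ hIm.
pose S : R[i] := cseries_sum u.
have -> : 2 * 'i%C ^+ n * sph_bessel n z = 2 * ('i%C * z) ^+ n * S.
  by rewrite /sph_bessel exprMn !mulrA.
have cvS : ((fun m => Re (\sum_(j < m) u j)) @ \oo --> Re S) /\
           ((fun m => Im (\sum_(j < m) u j)) @ \oo --> Im S).
  split.
    under eq_fun do rewrite Re_sum -(big_mkord xpredT (fun j => Re (u j))).
    exact: uR.
  under eq_fun do rewrite Im_sum -(big_mkord xpredT (fun j => Im (u j))).
  exact: uI.
have sub (v : nat -> R) (l : R) : v @ \oo --> l -> (fun m => v (n + 2 * m)%N) @ \oo --> l.
  move=> vl; apply: cvg_comp vl; apply/cvgnyPge => A; near=> m.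
  by apply: (@leq_trans m); [near: m; exact: nbhs_infty_ge|lia].
set c := 2 * ('i%C * z) ^+ n.
have cB (v w : R[i]) : Re (v - w) = Re v - Re w by rewrite cReD cReN.
have cB' (v w : R[i]) : Im (v - w) = Im v - Im w by rewrite cImD cImN.
have [cS1 cS2] := cvS.
apply: complex_eq.
  have h1 := sub _ _ (@cvg_legendre_cexp n ('i%C * z) _ hRe cB).
  apply: (cvg_unique _ h1) => //=.
  under eq_fun do rewrite e cReM; rewrite cReM.
  by apply: cvgB; apply: cvgMl_tmp.
have h1 := sub _ _ (@cvg_legendre_cexp n ('i%C * z) _ hIm cB').
apply: (cvg_unique _ h1) => //=.
under eq_fun do rewrite e cImM; rewrite cImM.
by apply: cvgD; apply: cvgMl_tmp.
Unshelve. all: by end_near. Qed.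

Lemma sph_besselN n z : sph_bessel n (- z) = (-1) ^+ n * sph_bessel n z.
Proof.
rewrite /sph_bessel (exprNn z) -mulrA; congr (_ * (_ * cseries_sum _)).

by apply/funext => k; rewrite !exprM sqrrN.
Qed.

Let cP n z : cintg (-1) 1 (fun s : R => (P n).[s]%:C * cexp ('i%C * z * s%:C)).
Proof.
apply: ccont_cintg; apply: ccontM; last exact: ccont_cexp.
by apply: ccont_real; exact: continuous_horner.
Qed.

Lemma legendre_ccos n z :
  Cint (-1) 1 (fun s : R => (P n).[s]%:C * ccos (z * s%:C)) =
  if odd n then 0 else 2 * (-1) ^+ n./2 * sph_bessel n z.
Proof.
rewrite (@eq_Cint _ _ _ _ (fun s : R => 2^-1 * ((P n).[s]%:C * cexp ('i%C * z * s%:C) +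
    (P n).[s]%:C * cexp ('i%C * (- z) * s%:C)))); last first.
  move=> s _; have e1 : 'i%C * (z * s%:C) = 'i%C * z * s%:C by rewrite mulrA.
  by rewrite /ccos mulrN mulNr e1 -mulrDr mulrA mulrC.
rewrite CintZ; last by apply: ccont_cintg; apply: ccontD; apply: ccontM;
  (exact: ccont_cexp || (apply: ccont_real; exact: continuous_horner)).
rewrite CintD// !legendre_cexp sph_besselN -signr_odd.
have n2 := odd_double_half n; case: ifP => on; rewrite on in n2.
  by rewrite expr1 mulN1r mulrN subrr mulr0.
rewrite expr0 mul1r -{1 3}n2 add0n -mul2n exprM sqr_i; field.
by []. Qed.

Lemma legendre_csin n z :
  Cint (-1) 1 (fun s : R => (P n).[s]%:C * csin (z * s%:C)) =
  if odd n then 2 * (-1) ^+ n./2 * sph_bessel n z else 0.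
Proof.
have i0 : 'i%C != 0 :> R[i] by rewrite neq0Ci.
rewrite (@eq_Cint _ _ _ _ (fun s : R => (2 * 'i%C)^-1 * ((P n).[s]%:C * cexp ('i%C * z * s%:C) -
    (P n).[s]%:C * cexp ('i%C * (- z) * s%:C)))); last first.
  move=> s _; have e1 : 'i%C * (z * s%:C) = 'i%C * z * s%:C by rewrite mulrA.
  by rewrite /csin mulrN mulNr e1 -mulrBr mulrA mulrC.
rewrite CintZ; last by apply: ccont_cintg; apply: ccontD; last (apply: ccontN); apply: ccontM;
  (exact: ccont_cexp || (apply: ccont_real; exact: continuous_horner)).
rewrite CintB// !legendre_cexp sph_besselN -signr_odd.
have n2 := odd_double_half n; case: ifP => on; rewrite on in n2; last first.
  by rewrite expr0 mul1r subrr mulr0.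
rewrite expr1 mulN1r -{1 3}n2 add1n exprS -mul2n exprM sqr_i; field.
by rewrite i0.
Qed.

End SphericalBessel.

(** * The operator norm *)

Section OperatorNorm.
Variable R : realType.
Local Notation Re := (@complex.Re R).
Local Notation Im := (@complex.Im R).
Local Notation M2 := 'M[R[i]]_2.
Local Notation C2 := 'cV[R[i]]_2.
Implicit Types (A : M2) (v : C2) (x y : R).

Lemma I2_sum (V : nmodType) (F : 'I_2 -> V) : \sum_(j < 2) F j = F 0 + F 1.
Proof.
by rewrite big_ord_recl big_ord1; congr (F _ + F _); apply: val_inj.
Qed.

Definition esq v : R := \sum_i (Re (v i 0) ^+ 2 + Im (v i 0) ^+ 2).

Lemma esq_ge0 v : 0 <= esq v.
Proof. by apply: sumr_ge0 => i _; rewrite addr_ge0 ?sqr_ge0. Qed.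

Lemma enorm_sqr v : enorm v ^+ 2 = esq v.
Proof. by rewrite /enorm sqr_sqrtr ?esq_ge0. Qed.

Lemma enorm_le v x : 0 <= x -> (enorm v <= x) = (esq v <= x ^+ 2).
Proof.
by move=> x0; rewrite -enorm_sqr ler_pXn2r// nnegrE// /enorm sqrtr_ge0.
Qed.

Lemma mulmx_col2 A v i : (A *m v) i 0 = A i 0 * v 0 0 + A i 1 * v 1 0.
Proof. by rewrite mxE I2_sum. Qed.

(** It shows that the set defining [opnorm] is bounded above, without which its [sup] would be a
    default value. *)
Lemma enorm_mulmx_bound A v : enorm v <= 1 ->
  enorm (A *m v) <= 2 * \sum_i \sum_j cl1 (A i j).
Proof.
have S0 : 0 <= \sum_i \sum_j cl1 (A i j).
  by apply: sumr_ge0 => i _; apply: sumr_ge0 => j _; exact: cl1_ge0.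
rewrite enorm_le// enorm_le ?mulr_ge0// expr1n => hv.
have cv j : cl1 (v j 0) <= 2.
  have : Re (v j 0) ^+ 2 + Im (v j 0) ^+ 2 <= 1.
    apply: le_trans hv; rewrite /esq (bigD1 j)//= lerDl.
    by apply: sumr_ge0 => i _; rewrite addr_ge0 ?sqr_ge0.
  rewrite -(real_normK (num_real (Re _))) -(real_normK (num_real (Im _))) /cl1.
  move: (normr_ge0 (Re (v j 0))) (normr_ge0 (Im (v j 0))) => h1 h2 h3.
  have := sqr_ge0 (`|Re (v j 0)| - 1); have := sqr_ge0 (`|Im (v j 0)| - 1); lra.
have cAv i : cl1 ((A *m v) i 0) <= 2 * \sum_j cl1 (A i j).
  rewrite mulmx_col2 I2_sum; apply: (le_trans (cl1D _ _)).
  rewrite mulrDr ![2 * _]mulrC; apply: lerD; apply: (le_trans (cl1M _ _));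
    by rewrite ler_wpM2l ?cl1_ge0.
have sq w : Re w ^+ 2 + Im w ^+ 2 <= cl1 w ^+ 2.
  rewrite -(real_normK (num_real (Re _))) -(real_normK (num_real (Im _))) /cl1.
  move: (normr_ge0 (Re w)) (normr_ge0 (Im w)) => h1 h2; nra.
rewrite /esq I2_sum; apply: (@le_trans _ _ (cl1 ((A *m v) 0 0) ^+ 2 + cl1 ((A *m v) 1 0) ^+ 2)).
  by apply: lerD.
rewrite [X in 2 * X]I2_sum mulrDr.
apply: (@le_trans _ _ ((cl1 ((A *m v) 0 0) + cl1 ((A *m v) 1 0)) ^+ 2)).
  have := cl1_ge0 ((A *m v) 0 0); have := cl1_ge0 ((A *m v) 1 0) => h1 h2; nra.
by rewrite ler_pXn2r ?nnegrE ?lerD// addr_ge0 ?cl1_ge0 ?mulr_ge0// sumr_ge0// => j _; exact: cl1_ge0.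
Qed.

Let ball0 A : [set enorm (A *m v) | v in [set v : C2 | enorm v <= 1]] 0.
Proof.
have e0 : enorm (0 : C2) = 0.
  by rewrite /enorm big1 ?sqrtr0// => i _; rewrite mxE expr0n addr0.
by exists 0; rewrite /= ?mulmx0 e0.
Qed.

Lemma enorm_le_opnorm A v : enorm v <= 1 -> enorm (A *m v) <= opnorm A.
Proof.
move=> hv; apply: ub_le_sup; last by exists v.
by exists (2 * \sum_i \sum_j cl1 (A i j)) => _ [u hu <-]; exact: enorm_mulmx_bound.
Qed.

Lemma opnorm_le A x : (forall v, enorm v <= 1 -> enorm (A *m v) <= x) -> opnorm A <= x.
Proof. by move=> h; apply: ge_sup; [exists 0; exact: ball0|move=> _ [v hv <-]; exact: h]. Qed.

Lemma opnorm_ge0 A : 0 <= opnorm A.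
Proof.
have := @enorm_le_opnorm A 0; rewrite mulmx0.
have -> : enorm (0 : C2) = 0.
  by rewrite /enorm big1 ?sqrtr0// => i _; rewrite mxE expr0n addr0.
by apply; rewrite ler01.
Qed.

Lemma opnorm_le_cl1 A : opnorm A <= 2 * \sum_i \sum_j cl1 (A i j).
Proof. by apply: opnorm_le => v; exact: enorm_mulmx_bound. Qed.

Lemma opnorm_entry A i j : `|Re (A i j)| <= opnorm A /\ `|Im (A i j)| <= opnorm A.
Proof.
pose v : C2 := \col_k (k == j)%:R.
have hv : enorm v <= 1.
  rewrite enorm_le// expr1n /esq (bigD1 j)//= big1 ?addr0; last first.
    by move=> k kj; rewrite mxE (negbTE kj) /= expr0n addr0.
  by rewrite mxE eqxx /= expr1n expr0n addr0.
have e : (A *m v) i 0 = A i j.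
  rewrite mxE (bigD1 j)//= big1 ?addr0 ?mxE ?eqxx ?mulr1//.
  by move=> k kj; rewrite mxE (negbTE kj) mulr0.
have := enorm_le_opnorm A hv; rewrite enorm_le ?opnorm_ge0// /esq (bigD1 i)//= e => h.
have h0 : 0 <= \sum_(k | k != i) (Re ((A *m v) k 0) ^+ 2 + Im ((A *m v) k 0) ^+ 2).
  by apply: sumr_ge0 => k _; rewrite addr_ge0 ?sqr_ge0.
have h1 := sqr_ge0 (Re (A i j)); have h2 := sqr_ge0 (Im (A i j)).
split; rewrite -(@ler_pXn2r _ 2) ?nnegrE ?opnorm_ge0// real_normK ?num_real//; lra.
Qed.

Definition vec4 (x : R * R * (R * R)) : C2 :=
  \col_i if i == 0 then x.1.1 +i* x.1.2 else x.2.1 +i* x.2.2.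

(* The vectors with rational entries suffice to compute the operator norm, which
   is therefore measurable. *)
Let ratvec n : C2 :=
  if unpickle n is Some q then
    vec4 (ratr (q : rat * rat * (rat * rat)).1.1, ratr q.1.2, (ratr q.2.1, ratr q.2.2))
  else 0.

Lemma rat_continuous_ge0 (h : R -> R) : continuous h -> (forall q, 0 <= h (ratr q)) ->
  forall x, 0 <= h x.
Proof.
move=> ch hq x; rewrite leNgt; apply/negP => hx.
have op : open (h @^-1` [set y | y < 0]) by apply: open_comp => // y _; exact: ch.
have [y [/= hy [q _ qy]]] := dense_rat (ex_intro _ x hx) op.
by have := hq q; rewrite qy leNgt hy.
Qed.

Lemma derivable_cont (k : R -> R) : (forall x, derivable k x 1) -> continuous k.
Proof. by move=> dk x; apply/differentiable_continuous/derivable1_diffP. Qed.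

(** The difference of the two sides is a polynomial in the four real coordinates of v, so rational
    coordinates are replaced by real ones one at a time. *)
Let esq_density A (s : R) : (forall n, esq (A *m ratvec n) <= s * esq (ratvec n)) ->
  forall v, esq (A *m v) <= s * esq v.
Proof.
move=> hn v; pose h (x : R * R * (R * R)) := s * esq (vec4 x) - esq (A *m vec4 x).
have hE x1 x2 x3 x4 : h (x1, x2, (x3, x4)) =
    s * (x1 ^+ 2 + x2 ^+ 2 + (x3 ^+ 2 + x4 ^+ 2)) -
    ((Re (A 0 0) * x1 - Im (A 0 0) * x2 + (Re (A 0 1) * x3 - Im (A 0 1) * x4)) ^+ 2 +
     (Re (A 0 0) * x2 + Im (A 0 0) * x1 + (Re (A 0 1) * x4 + Im (A 0 1) * x3)) ^+ 2 +
     ((Re (A 1 0) * x1 - Im (A 1 0) * x2 + (Re (A 1 1) * x3 - Im (A 1 1) * x4)) ^+ 2 +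
     (Re (A 1 0) * x2 + Im (A 1 0) * x1 + (Re (A 1 1) * x4 + Im (A 1 1) * x3)) ^+ 2)).
  by rewrite /h /esq !I2_sum !mulmx_col2 !cReD !cImD !cReM !cImM /vec4 !mxE /=.
have h0 (q : rat * rat * (rat * rat)) : 0 <= h (ratr q.1.1, ratr q.1.2, (ratr q.2.1, ratr q.2.2)).
  by have := hn (pickle q); rewrite /ratvec pickleK /h subr_ge0.
have st1 x1 (q2 q3 q4 : rat) : 0 <= h (x1, ratr q2, (ratr q3, ratr q4)).
  apply: (@rat_continuous_ge0 (fun x => h (x, ratr q2, (ratr q3, ratr q4)))) => [|q].
    by apply: derivable_cont => x; under eq_fun do rewrite hE; exact: ex_derive.
  exact: (h0 (q, q2, (q3, q4))).
have st2 x1 x2 (q3 q4 : rat) : 0 <= h (x1, x2, (ratr q3, ratr q4)).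
  apply: (@rat_continuous_ge0 (fun x => h (x1, x, (ratr q3, ratr q4)))) => [|q]; last exact: st1.
  by apply: derivable_cont => x; under eq_fun do rewrite hE; exact: ex_derive.
have st3 x1 x2 x3 (q4 : rat) : 0 <= h (x1, x2, (x3, ratr q4)).
  apply: (@rat_continuous_ge0 (fun x => h (x1, x2, (x, ratr q4)))) => [|q]; last exact: st2.
  by apply: derivable_cont => x; under eq_fun do rewrite hE; exact: ex_derive.
have st4 x1 x2 x3 x4 : 0 <= h (x1, x2, (x3, x4)).
  apply: (@rat_continuous_ge0 (fun x => h (x1, x2, (x3, x)))) => [|q]; last exact: st3.
  by apply: derivable_cont => x; under eq_fun do rewrite hE; exact: ex_derive.
have := st4 (Re (v 0 0)) (Im (v 0 0)) (Re (v 1 0)) (Im (v 1 0)).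
rewrite /h subr_ge0; suff -> : vec4 (Re (v 0 0), Im (v 0 0), (Re (v 1 0), Im (v 1 0))) = v by [].
apply/colP => i; rewrite mxE /=; case: ifPn => [/eqP ->|i0]; first by case: (v 0 0).
have -> : i = 1 by apply: val_inj; case: i i0 => [[|[|]]].
by case: (v 1 0).
Qed.

(** When [ratvec n] is the zero vector the quotient is 0, which does not affect the supremum. *)
Let ratio A n : R := esq (A *m ratvec n) / esq (ratvec n).

Let esq_le_opnorm A v : esq (A *m v) <= opnorm A ^+ 2 * esq v.
Proof.
have [v0|v0] := leP (esq v) 0.
  have z j : v j 0 = 0.
    have : Re (v j 0) ^+ 2 + Im (v j 0) ^+ 2 <= 0.
      apply: le_trans v0; rewrite /esq (bigD1 j)//= lerDl.
      by apply: sumr_ge0 => i _; rewrite addr_ge0 ?sqr_ge0.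
    have h1 := sqr_ge0 (Re (v j 0)); have h2 := sqr_ge0 (Im (v j 0)) => h3.
    by apply: complex_eq => /=; apply/eqP; rewrite -sqrf_eq0 eq_le; apply/andP; split; lra.
  have -> : v = 0 by apply/colP => j; rewrite z mxE.
  by rewrite mulmx0 {1}/esq big1 ?mulr_ge0 ?exprn_ge0 ?opnorm_ge0 ?esq_ge0// => i _; rewrite mxE expr0n addr0.
have esqZ (c : R) u : esq (c%:C *: u) = c ^+ 2 * esq u.
  rewrite /esq mulr_sumr; apply: eq_bigr => i _.
  by rewrite mxE cReM cImM /= !mul0r subr0 addr0 !exprMn mulrDr.
pose c := (Num.sqrt (esq v))^-1.
have c2 : c ^+ 2 = (esq v)^-1 by rewrite /c exprVn sqr_sqrtr// ltW.
have := @enorm_le_opnorm A (c%:C *: v); rewrite enorm_le ?ler01// esqZ c2 mulVf ?gt_eqF//.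
rewrite expr1n lexx => /(_ erefl); rewrite enorm_le ?opnorm_ge0// -scalemxAr esqZ c2.
by rewrite mulrC ler_pdivrMr.
Qed.

Lemma opnorm_sqr_sup A : opnorm A ^+ 2 = sups (ratio A) 0.
Proof.
have rE : sups (ratio A) 0 = sup (range (ratio A)).
  by rewrite /sups /=; congr (sup _); apply/seteqP; split => _ [n _ <-]; exists n.
have rle n : ratio A n <= opnorm A ^+ 2.
  rewrite /ratio; have [v0|v0] := ltP 0 (esq (ratvec n)).
    by rewrite ler_pdivrMr//; exact: esq_le_opnorm.
  have -> : esq (ratvec n) = 0 by apply/eqP; rewrite eq_le v0 esq_ge0.
  by rewrite invr0 mulr0 sqr_ge0.
have ub : has_ubound (range (ratio A)) by exists (opnorm A ^+ 2) => _ [n _ <-].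
rewrite rE; set s := sup _; have rs n : ratio A n <= s by apply: ub_le_sup => //; exists n.
have s0 : 0 <= s by apply: le_trans (rs 0%N); rewrite divr_ge0 ?esq_ge0.
apply/eqP; rewrite eq_le; apply/andP; split; last first.
  by apply: ge_sup => [|_ [n _ <-] //]; exists (ratio A 0), 0%N.
rewrite -(sqr_sqrtr s0) ler_pXn2r ?nnegrE ?opnorm_ge0 ?sqrtr_ge0//.
apply: opnorm_le => v; rewrite !enorm_le ?sqrtr_ge0// sqr_sqrtr// expr1n => hv.
apply: (@le_trans _ _ (s * esq v)); last by rewrite ler_piMr.
apply: esq_density => n; have [v0|v0] := ltP 0 (esq (ratvec n)).
  by rewrite -ler_pdivrMr//; exact: rs.
apply: (le_trans (esq_le_opnorm _ _)).
have -> : esq (ratvec n) = 0 by apply/eqP; rewrite eq_le v0 esq_ge0.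
by rewrite !mulr0.
Qed.

Lemma measurable_opnorm_sqr (D : set R) (f : R -> M2) : measurable D ->
  componentwise (fun g => measurable_fun D g) f ->
  measurable_fun D (fun t => opnorm (f t) ^+ 2).
Proof.
move=> mD mf; under eq_fun do rewrite opnorm_sqr_sup.
apply: (measurable_fun_sups (h := fun n t => ratio (f t) n)) => //.
  move=> t _; exists (opnorm (f t) ^+ 2) => _ [n _ <-] /=.
  rewrite /ratio; have [v0|v0] := ltP 0 (esq (ratvec n)).
    by rewrite ler_pdivrMr//; exact: esq_le_opnorm.
  have -> : esq (ratvec n) = 0 by apply/eqP; rewrite eq_le v0 esq_ge0.
  by rewrite invr0 mulr0 sqr_ge0.
move=> n; rewrite /ratio; apply: measurable_funM; last exact: measurable_cst.
have m i j : measurable_fun D (fun t => Re (f t i j)) /\ measurable_fun D (fun t => Im (f t i j)).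
  exact: mf.
have mc (c : R) (g : R -> R) : measurable_fun D g -> measurable_fun D (fun t => g t * c).
  by move=> mg; apply: measurable_funM => //; exact: measurable_cst.
have [r1 i1] := m 0 0; have [r2 i2] := m 0 1; have [r3 i3] := m 1 0; have [r4 i4] := m 1 1.
under eq_fun do rewrite /esq I2_sum !mulmx_col2 !cReD !cImD !cReM !cImM.
by apply: measurable_funD; apply: measurable_funD; apply: measurable_funX;
  apply: measurable_funD; (apply: measurable_funB || apply: measurable_funD); apply: mc.
Qed.

End OperatorNorm.

Section MatrixL2.
Variable R : realType.
Local Notation Re := (@complex.Re R).
Local Notation Im := (@complex.Im R).
Local Notation M2 := 'M[R[i]]_2.
Implicit Types (c d : R) (f : R -> M2).

Lemma in_L2_inL2 c d f : in_L2 c d f -> componentwise (inL2 c d) f.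
Proof.
move=> [mf hf] i j; have h := intg_oo hf.
have [m1 m2] := mf i j.
have m1' : measurable_fun `[c, d] (fun t => Re (f t i j)) by exact: measurable_fun_itv_cc m1.
have m2' : measurable_fun `[c, d] (fun t => Im (f t i j)) by exact: measurable_fun_itv_cc m2.
have [] : (forall t, `|Re (f t i j) ^+ 2| <= opnorm (f t) ^+ 2) /\
          (forall t, `|Im (f t i j) ^+ 2| <= opnorm (f t) ^+ 2).
  by split => t; have [h1 h2] := opnorm_entry (f t) i j;
    rewrite normrX lerXn2r ?nnegrE ?opnorm_ge0.
move=> b1 b2; split; split => //; apply: intg_le h _ => //; exact: measurable_funX.
Qed.

Lemma inL2_norm c d (g : R -> R) : inL2 c d g -> inL2 c d (fun t => `|g t|).
Proof.
move=> [mg hg]; split; first exact: measurableT_comp.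
by under eq_fun do rewrite real_normK ?num_real//.
Qed.

Lemma inL2_opnorm c d f : componentwise (inL2 c d) f ->
  intg c d (fun t => opnorm (f t) ^+ 2) /\
  intg c d (fun t => (2 * \sum_i \sum_j cl1 (f t i j)) ^+ 2).
Proof.
move=> hf; have hS : inL2 c d (fun t => 2 * \sum_i \sum_j cl1 (f t i j)).
  apply: inL2Z; apply: inL2_sum => i; apply: inL2_sum => j; have [h1 h2] := hf i j.
  by apply: inL2D; exact: inL2_norm.
split; last by case: hS.
apply: (intg_le _ (proj2 hS)) => [|t _].
  by apply: measurable_opnorm_sqr => // i j; have [[] ? ? []] := hf i j.
by rewrite normrX ger0_norm ?opnorm_ge0// lerXn2r ?nnegrE ?opnorm_ge0 ?opnorm_le_cl1//
  (le_trans (opnorm_ge0 (f t)))// opnorm_le_cl1.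
Qed.

Lemma inL2_in_L2 c d f : componentwise (inL2 c d) f -> in_L2 c d f.
Proof.
have sub : `]c, d[ `<=` `[c, d] by apply: subset_itv; rewrite bnd_simp.
move=> hf; split.
  by move=> i j; have [[m1 _] [m2 _]] := hf i j; split; [apply: measurable_funS m1|apply: measurable_funS m2].
by apply: integrableS (proj1 (inL2_opnorm hf)).
Qed.

Lemma n2_le_L2norm c d f i j : in_L2 c d f ->
  n2 c d (fun t => Re (f t i j)) <= L2norm c d f /\
  n2 c d (fun t => Im (f t i j)) <= L2norm c d f.
Proof.
move=> hf; have h := intg_oo (proj2 hf).
have [[_ h1] [_ h2]] := in_L2_inL2 hf i j.
rewrite /L2norm Int_oo//; split; apply: ler_wsqrtr; apply: le_Int => // t _;
  have [e1 e2] := opnorm_entry (f t) i j;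
  by rewrite -[X in X <= _](real_normK (num_real _)) lerXn2r ?nnegrE ?opnorm_ge0.
Qed.

(** Induction from the top derivative downwards: F (r - k) has k derivatives. Absolute continuity
    and the derivative almost everywhere make each F k a primitive of the next. *)
Lemma sobolev_Reg r c d f : c <= d -> sobolev r c d f -> componentwise (Reg c d r) f.
Proof.
move=> cd [F [F0 ac df top]].
suff H k : (k <= r)%N -> componentwise (Reg c d k) (F (r - k)%N).
  have := H r (leqnn r); rewrite subnn => h i j; have [h1 h2] := h i j.
  split; [apply: eq_Reg h1|apply: eq_Reg h2] => t tcd; rewrite F0// in_itv.
elim: k => [|k ih] kr; first by rewrite subn0; exact: in_L2_inL2.
have e : (r - k = (r - k.+1).+1)%N by rewrite subnSK.
have lt : (r - k.+1 < r)%N by rewrite ltn_subrL (leq_ltn_trans _ kr).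
move=> i j; have [h1 h2] := ih (ltnW kr) i j; rewrite e in h1 h2.
have [a1 a2] := ac _ lt i j; have hd := df _ lt.
have FF : Filter (nbhs (almost_everywhere (@lebesgue_measure R))).
  exact: (ae_filter_ringOfSetsType (@lebesgue_measure R)).
split.
  exists (fun t => Re (F (r - k.+1).+1 t i j)) => //.
  apply: abs_continuous_dens => //; last exact: inL2_intg (Reg_inL2 cd h1).
  by apply: filterS hd => t ht tcd; have [] := ht tcd i j.
exists (fun t => Im (F (r - k.+1).+1 t i j)) => //.
apply: abs_continuous_dens => //; last exact: inL2_intg (Reg_inL2 cd h2).
by apply: filterS hd => t ht tcd; have [] := ht tcd i j.
Qed.

Lemma mx_intE c d f : (forall i j, cintg c d (fun t => f t i j)) ->
  mx_int c d f = \matrix_(i, j) Cint c d (fun t => f t i j).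
Proof.
by move=> hf; apply/matrixP => i j; have [h1 h2] := hf i j; rewrite !mxE /Cint -!Int_oo.
Qed.

End MatrixL2.

(** * The complex Goursat problem as a real one *)

Section ComplexRegularity.
Variable R : realType.
Local Notation Re := (@complex.Re R).
Local Notation Im := (@complex.Im R).
Implicit Types (a b c d x : R) (f g : R -> R[i]).

Definition cReg a b m f := Reg a b m (fun t => Re (f t)) /\ Reg a b m (fun t => Im (f t)).

Lemma cRegD a b m f g : cReg a b m f -> cReg a b m g -> cReg a b m (fun t => f t + g t).
Proof.
move=> [f1 f2] [g1 g2]; split.
  by under eq_fun do rewrite cReD; exact: RegD.
by under eq_fun do rewrite cImD; exact: (RegD f2 g2).
Qed.

Lemma cRegZ a b m (k : R[i]) f : cReg a b m f -> cReg a b m (fun t => k * f t).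
Proof.
move=> [f1 f2]; split.
  by under eq_fun do rewrite cReM; exact: (RegB (RegZ _ f1) (RegZ _ f2)).
by under eq_fun do rewrite cImM; exact: (RegD (RegZ _ f2) (RegZ _ f1)).
Qed.

Lemma eq_cReg a b m f g : (forall t, a <= t <= b -> f t = g t) ->
  cReg a b m f -> cReg a b m g.
Proof.
by move=> fg [f1 f2]; split; [apply: eq_Reg f1|apply: eq_Reg f2] => t /fg ->.
Qed.

Lemma cReg_ccont_clamp a b m f : a <= b -> cReg a b m.+1 f -> ccont (fun t => f (clamp a b t)).
Proof.
move=> ab [/Reg_within f1 /Reg_within f2]; split.
  exact: (continuous_clamp ab f1).
exact: (continuous_clamp ab f2).
Qed.

(** Entry (p, q) of the real matrix of multiplication by z, where [true] stands for the imaginary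
    part. *)
Let cmul_part (z : R[i]) (p q : bool) : R :=
  if p then (if q then Re z else Im z) else (if q then - Im z else Re z).
Let cpart (p : bool) (z : R[i]) : R := if p then Im z else Re z.

Lemma complex_goursat_Reg b m (a c : R -> R[i]) (f1 f2 : R * R -> R[i]) x :
  0 <= b -> ccont a -> ccont c -> cReg 0 b m.+1 a -> cReg 0 b m.+1 c ->
  ccont f1 -> ccont f2 ->
  (forall u v, 0 <= u -> 0 <= v -> u + v <= b ->
    f1 (u, v) = Cint 0 v (fun s => a (u + s) * f2 (s, u)) /\
    f2 (u, v) = c u / 2 + Cint 0 v (fun s => c (u + s) * f1 (s, u))) ->
  0 <= x <= b ->
  cReg 0 x m.+1 (fun w => f1 (w, x - w)) /\ cReg 0 x m.+1 (fun w => f2 (w, x - w)).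
Proof.
move=> b0 [ca1 ca2] [cc1 cc2] [ra1 ra2] [rc1 rc2] [c11 c12] [c21 c22] e xb.
(* An index is a pair: f1 or f2, real or imaginary part. *)
pose A (i j : bool * bool) (t : R) : R :=
  if i.1 == j.1 then 0 else cmul_part (if i.1 then c t else a t) i.2 j.2.
pose g (i : bool * bool) (t : R) : R := if i.1 then 2^-1 * cpart i.2 (c t) else 0.
pose F (i : bool * bool) (z : R * R) : R := cpart i.2 (if i.1 then f2 z else f1 z).
have cmN (k : R -> R) : continuous k -> continuous (fun t => - k t).
  by move=> ck t; apply: cvgN; exact: ck.
have cA i j : continuous (A i j).
  case: i j => [i p] [j q]; rewrite /A /=; case: eqP => _; first by move=> t; exact: cvg_cst.
  by case: i; case: p; case: q => //=; exact: cmN.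
have rA i j : Reg 0 b m.+1 (A i j).
  move: (m.+1) ra1 ra2 rc1 rc2 => n ra1 ra2 rc1 rc2.
  case: i j => [i p] [j q]; rewrite /A /=; case: eqP => _; first exact: Reg_cst.
  by case: i; case: p; case: q => //=; exact: RegN.
have rg i : Reg 0 b m.+1 (g i).
  move: (m.+1) rc1 rc2 => n rc1 rc2.
  by case: i => [[] []]; rewrite /g /=; [exact: RegZ|exact: RegZ|exact: Reg_cst|exact: Reg_cst].
have cF i : continuous (F i) by case: i => [[] []].
have gF : goursat b A g F.
  move=> [i p] u v u0 v0 uv; have [e1 e2] := e u v u0 v0 uv.
  have sum_bool (G : bool * bool -> R) :
      \sum_j G j = G (true, true) + G (true, false) + (G (false, true) + G (false, false)).
    rewrite (eq_bigr (fun j => G (j.1, j.2))); last by case.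
    by rewrite -(pair_bigA _ (fun i j => G (i, j))) /= big_bool !big_bool.
  under eq_Int do rewrite sum_bool.
  case: i; case: p; rewrite /F /g /A /= ?e1 ?e2 ?cReD ?cImD ?cReM ?cImM /=.
  - congr (_ + _); first by field.
    by apply: eq_Int => s _; rewrite cImM; ring.
  - congr (_ + _); first by field.
    by apply: eq_Int => s _; rewrite cReM; ring.
  - by rewrite add0r; apply: eq_Int => s _; rewrite cImM; ring.
  - by rewrite add0r; apply: eq_Int => s _; rewrite cReM; ring.
have H i := goursat_Reg b0 cA rA rg cF gF i xb.
by split; split; [exact: (H (false, false))|exact: (H (false, true))|
  exact: (H (true, false))|exact: (H (true, true))].
Qed.

End ComplexRegularity.

(** * The transmutation kernel *)

Lemma mulmx2E (T : comPzRingType) (A B : 'M[T]_2) i j :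
  (A *m B) i j = A i 0 * B 0 j + A i 1 * B 1 j.
Proof. by rewrite mxE I2_sum. Qed.

Lemma ccont_U0 (R : realType) (lam : R[i]) i j : ccont (fun t => U0 lam t i j).
Proof.
have cE : ccont (fun t : R => cexp ('i%C * (lam * t%:C))).
  by under eq_fun do rewrite mulrA; exact: ccont_cexp.
have cE' : ccont (fun t : R => cexp (- ('i%C * (lam * t%:C)))).
  by under eq_fun do rewrite mulrA -mulNr; exact: ccont_cexp.
have cc : ccont (fun t : R => ccos (lam * t%:C)).
  by apply: ccontM; [exact: ccontD|exact: ccont_cst].
have cs : ccont (fun t : R => csin (lam * t%:C)).
  by apply: ccontM; [apply: ccontD => //; exact: ccontN|exact: ccont_cst].
under eq_fun do rewrite mxE; case: (i == 0); case: (j == 0) => //.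
exact: ccontN.
Qed.

Section TransmutationKernel.
Variables (R : realType) (b : R) (p1 q1 : R -> R[i]) (p : nat).
Variables (U : R[i] -> R -> 'M[R[i]]_2) (K : R -> R -> 'M[R[i]]_2).
Hypothesis b0 : 0 < b.
Hypothesis sobQ : sobolev p.+1 0 b (Qmx p1 q1).
Hypothesis solU : is_dirac_solution b (Qmx p1 q1) U.
Hypothesis kerK : is_transmutation_kernel b U K.
Local Notation Re := (@complex.Re R).
Local Notation Im := (@complex.Im R).

Let b0' : 0 <= b. Proof. exact: ltW. Qed.

Let creg : cReg 0 b p.+1 p1 /\ cReg 0 b p.+1 q1.
Proof.
have h := sobolev_Reg b0' sobQ; split.
  have [h1 h2] := h 0 0; split.
    by apply: eq_Reg h1 => t _; rewrite mxE.
  by apply: eq_Reg h2 => t _; rewrite mxE.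
have [h1 h2] := h 0 1; split.
  by apply: eq_Reg h1 => t _; rewrite mxE.
by apply: eq_Reg h2 => t _; rewrite mxE.
Qed.

Let pe t := p1 (clamp 0 b t).
Let qe t := q1 (clamp 0 b t).

Let ccpe : ccont pe. Proof. exact: (cReg_ccont_clamp b0' (proj1 creg)). Qed.
Let ccqe : ccont qe. Proof. exact: (cReg_ccont_clamp b0' (proj2 creg)). Qed.
Let crpe : cReg 0 b p.+1 pe.
Proof. by apply: eq_cReg (proj1 creg) => t tb; rewrite /pe clamp_id. Qed.
Let crqe : cReg 0 b p.+1 qe.
Proof. by apply: eq_cReg (proj2 creg) => t tb; rewrite /qe clamp_id. Qed.

(** K is continuous on the triangle |t| <= x <= b only; projecting onto it first in x and then in t
    gives a continuous function on the plane, as the Goursat part requires. *)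
Definition kernel_ext (z : R * R) : 'M[R[i]]_2 :=
  let x := clamp 0 b z.1 in K x (clamp (- x) x z.2).

Lemma kernel_extE x t : 0 <= x <= b -> - x <= t <= x -> kernel_ext (x, t) = K x t.
Proof. by move=> xb tx; rewrite /kernel_ext /= !clamp_id. Qed.

Lemma ccont_kernel_ext i j : ccont (fun z => kernel_ext z i j).
Proof.
have [cK _] := kerK; have [c1 c2] := cK i j.
pose X (z : R * R) := clamp 0 b z.1.
have cX : continuous X.
  move=> z; apply: (@continuous_comp _ _ _ fst (clamp 0 b)); first exact: fst_cont.
  exact: clamp_continuous.
have cm : continuous (fun z : R * R => (X z, clamp (- X z) (X z) z.2)).
  have cY : continuous (fun z : R * R => clamp (- X z) (X z) z.2).
    move=> z; apply: (@continuous_max R _ (fun z : R * R => - X z) (fun z : R * R => Num.min z.2 (X z))).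
      by apply: cvgN; exact: cX.
    apply: (@continuous_min R _ (fun z : R * R => z.2) X); first exact: snd_cont.
    exact: cX.
  by move=> z; exact: (cvg_pair (cX z) (cY z)).
have inO z : [set z : R * R | 0 <= z.1 <= b /\ `|z.2| <= z.1] (X z, clamp (- X z) (X z) z.2).
  have h := clamp_itv z.1 b0'; split => //=; rewrite ler_norml; apply: clamp_itv.
  by rewrite /X; case/andP: h => h _; lra.
by split; [exact: (within_continuous_comp c1 cm inO)|exact: (within_continuous_comp c2 cm inO)].
Qed.

(* The combinations L1 and L2 of the entries of U satisfy a Zakharov-Shabat system
   for e = 'i and for e = - 'i; K is recovered from the two kernels. *)
Section Sign.
Variable s : R.
Hypothesis s1 : s = 1 \/ s = -1.
Let e : R[i] := 'i%C * s%:C.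

Let ee : e * e = -1.
Proof.
rewrite /e; case: s1 => ->; first by rewrite mulr1 -expr2 sqr_i.
by rewrite rmorphN mulrN1 mulrNN -expr2 sqr_i.
Qed.

Let es : e * s%:C = 'i%C.
Proof.
rewrite /e -mulrA; case: s1 => ->; first by rewrite !mulr1.
by rewrite rmorphN mulrNN !mulr1.
Qed.

Let k1 z : R[i] := 2^-1 * (kernel_ext z 0 0 + kernel_ext z 1 1 + e * (kernel_ext z 0 1 - kernel_ext z 1 0)).
Let k2 z : R[i] := 2^-1 * (kernel_ext z 0 0 - kernel_ext z 1 1 + e * (kernel_ext z 0 1 + kernel_ext z 1 0)).
(** At (w, x - w) this is k1 at t = x - 2w, while [f2] is k2 at t = 2w - x. The phase cis (-lam t)
    then splits into cis (-lam x) cis (2 lam w) for f1 and cis (lam x) cis (-2 lam w) for f2, as in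
    [tr1] and [tr2]. *)
Let f1 (z : R * R) := k1 (z.1 + z.2, z.2 - z.1).
Let f2 (z : R * R) := k2 (z.1 + z.2, z.1 - z.2).

Let ck1 : ccont k1.
Proof.
have h := ccont_kernel_ext; apply: ccontM; first exact: ccont_cst.
apply: ccontD; first exact: ccontD.
by apply: ccontM; [exact: ccont_cst|apply: ccontD => //; exact: ccontN].
Qed.

Let ck2 : ccont k2.
Proof.
have h := ccont_kernel_ext; apply: ccontM; first exact: ccont_cst.
apply: ccontD; first by apply: ccontD => //; exact: ccontN.
by apply: ccontM; [exact: ccont_cst|exact: ccontD].
Qed.

Let cf1 : ccont f1.
Proof.
apply: (@ccont2_comp _ _ k1 (fun z : R * R => z.1 + z.2) (fun z : R * R => z.2 - z.1)) => // z.
  by apply: cvgD; [exact: fst_cont|exact: snd_cont].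
by apply: cvgB; [exact: snd_cont|exact: fst_cont].
Qed.

Let cf2 : ccont f2.
Proof.
apply: (@ccont2_comp _ _ k2 (fun z : R * R => z.1 + z.2) (fun z : R * R => z.1 - z.2)) => // z.
  by apply: cvgD; [exact: fst_cont|exact: snd_cont].
by apply: cvgB; [exact: fst_cont|exact: snd_cont].
Qed.

(** With the sign s in the spectral parameter, e mu(lam) = i lam for both signs, so that both
    systems take the same form. *)
Let mu (lam : R) : R[i] := (s * lam)%:C.
(** As e^2 = -1, the column (1, e) is an eigenvector of B and of U0. [L1 M] is half of (1, -e) M (1,
    e)^T and [L2 M] half of (1, e) M (1, e)^T, which is why [L1] of U0 is a pure phase and [L2] of
    U0 vanishes. *)
Let L1 (M : 'M[R[i]]_2) : R[i] := 2^-1 * (M 0 0 + e * M 0 1 + (- e) * M 1 0 + M 1 1).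
Let L2 (M : 'M[R[i]]_2) : R[i] := 2^-1 * (M 0 0 + e * M 0 1 + e * M 1 0 + (- 1) * M 1 1).
Let Ue lam x : 'M[R[i]]_2 := U (mu lam) (clamp 0 b x).
Let u1 lam x := L1 (Ue lam x).
Let u2 lam x := L2 (Ue lam x).

Let cUe lam i j : ccont (fun x => Ue lam x i j).
Proof.
have [_ cU _] := solU (mu lam); have [c1 c2] := cU i j.
by split; [exact: (continuous_clamp b0' c1)|exact: (continuous_clamp b0' c2)].
Qed.

Let ccontL (F : R -> 'M[R[i]]_2) (c0 c1 c2 c3 : R[i]) : (forall i j, ccont (fun x => F x i j)) ->
  ccont (fun x => c0 * (F x 0 0 + c1 * F x 0 1 + c2 * F x 1 0 + c3 * F x 1 1)).
Proof.
move=> h; apply: ccontM; first exact: ccont_cst.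
by apply: ccontD; [apply: ccontD; [apply: ccontD => //|]|]; apply: ccontM => //; exact: ccont_cst.
Qed.

Let cu1 lam : ccont (u1 lam).
Proof.
have := @ccontL (Ue lam) 2^-1 e (- e) 1 (@cUe lam).
by under eq_fun do rewrite mul1r.
Qed.

Let cu2 lam : ccont (u2 lam).
Proof. exact: (@ccontL (Ue lam) 2^-1 e e (-1) (@cUe lam)). Qed.

Let u10 lam : u1 lam 0 = 1.
Proof.
have [U1 _ _] := solU (mu lam).
rewrite /u1 /L1 /Ue clamp_id ?lexx// U1 !mxE /= !mulr0 !addr0.
by rewrite -mulr2n -[X in X *+ 2]/(1%:R) -mulr_natr mul1r mulVf// pnatr_eq0.
Qed.

Let u20 lam : u2 lam 0 = 0.
Proof.
have [U1 _ _] := solU (mu lam).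
by rewrite /u2 /L2 /Ue clamp_id ?lexx// U1 !mxE /= !mulr0 !addr0 mulr1 subrr mulr0.
Qed.

Let dUe lam x : 0 < x < b -> forall i j,
  cder x (fun t => Ue lam t i j)
   ((if i == 0 then qe x * Ue lam x 0 j - pe x * Ue lam x 1 j - mu lam * Ue lam x 1 j
     else mu lam * Ue lam x 0 j - pe x * Ue lam x 0 j - qe x * Ue lam x 1 j)).
Proof.
move=> xb i j; have [_ _ dU] := solU (mu lam).
have xb' : 0 <= x <= b by case/andP: xb => h1 h2; rewrite !ltW.
have /dU[D hD eD] : x \in `]0, b[ by rewrite in_itv.
have [d1 d2] := hD i j.
have nr : \forall t \near x, clamp 0 b t = t.
  have : \forall t \near x, t \in `]0, b[ by apply: near_in_itvoo; rewrite in_itv.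
  by apply: filterS => t; rewrite in_itv /= => /andP[h1 h2]; rewrite clamp_id// !ltW.
have -> : (if i == 0 then qe x * Ue lam x 0 j - pe x * Ue lam x 1 j - mu lam * Ue lam x 1 j
     else mu lam * Ue lam x 0 j - pe x * Ue lam x 0 j - qe x * Ue lam x 1 j) = D i j.
  rewrite /Ue /pe /qe clamp_id//.
  have := congr1 (fun M : 'M[R[i]]_2 => M 0 j) eD; have := congr1 (fun M : 'M[R[i]]_2 => M 1 j) eD.
  rewrite !mxE !I2_sum !mxE /= ; rewrite ?(mul0r, mul1r, add0r, addr0) => e1 e2.
  case: ifPn => [/eqP ->|i0].
    by rewrite -e1; ring.
  have -> : i = 1 by apply: val_inj; case: i i0 {d1 d2} => [[|[|]]].
  by rewrite -e2; ring.
split.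
  apply: near_eq_is_derive d1; near=> t; rewrite /Ue; congr (Re (U _ _ _ _)).
  by symmetry; near: t.
apply: near_eq_is_derive d2; near=> t; rewrite /Ue; congr (Im (U _ _ _ _)).
by symmetry; near: t.
Unshelve. all: by end_near. Qed.

Let cderL lam (c0 c1 c2 c3 : R[i]) x (D : 'M[R[i]]_2) :
  (forall i j, cder x (fun t => Ue lam t i j) (D i j)) ->
  cder x (fun x => c0 * (Ue lam x 0 0 + c1 * Ue lam x 0 1 + c2 * Ue lam x 1 0 + c3 * Ue lam x 1 1))
    (c0 * (D 0 0 + c1 * D 0 1 + c2 * D 1 0 + c3 * D 1 1)).
Proof.
move=> h; apply: cderZ; apply: cderD; last exact: cderZ.
by apply: cderD; [apply: cderD => //|]; exact: cderZ.
Qed.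

Let du1 lam x : 0 < x < b ->
  cder x (u1 lam) (- ('i%C * lam%:C) * u1 lam x + (qe x + e * pe x) * u2 lam x).
Proof.
move=> xb; have h := dUe lam xb.
pose D : 'M[R[i]]_2 := \matrix_(i, j) (if i == 0 then qe x * Ue lam x 0 j - pe x * Ue lam x 1 j - mu lam * Ue lam x 1 j
     else mu lam * Ue lam x 0 j - pe x * Ue lam x 0 j - qe x * Ue lam x 1 j).
have hD i j : cder x (fun t => Ue lam t i j) (D i j) by rewrite mxE; exact: h.
have := @cderL lam 2^-1 e (-e) 1 x D hD.
under eq_fun do rewrite mul1r; rewrite -/(u1 lam).
suff -> : 2^-1 * (D 0 0 + e * D 0 1 + - e * D 1 0 + 1 * D 1 1) =
  - ('i%C * lam%:C) * u1 lam x + (qe x + e * pe x) * u2 lam x by [].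
have -> : 'i%C * lam%:C = e * mu lam by rewrite /mu rmorphM mulrA es.
rewrite /u1 /u2 /L1 /L2 !mxE /=.
move: (Ue lam x 0 0) (Ue lam x 0 1) (Ue lam x 1 0) (Ue lam x 1 1) (mu lam) (qe x) (pe x) => x1 x2 x3 x4 m q p'.
(* The two sides differ by a multiple of 1 + e e, which is 0. *)
transitivity (- (e * m) * (2^-1 * (x1 + e * x2 + - e * x3 + x4)) +
   (q + e * p') * (2^-1 * (x1 + e * x2 + e * x3 + -1 * x4)) +
   2^-1 * (1 + e * e) * (m * x2 - m * x3 - p' * x2 - p' * x3)); first by ring.
by rewrite ee subrr !(mulr0, mul0r) addr0.
Qed.

Let du2 lam x : 0 < x < b ->
  cder x (u2 lam) ('i%C * lam%:C * u2 lam x + (qe x - e * pe x) * u1 lam x).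
Proof.
move=> xb; have h := dUe lam xb.
pose D : 'M[R[i]]_2 := \matrix_(i, j) (if i == 0 then qe x * Ue lam x 0 j - pe x * Ue lam x 1 j - mu lam * Ue lam x 1 j
     else mu lam * Ue lam x 0 j - pe x * Ue lam x 0 j - qe x * Ue lam x 1 j).
have hD i j : cder x (fun t => Ue lam t i j) (D i j) by rewrite mxE; exact: h.
have := @cderL lam 2^-1 e e (-1) x D hD; rewrite -/(u2 lam).
suff -> : 2^-1 * (D 0 0 + e * D 0 1 + e * D 1 0 + -1 * D 1 1) =
  'i%C * lam%:C * u2 lam x + (qe x - e * pe x) * u1 lam x by [].
have -> : 'i%C * lam%:C = e * mu lam by rewrite /mu rmorphM mulrA es.
rewrite /u1 /u2 /L1 /L2 !mxE /=.
move: (Ue lam x 0 0) (Ue lam x 0 1) (Ue lam x 1 0) (Ue lam x 1 1) (mu lam) (qe x) (pe x) => x1 x2 x3 x4 m q p'.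
transitivity (e * m * (2^-1 * (x1 + e * x2 + e * x3 + -1 * x4)) +
   (q - e * p') * (2^-1 * (x1 + e * x2 + - e * x3 + x4)) -
   2^-1 * (1 + e * e) * (m * x2 + m * x3 - p' * x2 + p' * x3)); first by ring.
by rewrite ee subrr !(mulr0, mul0r) subr0.
Qed.

Let trig lam t : ccos (mu lam * t%:C) - e * csin (mu lam * t%:C) = cis (- (lam * t)).
Proof.
have E (y : R) : cexp ('i%C * y%:C) = cis y.
  by rewrite cexpE /= mul0r expR0 mul1r mul1r.
have Z (z : R[i]) : ccos z + 'i%C * csin z = cexp ('i%C * z) /\ ccos z - 'i%C * csin z = cexp (- ('i%C * z)).
  have i0 : 'i%C != 0 :> R[i] by rewrite neq0Ci.
  by rewrite /ccos /csin; split; field; rewrite i0.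
rewrite /mu -rmorphM /= /e; case: s1 => ->.
  by rewrite mulr1 mul1r (proj2 (Z _)) -mulrN -rmorphN E.
by rewrite rmorphN mulrN1 [in X in _ - X]mulNr opprK (proj1 (Z _)) E mulN1r mulNr.
Qed.

Let L1U0 lam t : L1 (U0 (mu lam) t) = cis (- (lam * t)).
Proof. by rewrite -trig /L1 /U0 !mxE /=; field. Qed.

Let L2U0 lam t : L2 (U0 (mu lam) t) = 0.
Proof. by rewrite /L2 /U0 !mxE /=; field. Qed.

Let L1M lam t (M : 'M[R[i]]_2) : L1 (M *m U0 (mu lam) t) =
  2^-1 * (M 0 0 + M 1 1 + e * (M 0 1 - M 1 0)) * cis (- (lam * t)).
Proof.
rewrite -trig /L1 /U0 !mxE !I2_sum !mxE /=.
move: (ccos _) (csin _) (M 0 0) (M 0 1) (M 1 0) (M 1 1) => C S m1 m2 m3 m4.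
transitivity (2^-1 * (m1 + m4 + e * (m2 - m3)) * (C - e * S) + 2^-1 * (1 + e * e) * (S * (m2 - m3))).
  by ring.
by rewrite ee subrr mulr0 mul0r addr0.
Qed.

Let L2M lam t (M : 'M[R[i]]_2) : L2 (M *m U0 (mu lam) t) =
  2^-1 * (M 0 0 - M 1 1 + e * (M 0 1 + M 1 0)) * cis (- (lam * t)).
Proof.
rewrite -trig /L2 /U0 !mxE !I2_sum !mxE /=.
move: (ccos _) (csin _) (M 0 0) (M 0 1) (M 1 0) (M 1 1) => C S m1 m2 m3 m4.
transitivity (2^-1 * (m1 - m4 + e * (m2 + m3)) * (C - e * S) + 2^-1 * (1 + e * e) * (S * (m2 + m3))).
  by ring.
by rewrite ee subrr mulr0 mul0r addr0.
Qed.

Let cF lam x i j : ccont (fun t => (kernel_ext (x, t) *m U0 (mu lam) t) i j).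
Proof.
have ck k l : ccont (fun t => kernel_ext (x, t) k l).
  apply: (@ccont2_comp _ _ (fun z => kernel_ext z k l) (fun=> x) id) => //.
  - exact: ccont_kernel_ext.
  - by move=> t; exact: cvg_cst.
  - by move=> t; exact: cvg_id.
under eq_fun do rewrite mulmx2E.
by apply: ccontD; apply: ccontM => //; exact: ccont_U0.
Qed.

Let trans lam x : 0 < x <= b ->
  Ue lam x = U0 (mu lam) x + \matrix_(i, j) Cint (- x) x (fun t => (kernel_ext (x, t) *m U0 (mu lam) t) i j).
Proof.
move=> xb; have [_ hU] := kerK; have xb' : 0 <= x <= b by case/andP: xb => h ->; rewrite ltW.
have eqK t : - x <= t <= x -> K x t = kernel_ext (x, t) by move=> tx; rewrite kernel_extE.
have hc i j : cintg (- x) x (fun t => (K x t *m U0 (mu lam) t) i j).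
  have [h1 h2] := ccont_cintg (- x) x (@cF lam x i j).
  by split; [apply: eq_intg h1|apply: eq_intg h2] => t /eqK ->.
rewrite /Ue (clamp_id xb') (hU (mu lam) x xb) (mx_intE hc).
have hE : (\matrix_(i, j) Cint (- x) x (fun t => (K x t *m U0 (mu lam) t) i j)) =
  \matrix_(i, j) Cint (- x) x (fun t => (kernel_ext (x, t) *m U0 (mu lam) t) i j) :> 'M[R[i]]_2.
  apply/matrixP => i j; rewrite [LHS]mxE [RHS]mxE; apply: eq_Cint => t tx.
  by rewrite (eqK t tx).
exact: (congr1 (fun M => U0 (mu lam) x + M) hE).
Qed.

Let L_Cint a d (F : R -> 'M[R[i]]_2) (c0 c1 c2 c3 : R[i]) : (forall i j, ccont (fun x => F x i j)) ->
  c0 * (Cint a d (fun t => F t 0 0) + c1 * Cint a d (fun t => F t 0 1) +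
    c2 * Cint a d (fun t => F t 1 0) + c3 * Cint a d (fun t => F t 1 1)) =
  Cint a d (fun x => c0 * (F x 0 0 + c1 * F x 0 1 + c2 * F x 1 0 + c3 * F x 1 1)).
Proof.
move=> h; have z c i j : ccont (fun x => c * F x i j) by apply: ccontM => //; exact: ccont_cst.
have i i' j' := ccont_cintg a d (h i' j').
have zi c i' j' := ccont_cintg a d (z c i' j').
rewrite CintZ; last by apply: ccont_cintg; do 3 apply: ccontD => //.
rewrite CintD//; last by apply: ccont_cintg; do 2 apply: ccontD => //.
rewrite CintD//; last by apply: ccont_cintg; apply: ccontD.
by rewrite CintD// !CintZ.
Qed.

Let tr1 lam x : 0 < x <= b -> u1 lam x =
  cis (- (lam * x)) * (1 + 2 * Cint 0 x (fun w => f1 (w, x - w) * cis (2 * lam * w))).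
Proof.
move=> xb; have l := @L_Cint (- x) x _ 2^-1 e (- e) 1 (@cF lam x).
have ck : ccont (fun t => k1 (x, t)).
  by apply: (@ccont2_comp _ _ k1 (fun=> x) id) => //; move=> t; (exact: cvg_cst || exact: cvg_id).
have cc : ccont (fun t => k1 (x, t) * cis (- (lam * t))).
  apply: ccontM => //; apply: ccont_cis => t; apply: cvgN; exact: continuous_scale.
rewrite /u1 trans// {1}/L1 !mxE.
transitivity (L1 (U0 (mu lam) x) + Cint (- x) x (fun t => k1 (x, t) * cis (- (lam * t)))).
  rewrite (@eq_Cint _ _ _ (fun t => k1 (x, t) * cis (- (lam * t)))
    (fun t => L1 (kernel_ext (x, t) *m U0 (mu lam) t))); last by move=> t _; rewrite L1M.
  rewrite /L1; under [X in _ = _ + Cint _ _ X]eq_fun do rewrite -[_ 1 1]mul1r.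
  by rewrite -l /U0 !mxE /=; ring.
rewrite L1U0 mulrDr mulr1; congr (_ + _).
rewrite -(Cint_refl 0 (- x) x cc) sub0r opprK add0r.
have cr : ccont (fun t => k1 (x, 0 - t) * cis (- (lam * (0 - t)))).
  by apply: (ccont_comp (h := fun t => 0 - t) (k := fun t => k1 (x, t) * cis (- (lam * t)))) => // t;
    apply: cvgB; [exact: cvg_cst|exact: cvg_id].
have := @Cint_affine R 0 x 2 (- x) _ (ltr0Sn R 1) cr; rewrite mulr0 add0r.
have -> : 2 * x - x = x by ring.
move=> ->; rewrite [RHS]mulrCA (rmorph_nat (@real_complex R)); congr (_ * _).
rewrite -CintZ; last first.
  apply: ccont_cintg; apply: ccontM; last by apply: ccont_cis; exact: continuous_scale.
  apply: (@ccont2_comp _ _ f1 id (fun w => x - w)) => // t; first exact: cvg_id.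
  by apply: cvgB; [exact: cvg_cst|exact: cvg_id].
apply: eq_Cint => w _; rewrite mulrCA -cisD /f1 /=; congr (k1 (_, _) * cis _); ring.
Qed.

Let tr2 lam x : 0 < x <= b -> u2 lam x =
  cis (lam * x) * (2 * Cint 0 x (fun w => f2 (w, x - w) * cis (- (2 * lam * w)))).
Proof.
move=> xb; have l := @L_Cint (- x) x _ 2^-1 e e (-1) (@cF lam x).
have ck : ccont (fun t => k2 (x, t)).
  by apply: (@ccont2_comp _ _ k2 (fun=> x) id) => //; move=> t; (exact: cvg_cst || exact: cvg_id).
have cc : ccont (fun t => k2 (x, t) * cis (- (lam * t))).
  apply: ccontM => //; apply: ccont_cis => t; apply: cvgN; exact: continuous_scale.
rewrite /u2 trans// {1}/L2 !mxE.
transitivity (L2 (U0 (mu lam) x) + Cint (- x) x (fun t => k2 (x, t) * cis (- (lam * t)))).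
  rewrite (@eq_Cint _ _ _ (fun t => k2 (x, t) * cis (- (lam * t)))
    (fun t => L2 (kernel_ext (x, t) *m U0 (mu lam) t))); last by move=> t _; rewrite L2M.
  by rewrite /L2 -l /U0 !mxE /=; ring.
rewrite L2U0 add0r.
have := @Cint_affine R 0 x 2 (- x) _ (ltr0Sn R 1) cc; rewrite mulr0 add0r.
have -> : 2 * x - x = x by ring.
move=> ->; rewrite [RHS]mulrCA (rmorph_nat (@real_complex R)); congr (_ * _).
rewrite -CintZ; last first.
  apply: ccont_cintg; apply: ccontM; last first.
    by apply: ccont_cis => t; apply: cvgN; exact: continuous_scale.
  apply: (@ccont2_comp _ _ f2 id (fun w => x - w)) => // t; first exact: cvg_id.
  by apply: cvgB; [exact: cvg_cst|exact: cvg_id].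
apply: eq_Cint => w _; rewrite mulrCA -cisD /f2 /=; congr (k2 (_, _) * cis _); ring.
Qed.

Lemma kernel_comb_Reg x : 0 < x <= b ->
  cReg (- x) x p.+1 (fun t => k1 (x, t)) /\ cReg (- x) x p.+1 (fun t => k2 (x, t)).
Proof.
move=> /andP[x0 xb]; have xb' : 0 <= x <= b by rewrite ltW.
have ca : ccont (fun t => qe t + e * pe t).
  by apply: ccontD => //; apply: ccontM => //; exact: ccont_cst.
have cc : ccont (fun t => qe t - e * pe t).
  by apply: ccontD => //; apply: ccontN; apply: ccontM => //; exact: ccont_cst.
have ra : cReg 0 b p.+1 (fun t => qe t + e * pe t) by apply: cRegD => //; exact: cRegZ.
have rc : cReg 0 b p.+1 (fun t => qe t - e * pe t).
  have := cRegD crqe (cRegZ (- e) crpe).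
  by apply: eq_cReg => t _; rewrite mulNr.
have g := zs_goursat b0 ca cc cf1 cf2 cu1 cu2 u10 u20 du1 du2 tr1 tr2.
have [[r1 i1] [r2 i2]] := complex_goursat_Reg b0' ca cc ra rc cf1 cf2 g xb'.
(* Back from w to t: w = (x + t) / 2 for [f2] and w = x - (x + t) / 2 for [f1], where [rf] supplies
   the reflection. *)
have af (h : R -> R) : Reg 0 x p.+1 h -> Reg (- x) x p.+1 (fun t => h (2^-1 * t + x / 2)).
  move=> rh; apply: Reg_affine; first by rewrite invr_gt0.
  by have -> : 2^-1 * - x + x / 2 = 0 by [field]; have -> : 2^-1 * x + x / 2 = x by field.
have rf (h : R -> R) : Reg 0 x p.+1 h -> Reg 0 x p.+1 (fun t => h (x - t)).
  by move=> /(Reg_refl x); rewrite subrr subr0.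
split; split.
- by apply: eq_Reg (af _ (rf _ r1)) => t _; rewrite /f1 /=; congr (Re (k1 (_, _))); field.
- by apply: eq_Reg (af _ (rf _ i1)) => t _; rewrite /f1 /=; congr (Im (k1 (_, _))); field.
- by apply: eq_Reg (af _ r2) => t _; rewrite /f2 /=; congr (Re (k2 (_, _))); field.
- by apply: eq_Reg (af _ i2) => t _; rewrite /f2 /=; congr (Im (k2 (_, _))); field.
Qed.

End Sign.

Lemma kernel_Reg x i j : 0 < x <= b -> cReg (- x) x p.+1 (fun t => K x t i j).
Proof.
move=> xb; have xb' : 0 <= x <= b by case/andP: xb => h ->; rewrite ltW.
have [P1 P2] := kernel_comb_Reg (s := 1) (or_introl erefl) xb.
have [N1 N2] := kernel_comb_Reg (s := -1) (or_intror erefl) xb.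
rewrite !mulr1 in P1 P2; rewrite rmorphN mulrN1 in N1 N2.
have ii : 'i%C * 'i%C = -1 :> R[i] by rewrite -expr2 sqr_i.
have comb (c1 c2 c3 c4 : R[i]) := cRegD (cRegD (cRegZ c1 P1) (cRegZ c2 N1)) (cRegD (cRegZ c3 P2) (cRegZ c4 N2)).
(* The sums P + N give the diagonal of K. The differences P1 - N1 and P2 - N2 are i (K01 - K10) and
   i (K01 + K10), and g = 1 / (2 i) undoes the factor. *)
pose h : R[i] := 2^-1; pose g : R[i] := - 'i%C * 2^-1.
have i0 : 'i%C != 0 :> R[i] by rewrite neq0Ci.
have E (F : R -> R[i]) : cReg (- x) x p.+1 F -> (forall t, F t = kernel_ext (x, t) i j) ->
    cReg (- x) x p.+1 (fun t => K x t i j).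
  by move=> hF eF; apply: eq_cReg hF => t tx; rewrite eF kernel_extE.
have I2 (k : 'I_2) : k = 0 \/ k = 1.
  by case: k => [[|[|]]] // ?; [left|right]; exact: val_inj.
have [ei|ei] := I2 i; have [ej|ej] := I2 j; rewrite ei ej in E *.
- by apply: (E _ (comb h h h h)) => t; rewrite /h; field.
- apply: (E _ (comb g (- g) g (- g))) => t; rewrite /g.
  transitivity (- ('i%C * 'i%C) * kernel_ext (x, t) 0 1); first by field.
  by rewrite ii opprK mul1r.
- apply: (E _ (comb (- g) g g (- g))) => t; rewrite /g.
  transitivity (- ('i%C * 'i%C) * kernel_ext (x, t) 1 0); first by field.
  by rewrite ii opprK mul1r.
- by apply: (E _ (comb h h (- h) (- h))) => t; rewrite /h; field.
Qed.

End TransmutationKernel.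

(** * Estimates *)

Section Estimates.
Variable R : realType.
Local Notation Re := (@complex.Re R).
Local Notation Im := (@complex.Im R).
Implicit Types (a b x t : R) (f g u : R -> R[i]) (z lam : R[i]) (n N : nat).
Local Notation P := (legendre R).

Definition cL2 a b f := inL2 a b (fun t => Re (f t)) /\ inL2 a b (fun t => Im (f t)).

Lemma ccont_cL2 a b f : ccont f -> cL2 a b f.
Proof. by move=> [f1 f2]; split; exact: inL2_cont. Qed.

Lemma cL2B a b f g : cL2 a b f -> cL2 a b g -> cL2 a b (fun t => f t - g t).
Proof.
move=> [f1 f2] [g1 g2]; split.
  by under eq_fun do rewrite cReD cReN; exact: inL2B.
by under eq_fun do rewrite cImD cImN; exact: inL2B.
Qed.

Lemma cintgM a b f g : cL2 a b f -> cL2 a b g -> cintg a b (fun t => f t * g t).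
Proof.
move=> [f1 f2] [g1 g2]; split.
  by under eq_fun do rewrite cReM; apply: intgB; exact: inL2M.
by under eq_fun do rewrite cImM; apply: intgD; exact: inL2M.
Qed.

Lemma cl1_Cint_le a b f g A W : cL2 a b f -> cL2 a b g ->
  n2 a b (fun t => Re (f t)) <= A -> n2 a b (fun t => Im (f t)) <= A ->
  n2 a b (fun t => Re (g t)) <= W -> n2 a b (fun t => Im (g t)) <= W ->
  cl1 (Cint a b (fun t => f t * g t)) <= 4 * (A * W).
Proof.
move=> [f1 f2] [g1 g2] A1 A2 W1 W2.
have cs (h k : R -> R) : inL2 a b h -> inL2 a b k -> n2 a b h <= A -> n2 a b k <= W ->
    `|Int a b (fun t => h t * k t)| <= A * W.
  move=> hh hk hA hW; apply: (le_trans (CauchySchwarz hh hk)).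
  by apply: ler_pM => //; exact: n2_ge0.
rewrite /cl1 /Cint /=.
rewrite (@eq_Int _ a b (fun t => Re (f t * g t)) (fun t => Re (f t) * Re (g t) - Im (f t) * Im (g t))); last first.
  by move=> t _; rewrite cReM.
rewrite (@eq_Int _ a b (fun t => Im (f t * g t)) (fun t => Re (f t) * Im (g t) + Im (f t) * Re (g t))); last first.
  by move=> t _; rewrite cImM.
rewrite IntB ?IntD; [|exact: inL2M..].
have h1 := cs _ _ f1 g1 A1 W1; have h2 := cs _ _ f2 g2 A2 W2.
have h3 := cs _ _ f1 g2 A1 W2; have h4 := cs _ _ f2 g1 A2 W1.
have h5 := ler_normB (Int a b (fun t => Re (f t) * Re (g t))) (Int a b (fun t => Im (f t) * Im (g t))).
have h6 := ler_normD (Int a b (fun t => Re (f t) * Im (g t))) (Int a b (fun t => Im (f t) * Re (g t))).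
lra.
Qed.

Lemma cexp_bound z : `|Re (cexp z)| <= expR (Re z) /\ `|Im (cexp z)| <= expR (Re z).
Proof.
rewrite /cexp cReM cImM /= !mul0r subr0 addr0 !normrM (ger0_norm (expR_ge0 _)).
by rewrite !ler_piMr ?expR_ge0// ler_norml ?cos_geN1 ?cos_le1 ?sin_geN1 ?sin_le1.
Qed.

Let cexp_i z : `|Re (cexp ('i%C * z))| <= expR `|Im z| /\ `|Im (cexp ('i%C * z))| <= expR `|Im z| /\
  `|Re (cexp (- ('i%C * z)))| <= expR `|Im z| /\ `|Im (cexp (- ('i%C * z)))| <= expR `|Im z|.
Proof.
have [h1 h2] := cexp_bound ('i%C * z); have [h3 h4] := cexp_bound (- ('i%C * z)).
have e : Re ('i%C * z) = - Im z by rewrite cReM /= mul0r mul1r sub0r.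
rewrite cReN e opprK in h3 h4; rewrite e in h1 h2.
have l1 : expR (- Im z) <= expR `|Im z| by rewrite ler_expR -normrN ler_norm.
have l2 : expR (Im z) <= expR `|Im z| by rewrite ler_expR ler_norm.
by split; [|split; [|split]]; [apply: le_trans l1|apply: le_trans l1|apply: le_trans l2|apply: le_trans l2].
Qed.

Lemma ccos_bound z : `|Re (ccos z)| <= expR `|Im z| /\ `|Im (ccos z)| <= expR `|Im z|.
Proof.
have [h1 [h2 [h3 h4]]] := cexp_i z.
have -> : ccos z = (2^-1)%:C * (cexp ('i%C * z) + cexp (- ('i%C * z))).
  by rewrite /ccos mulrC fmorphV rmorph_nat.
move: (cexp ('i%C * z)) (cexp (- ('i%C * z))) h1 h2 h3 h4 => c d h1 h2 h3 h4.
rewrite cReM cImM cReD cImD /= !mul0r subr0 addr0.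
by move: h1 h2 h3 h4; rewrite !ler_norml => /andP[? ?] /andP[? ?] /andP[? ?] /andP[? ?];
  split; apply/andP; split; lra.
Qed.

Lemma csin_bound z : `|Re (csin z)| <= expR `|Im z| /\ `|Im (csin z)| <= expR `|Im z|.
Proof.
have [h1 [h2 [h3 h4]]] := cexp_i z.
have i0 : 'i%C != 0 :> R[i] by rewrite neq0Ci.
have -> : csin z = (2^-1)%:C * (- 'i%C * (cexp ('i%C * z) - cexp (- ('i%C * z)))).
  rewrite /csin fmorphV rmorph_nat; move: (cexp (- ('i%C * z))) => d; move: (cexp _) => c.
  apply: (mulfI i0); transitivity (2^-1 * (c - d)); first by field; rewrite i0.
  transitivity (- ('i%C * 'i%C) * (2^-1 * (c - d))); last by ring.
  by rewrite -expr2 sqr_i opprK mul1r.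
move: (cexp ('i%C * z)) (cexp (- ('i%C * z))) h1 h2 h3 h4 => c d h1 h2 h3 h4.
rewrite !(cReM, cImM, cReD, cImD, cReN, cImN) /= !(oppr0, mul0r, subr0, addr0, add0r, sub0r).
by move: h1 h2 h3 h4; rewrite !ler_norml => /andP[? ?] /andP[? ?] /andP[? ?] /andP[? ?];
  split; apply/andP; split; lra.
Qed.

Lemma U0_bound lam t i j : `|Re (U0 lam t i j)| <= expR (`|Im lam| * `|t|) /\
  `|Im (U0 lam t i j)| <= expR (`|Im lam| * `|t|).
Proof.
have e : `|Im lam| * `|t| = `|Im (lam * t%:C)| by rewrite cImM /= mulr0 add0r normrM.
rewrite e mxE; have [h1 h2] := ccos_bound (lam * t%:C); have [h3 h4] := csin_bound (lam * t%:C).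
by case: (i == 0); case: (j == 0); rewrite ?cReN ?cImN ?normrN.
Qed.

(** A common bound for the L^2 norms of the entries of [U0]; its values in [weight_real] and
    [weight_nonreal] are the factors in the two parts of the theorem. *)
Definition weight lam x : R := n2 (- x) x (fun t => expR (`|Im lam| * `|t|)).

Let cw lam : continuous (fun t : R => expR (`|Im lam| * `|t|)).
Proof.
move=> t; apply: (@continuous_comp _ _ _ (fun t => `|Im lam| * `|t|) expR); last exact: continuous_expR.
apply: (@continuous_comp _ _ _ (fun t : R => `|t|) (fun y => `|Im lam| * y)).
  exact: norm_continuous.
exact: continuous_scale.
Qed.

Lemma n2_U0 lam x i j : n2 (- x) x (fun t => Re (U0 lam t i j)) <= weight lam x /\
  n2 (- x) x (fun t => Im (U0 lam t i j)) <= weight lam x.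
Proof.
have [c1 c2] := ccont_cL2 (- x) x (ccont_U0 lam i j).
have [_ cw2] := inL2_cont (- x) x (@cw lam).
have sq (a c : R) : `|a| <= c -> a ^+ 2 <= c ^+ 2.
  by move=> ac; rewrite -(real_normK (num_real a)) lerXn2r ?nnegrE// (le_trans _ ac).
by split; apply: ler_wsqrtr; apply: le_Int => //; [case: c1|move=> t _|case: c2|move=> t _];
  try (by []); apply: sq; have [] := U0_bound lam t i j.
Qed.

Lemma weight_real lam x : 0 < x -> Im lam = 0 -> weight lam x = Num.sqrt (2 * x).
Proof.
move=> x0 l0; rewrite /weight /n2; congr Num.sqrt.
rewrite (@eq_Int _ _ _ _ (fun=> 1)); first by rewrite Int_cst; lra.
by move=> t _; rewrite l0 normr0 mul0r expR0 expr1n.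
Qed.

Lemma weight_nonreal lam x : 0 < x -> Im lam != 0 ->
  weight lam x = Num.sqrt ((expR (2 * `|Im lam| * x) - 1) / `|Im lam|).
Proof.
move=> x0 l0; rewrite /weight /n2; congr Num.sqrt; set y := `|Im lam|.
have y0 : 0 < y by rewrite normr_gt0.
have [_ ci] := inL2_cont (- x) x (@cw lam); rewrite -/y in ci.
have xx : - x <= 0 by rewrite oppr_le0 ltW.
rewrite (Int_chasles xx (ltW x0) ci).
have half : Int 0 x (fun t => expR (y * `|t|) ^+ 2) = (expR (2 * y * x) - 1) / (2 * y).
  rewrite (@eq_Int _ 0 x _ (fun t => expR (2 * y * t))); last first.
    by move=> t /andP[t0 _]; rewrite ger0_norm// -expRM_natl mulrA [2%:R * y]mulrC.
  have cE : continuous (fun t => expR (2 * y * t)).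
    by move=> t; apply: continuous_comp; [exact: continuous_scale|exact: continuous_expR].
  have -> : Int 0 x (fun t => expR (2 * y * t)) = expR (2 * y * x) / (2 * y) - expR (2 * y * 0) / (2 * y).
    apply: (Int_FTC (F := fun t => expR (2 * y * t) / (2 * y))); first exact: ltW.
    - by apply: continuous_subspaceT => t; apply: cvgMr_tmp; exact: cE.
    - by apply: continuous_subspaceT => t; exact: cE.
    - move=> t _.
      have h : is_derive t 1 (fun s => expR (2 * y * s)) (expR (2 * y * t) * (2 * y)).
        apply: (is_derive1_comp (is_derive_expR (2 * y * t))).
        by apply: is_derive_eq; rewrite scaler1.
      apply: is_derive_eq; rewrite /GRing.scale /=; field; exact: lt0r_neq0.
  by rewrite mulr0 expR0; field; exact: lt0r_neq0.
have -> : Int (- x) 0 (fun t => expR (y * `|t|) ^+ 2) = Int 0 x (fun t => expR (y * `|t|) ^+ 2).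
  have := @Int_refl R 0 (- x) 0 (fun t => expR (y * `|t|) ^+ 2).
  rewrite subrr sub0r opprK => <-; last by apply: intgS ci => //; exact: ltW.
  by apply: eq_Int => t _; rewrite sub0r normrN.
by rewrite half; field; exact: lt0r_neq0.
Qed.

Lemma Cint_scale x f : 0 < x -> cintg (- x) x f ->
  Cint (- x) x f = x%:C * Cint (-1) 1 (fun s => f (x * s)).
Proof.
move=> x0 [f1 f2]; apply: complex_eq; rewrite ?cReM ?cImM /= !mul0r ?subr0 ?addr0.
  exact: (Int_scale x0 f1).
exact: (Int_scale x0 f2).
Qed.

Definition clcoef f n : R[i] := lcoef (fun t => Re (f t)) n +i* lcoef (fun t => Im (f t)) n.

Definition clproj N x f t : R[i] :=
  \sum_(n < N.+1) clcoef (fun s => f (x * s)) n * ((P n).[t / x])%:C.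

Lemma clproj_parts N x f t :
  Re (clproj N x f t) = (lproj N (fun s => Re (f (x * s)))).[t / x] /\
  Im (clproj N x f t) = (lproj N (fun s => Im (f (x * s)))).[t / x].
Proof.
rewrite /clproj Re_sum Im_sum /lproj !horner_sum.
by split; apply: eq_bigr => n _; rewrite ?cReM ?cImM /= [in RHS]hornerZ !mulr0 ?subr0 ?add0r.
Qed.

Lemma continuous_legendre_scale n x : continuous (fun t : R => (P n).[t / x]).
Proof.
move=> t; apply: (@continuous_comp _ _ _ (fun t : R => t / x) (horner (P n))).
  by apply: cvgMr_tmp; exact: cvg_id.
exact: continuous_horner.
Qed.

Lemma clcoefE x f n : 0 < x -> cL2 (- x) x f ->
  x%:C * clcoef (fun s => f (x * s)) n =
  (2 * n + 1)%:R / 2 * Cint (- x) x (fun t => ((P n).[t / x])%:C * f t).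
Proof.
move=> x0 hf.
have cP : cL2 (- x) x (fun t => ((P n).[t / x])%:C).
  by apply: ccont_cL2; apply: ccont_real; exact: continuous_legendre_scale.
rewrite (Cint_scale x0 (cintgM cP hf)) mulrCA; congr (_ * _).
have -> : (2 * n + 1)%:R / 2 = ((2 * n + 1)%:R / 2)%:C :> R[i].
  by rewrite rmorphM fmorphV !rmorph_nat.
have e s : x * s / x = s by rewrite mulrAC mulfV ?mul1r// lt0r_neq0.
have n0 : (2 * n + 1)%:R != 0 :> R by rewrite pnatr_eq0 addn1.
apply: complex_eq; rewrite ?cReM ?cImM /= !mul0r ?subr0 ?addr0 /lcoef invf_div mulrC; congr (_ * _);
  apply: eq_Int => s _; rewrite e ?cReM ?cImM /= mul0r ?subr0 ?addr0; exact: mulrC.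
Qed.

Lemma Cint_clproj N x f u (J : nat -> R[i]) : 0 < x -> cL2 (- x) x f -> ccont u ->
  (forall n, Cint (- x) x (fun t => ((P n).[t / x])%:C * u t) = x%:C * J n) ->
  Cint (- x) x (fun t => clproj N x f t * u t) =
  \sum_(n < N.+1) (2 * n + 1)%:R / 2 * Cint (- x) x (fun t => ((P n).[t / x])%:C * f t) * J n.
Proof.
move=> x0 hf cu hJ; rewrite /clproj.
have cP n : ccont (fun t => ((P n).[t / x])%:C * u t).
  by apply: ccontM => //; apply: ccont_real; exact: continuous_legendre_scale.
rewrite (@eq_Cint _ _ _ _ (fun t => \sum_(n < N.+1)
    clcoef (fun s => f (x * s)) n * (((P n).[t / x])%:C * u t))); last first.
  by move=> t _; rewrite mulr_suml; apply: eq_bigr => n _; rewrite mulrA.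
elim: N.+1 => [|m ih].
  by rewrite big_ord0; under [X in Cint _ _ X]eq_fun do rewrite big_ord0; rewrite Cint0.
rewrite big_ord_recr -ih /=; under [X in Cint _ _ X]eq_fun do rewrite big_ord_recr /=.
have cZ n : ccont (fun t => clcoef (fun s => f (x * s)) n * (((P n).[t / x])%:C * u t)).
  by apply: ccontM => //; exact: ccont_cst.
rewrite CintD; [|apply: ccont_cintg|exact: ccont_cintg]; last first.
  exact: (@ccont_sum _ _ m (fun n t => clcoef (fun s => f (x * s)) n * (((P n).[t / x])%:C * u t))).
rewrite CintZ ?hJ; last exact: ccont_cintg.
by congr (_ + _); rewrite -clcoefE// mulrCA mulrA.
Qed.

Lemma legendre_U0 n x lam : 0 < x ->
  Cint (- x) x (fun t => ((P n).[t / x])%:C * ccos (lam * t%:C)) =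
    x%:C * (if odd n then 0 else 2 * (-1) ^+ n./2 * sph_bessel n (lam * x%:C)) /\
  Cint (- x) x (fun t => ((P n).[t / x])%:C * csin (lam * t%:C)) =
    x%:C * (if odd n then 2 * (-1) ^+ n./2 * sph_bessel n (lam * x%:C) else 0).
Proof.
move=> x0; rewrite -legendre_ccos -legendre_csin.
have cP : ccont (fun t => ((P n).[t / x])%:C) by apply: ccont_real; exact: continuous_legendre_scale.
have cc : ccont (fun t : R => ccos (lam * t%:C)).
  have := ccont_U0 lam 0 0; by under eq_fun do rewrite mxE /=.
have cs : ccont (fun t : R => csin (lam * t%:C)).
  have := ccont_U0 lam 1 0; by under eq_fun do rewrite mxE /=.
have e s : x * s / x = s by rewrite mulrAC mulfV ?mul1r// lt0r_neq0.
split; rewrite Cint_scale//; try (by apply: ccont_cintg; exact: ccontM);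
  by congr (_ * _); apply: eq_Cint => s _; rewrite e rmorphM /= (mulrA lam).
Qed.

End Estimates.

(** * The truncation error as an integral of the kernel remainder *)

Section Truncation.
Variables (R : realType) (K : R -> R -> 'M[R[i]]_2) (x : R).
Hypothesis x0 : 0 < x.
Hypothesis hK : forall i j, cL2 (- x) x (fun t => K x t i j).
Local Notation Re := (@complex.Re R).
Local Notation Im := (@complex.Im R).
Implicit Types (lam : R[i]) (n N : nat) (i j k : 'I_2).

Let cP n : ccont (fun t : R => ((legendre R n).[t / x])%:C).
Proof. by apply: ccont_real; exact: continuous_legendre_scale. Qed.

Lemma KcoefE n i j : Kcoef K n x i j =
  (2 * n + 1)%:R / 2 * Cint (- x) x (fun t => ((legendre R n).[t / x])%:C * K x t i j).
Proof.
rewrite /Kcoef mxE mx_intE; last first.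
  move=> k l; under eq_fun do rewrite mxE.
  by apply: cintgM => //; exact: ccont_cL2.
by rewrite mxE; congr (_ * _); apply: eq_Cint => t _; rewrite mxE.
Qed.

Definition kernel_rem N i k t : R[i] := K x t i k - clproj N x (fun t => K x t i k) t.

Lemma ccont_clproj N (f : R -> R[i]) : ccont (clproj N x f).
Proof.
have h n : ccont (fun t : R => clcoef (fun s => f (x * s)) n * ((legendre R n).[t / x])%:C).
  by apply: ccontM; [exact: ccont_cst|exact: cP].
exact: (@ccont_sum _ _ N.+1 _ h).
Qed.

Lemma cL2_kernel_rem N i k : cL2 (- x) x (kernel_rem N i k).
Proof. by apply: cL2B => //; apply: ccont_cL2; exact: ccont_clproj. Qed.

(** The integral of P_n(t / x) against entry (k, j) of [U0], divided by x. By parity the cosines on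
    the diagonal survive for even n and the sines off it for odd n. *)
Let J lam k j n : R[i] :=
  if odd n then
    if k == j then 0 else (if k == 0 then -1 else 1) * (2 * (-1) ^+ n./2 * sph_bessel n (lam * x%:C))
  else if k == j then 2 * (-1) ^+ n./2 * sph_bessel n (lam * x%:C) else 0.

Let I2 k : k = 0 \/ k = 1.
Proof. by case: k => [[|[|]]] // ?; [left|right]; exact: val_inj. Qed.

Let JE lam k j n :
  Cint (- x) x (fun t => ((legendre R n).[t / x])%:C * U0 lam t k j) = x%:C * J lam k j n.
Proof.
have [hc hs] := legendre_U0 n lam x0.
have cs : cintg (- x) x (fun t => ((legendre R n).[t / x])%:C * csin (lam * t%:C)).
  apply: cintgM; first exact: ccont_cL2.
  have := ccont_cL2 (- x) x (ccont_U0 lam 1 0); by under eq_fun do rewrite mxE /=.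
have hs' : Cint (- x) x (fun t => ((legendre R n).[t / x])%:C * - csin (lam * t%:C)) =
    x%:C * (- (if odd n then 2 * (-1) ^+ n./2 * sph_bessel n (lam * x%:C) else 0)).
  rewrite mulrN -hs -mulN1r -CintZ//; apply: eq_Cint => t _; ring.
rewrite /J; have [->|->] := I2 k; have [->|->] := I2 j.
- by rewrite (eq_Cint (g := fun t => ((legendre R n).[t / x])%:C * ccos (lam * t%:C))) => [|t _]; rewrite ?hc ?mxE.
- rewrite (eq_Cint (g := fun t => ((legendre R n).[t / x])%:C * - csin (lam * t%:C))) => [|t _]; rewrite ?mxE// hs'.
  by case: ifP; rewrite ?mulN1r ?oppr0.
- rewrite (eq_Cint (g := fun t => ((legendre R n).[t / x])%:C * csin (lam * t%:C))) => [|t _]; rewrite ?mxE// hs.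
  by case: ifP; rewrite ?mul1r.
- by rewrite (eq_Cint (g := fun t => ((legendre R n).[t / x])%:C * ccos (lam * t%:C))) => [|t _]; rewrite ?hc ?mxE.
Qed.

(** For odd n the sine entries of [U0] form the pattern of -B, whence the right factor B and the
    sign (-1)^((n + 1) / 2) in [Ktilde]. *)
Let KtildeE lam n i j : sph_bessel n (lam * x%:C) * Ktilde K n x i j =
  Kcoef K n x i 0 * J lam 0 j n + Kcoef K n x i 1 * J lam 1 j n.
Proof.
rewrite /Ktilde /J; case: ifPn => on; rewrite mxE; last first.
  by have [->|->] := I2 j; rewrite /= ?mulr0 ?addr0 ?add0r; ring.
have -> : (n.+1)./2 = (n./2).+1 by rewrite -uphalfE uphalf_half on.
by rewrite mulmx2E /Bmx !mxE exprS; have [->|->] := I2 j; rewrite /= ?mulr0 ?addr0 ?add0r; ring.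
Qed.

Lemma UN_error N lam i j :
  (U0 lam x + mx_int (- x) x (fun t => K x t *m U0 lam t) - UN K N lam x) i j =
  Cint (- x) x (fun t => kernel_rem N i 0 t * U0 lam t 0 j) +
  Cint (- x) x (fun t => kernel_rem N i 1 t * U0 lam t 1 j).
Proof.
have cU k : cL2 (- x) x (fun t => U0 lam t k j) by apply: ccont_cL2; exact: ccont_U0.
have cS k : cL2 (- x) x (clproj N x (fun t => K x t i k)).
  by apply: ccont_cL2; exact: ccont_clproj.
have e k : Cint (- x) x (fun t => kernel_rem N i k t * U0 lam t k j) =
    Cint (- x) x (fun t => K x t i k * U0 lam t k j) -
    \sum_(n < N.+1) Kcoef K n x i k * J lam k j n.
  have -> : \sum_(n < N.+1) Kcoef K n x i k * J lam k j n =
      Cint (- x) x (fun t => clproj N x (fun t => K x t i k) t * U0 lam t k j).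
    rewrite (Cint_clproj N (f := fun t => K x t i k) x0 (hK i k) (ccont_U0 lam k j) (JE lam k j)).
    by apply: eq_bigr => n _; rewrite KcoefE.
  rewrite -CintB; [|exact: cintgM..].
  by apply: eq_Cint => t _; rewrite /kernel_rem mulrBl.
have hm k l : cintg (- x) x (fun t => (K x t *m U0 lam t) k l).
  have [c1 c2] := cintgM (hK k 0) (ccont_cL2 (- x) x (ccont_U0 lam 0 l)).
  have [c3 c4] := cintgM (hK k 1) (ccont_cL2 (- x) x (ccont_U0 lam 1 l)).
  split.
    by under eq_fun do rewrite mulmx2E cReD; exact: intgD.
  by under eq_fun do rewrite mulmx2E cImD; exact: intgD.
rewrite !e (mx_intE hm) /UN opprD addrACA subrr add0r mxE [X in _ + X]mxE [X in X - _]mxE summxE.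
rewrite (@eq_Cint _ _ _ _ (fun t => K x t i 0 * U0 lam t 0 j + K x t i 1 * U0 lam t 1 j)); last first.
  by move=> t _; rewrite mulmx2E.
rewrite CintD; [|exact: cintgM..].
rewrite (eq_bigr (fun n : 'I_N.+1 => Kcoef K n x i 0 * J lam 0 j n + Kcoef K n x i 1 * J lam 1 j n)).
  by rewrite big_split /=; ring.
by move=> n _; rewrite mxE KtildeE.
Qed.

(** Each complex integral costs a factor 4, each entry is a sum of two of them, there are four
    entries, and [opnorm_le_cl1] adds a factor 2: together 64. *)
Lemma UN_error_bound N lam A :
  (forall i k, n2 (- x) x (fun t => Re (kernel_rem N i k t)) <= A /\
               n2 (- x) x (fun t => Im (kernel_rem N i k t)) <= A) ->
  opnorm (U0 lam x + mx_int (- x) x (fun t => K x t *m U0 lam t) - UN K N lam x) <=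
  64 * (A * weight lam x).
Proof.
move=> hA; set E := _ - _.
have bE i j : cl1 (E i j) <= 8 * (A * weight lam x).
  rewrite /E UN_error; apply: (le_trans (cl1D _ _)).
  have b k : cl1 (Cint (- x) x (fun t => kernel_rem N i k t * U0 lam t k j)) <= 4 * (A * weight lam x).
    have [a1 a2] := hA i k; have [u1 u2] := n2_U0 lam x k j.
    by apply: cl1_Cint_le => //; [exact: cL2_kernel_rem|apply: ccont_cL2; exact: ccont_U0].
  by have := b 0; have := b 1; lra.
apply: (le_trans (opnorm_le_cl1 E)); rewrite !I2_sum.
by have := bE 0 0; have := bE 0 1; have := bE 1 0; have := bE 1 1; lra.
Qed.

End Truncation.

Theorem theorem4p10 (R : realType) (p : nat) :
  exists C1 : R,
  forall (b : R) (p1 q1 : R -> R[i]) (U : R[i] -> R -> 'M[R[i]]_2)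
         (K : R -> R -> 'M[R[i]]_2),
    0 < b ->
    sobolev p.+1 0 b (Qmx p1 q1) ->
    is_dirac_solution b (Qmx p1 q1) U ->
    is_transmutation_kernel b U K ->
  forall x : R, 0 < x <= b ->
  exists DK : R -> 'M[R[i]]_2,
    is_L2_weak_derive p.+1 (- x) x (K x) DK /\
    forall N : nat, (p + 1 < N)%N ->
    let eps := C1 * x ^+ p.+1 / N%:R ^+ p.+1 * L2norm (- x) x DK in
    (forall lam : R,
       opnorm (U lam%:C x - UN K N lam%:C x) <= Num.sqrt (2 * x) * eps) /\
    (forall lam : R[i], complex.Im lam != 0 ->
       opnorm (U lam x - UN K N lam x) <=
       eps * Num.sqrt ((expR (2 * `|complex.Im lam| * x) - 1)
                       / `|complex.Im lam|)).
Proof.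
(* The factor 64 is that of [UN_error_bound]; the power is the price of replacing N - p by N in
   [rate]. *)
exists (64 * (p.+1)%:R ^+ p.+1) => b p1 q1 U K b0 sob sol ker x xb.
have [x0 _] := andP xb; have xx : - x <= x by rewrite ge0_cp// ltW.
set m := p.+1.
have reg i j := kernel_Reg b0 sob sol ker i j xb.
have hK i j : cL2 (- x) x (fun t => K x t i j).
  by have [h1 h2] := reg i j; split; [exact: Reg_inL2 h1|exact: Reg_inL2 h2].
have /choice[D hD] : forall ij : 'I_2 * 'I_2, exists D : R -> R[i],
    Chain (- x) x m (fun t => complex.Re (K x t ij.1 ij.2)) (fun t => complex.Re (D t)) /\
    Chain (- x) x m (fun t => complex.Im (K x t ij.1 ij.2)) (fun t => complex.Im (D t)).
  move=> ij; have [/Reg_Chain[D1 h1] /Reg_Chain[D2 h2]] := reg ij.1 ij.2.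
  by exists (fun t => D1 t +i* D2 t).
pose DK t : 'M[R[i]]_2 := \matrix_(i, j) D (i, j) t.
have cDK i j : Chain (- x) x m (fun t => complex.Re (K x t i j)) (fun t => complex.Re (DK t i j)) /\
    Chain (- x) x m (fun t => complex.Im (K x t i j)) (fun t => complex.Im (DK t i j)).
  have [h1 h2] := hD (i, j).
  by split; [under [X in Chain _ _ _ _ X]eq_fun do rewrite mxE|
             under [X in Chain _ _ _ _ X]eq_fun do rewrite mxE].
have DL2 : componentwise (inL2 (- x) x) DK.
  by move=> i j; have [h1 h2] := cDK i j; split; [exact: Chain_top h1|exact: Chain_top h2].
have inDK := inL2_in_L2 DL2.
exists DK; split.
  split=> // phi tphi; have [dphi _] := tphi.
  have cphi k : continuous (derive1n k phi) by apply: derivable_cont; exact: dphi.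
  have cc k (f : R -> R[i]) : cL2 (- x) x f -> cintg (- x) x (fun t => (derive1n k phi t)%:C * f t).
    by move=> hf; apply: cintgM => //; apply: ccont_cL2; exact: ccont_real.
  rewrite mx_intE; last by move=> i j; under eq_fun do rewrite mxE; exact: cc.
  rewrite mx_intE; last first.
    by move=> i j; under eq_fun do rewrite mxE; apply: (cc 0%N); exact: DL2.
  apply/matrixP => i j; rewrite mxE [RHS]mxE [X in _ * X]mxE.
  have [h1 h2] := cDK i j.
  have w1 := Chain_weak xx h1 tphi; have w2 := Chain_weak xx h2 tphi.
  have -> : (-1) ^+ m = ((-1) ^+ m)%:C :> R[i] by rewrite rmorphXn rmorphN1.
  apply: complex_eq; rewrite ?cReM ?cImM /= !mul0r ?subr0 ?addr0.
    transitivity (Int (- x) x (fun t => derive1n m phi t * complex.Re (K x t i j))).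
      by apply: eq_Int => t _; rewrite mxE cReM /= mul0r subr0.
    by rewrite w1; congr (_ * _); apply: eq_Int => t _; rewrite [in RHS]mxE cReM /= mul0r subr0.
  transitivity (Int (- x) x (fun t => derive1n m phi t * complex.Im (K x t i j))).
    by apply: eq_Int => t _; rewrite mxE cImM /= mul0r addr0.
  by rewrite w2; congr (_ * _); apply: eq_Int => t _; rewrite [in RHS]mxE cImM /= mul0r addr0.
move=> N; rewrite addn1 -/m => mN eps.
pose A := m%:R ^+ m * x ^+ m / N%:R ^+ m * L2norm (- x) x DK.
have N0 : (0 < N)%N by exact: leq_trans mN.
(* [legendre_approx] is used with K = N - m, and N <= m (N - m + 1) because m >= 1 and N > m. *)
have rate : (x / (N - m).+1%:R) ^+ m <= m%:R ^+ m * x ^+ m / N%:R ^+ m.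
  rewrite -exprMn -expr_div_n lerXn2r ?nnegrE ?divr_ge0 ?mulr_ge0 ?(ltW x0)//.
  have le : N%:R <= m%:R * (N - m).+1%:R :> R.
    rewrite -natrM ler_nat -{1}(subnK (ltnW mN)).
    by move: (N - m)%N => k; rewrite /m; nia.
  rewrite ler_pdivrMr ?ltr0n// mulrAC ler_pdivlMr ?ltr0n// [m%:R * x]mulrC -mulrA.
  by rewrite ler_pM2l.
have hA i k : n2 (- x) x (fun t => complex.Re (kernel_rem K x N i k t)) <= A /\
              n2 (- x) x (fun t => complex.Im (kernel_rem K x N i k t)) <= A.
  have [h1 h2] := cDK i k; have [l1 l2] := n2_le_L2norm i k inDK.
  have r0 : 0 <= (x / (N - m).+1%:R) ^+ m by rewrite exprn_ge0// divr_ge0// ltW.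
  have a1 := legendre_approx (N - m) x0 h1; have a2 := legendre_approx (N - m) x0 h2.
  rewrite subnK in a1; last exact: ltnW. rewrite subnK in a2; last exact: ltnW.
  split.
    rewrite /kernel_rem; under eq_fun do rewrite cReD cReN (proj1 (clproj_parts _ _ _ _)).
    by apply: (le_trans a1); apply: ler_pM => //; exact: n2_ge0.
  rewrite /kernel_rem; under eq_fun do rewrite cImD cImN (proj2 (clproj_parts _ _ _ _)).
  by apply: (le_trans a2); apply: ler_pM => //; exact: n2_ge0.
have [_ hU] := ker.
have bound (lam : R[i]) : opnorm (U lam x - UN K N lam x) <= weight lam x * eps.
  rewrite (hU lam x xb); apply: (le_trans (UN_error_bound x0 hK lam hA)).
  by rewrite le_eqVlt; apply/orP; left; apply/eqP; rewrite /A /eps; ring.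
split=> lam; first by rewrite -(weight_real (lam := lam%:C) x0).
by move=> l0; rewrite -(weight_nonreal x0 l0) mulrC.
Qed.
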